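(* Let $x_0\in\mathcal U$ be a non-singular point of the system $\frac{dy}{dx}=A(x)y$, let $k\ge 2$, and let $r_1,\ldots,r_k$ be positive integers with $r_1+\cdots+r_k=n$. The following are equivalent: (a) There is a decomposer symmetry $Y\in\mathbf{sym}^1_X(\mathcal K)$ with $k$ different eigenvalues of multiplicities $r_1,\ldots,r_k$. (b) The Galois group $\mathrm{Gal}(x_0,X)$ is conjugated (in $\mathrm{GL}(n,\mathbb C)$) to a subgroup of the group of block-diagonal matrices $\mathrm{GL}(r_1,\mathbb C)\times\cdots\times\mathrm{GL}(r_k,\mathbb C)$.
   Context: Let $\mathcal U$ be a nonempty connected open subset of $\mathbb{CP}_1$ with affine coordinate $x$. A function field $\mathcal K$ is a subfield of the field of meromorphic functions on $\mathcal U$ that contains the constants $\mathbb C$ and is closed under $\frac{d}{dx}$; fix one. Fix $n\ge 1$ and $A(x)=(a_{ij}(x))\in\mathfrak{gl}(n,\mathcal K)$, and consider the linear system $\frac{dy}{dx}=A(x)y$, $y=(y_1,\ldots,y_n)$, with associated meromorphic vector field on $\mathcal U\times\mathbb C^n$ $$X=\frac{\partial}{\partial x}+\sum_{i,j=1}^n a_{ij}(x)y_j\frac{\partial}{\partial y_i}.$$ The singularities of the system are the poles of $A(x)$; the point at infinity (if in $\mathcal U$) counts as a singularity if the system rewritten in the coordinate $t=1/x$ has a pole at $t=0$. Linear symmetries: $\mathbf{sym}^1_X(\mathcal K)$ is the set of vector fields $Y=\sum_{i,j}b_{ij}(x)y_j\frac{\partial}{\partial y_i}$ with $b_{ij}\in\mathcal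 K$ and $[X,Y]=0$; equivalently the matrix $B(x)=(b_{ij}(x))$ of $Y$ satisfies $\frac{dB}{dx}=[A(x),B]$. The Jordan canonical form of such a $B(x)$ does not depend on the point $x$; the eigenvalues of $Y$ and their (algebraic) multiplicities are those of $B(x)$. $Y$ is a decomposer symmetry if $B(x)$ has at least two different eigenvalues. Galois group: for a finite-dimensional complex (algebraic) linear representation $\Psi:\mathrm{GL}(n,\mathbb C)\to\mathrm{GL}(E)$ with differential $\Psi':\mathfrak{gl}(n,\mathbb C)\to\mathrm{End}(E)$, the induced Lie--Vessiot system is $\frac{dv}{dx}=\Psi'(A(x))(v)$. A $\mathcal K$-rational solution is a solution $v(x)\in E\otimes_{\mathbb C}\mathcal K$. A $\mathcal K$-exponential pre-solution is an element $w(x)\in E\otimes_{\mathbb C}\mathcal K$ for which there is $b(x)\in\mathcal K$ with $\frac{dw}{dx}-\Psi'(A(x))(w)=-b(x)w$. For a non-singular point $x_0\in\mathcal U$, a matrix $\sigma\in\mathrm{GL}(n,\mathbb C)$ is Galoisian at $x_0$ if for every such representation $(E,\Psi)$: (a) $\Psi(\sigma)(v(x_0))=v(x_0)$ for every $\mathcal K$-rational solution $v(x)$ of the induced Lie--Vessiot system; (b) for every $\mathcal K$-exponential pre-solution $w(x)$ of the induced Lie--Vessiot system such that $w(x_0)$ is well defined, $\Psi(\sigma)(w(x_0))\in\mathbb C\,w(x_0)$. The Galoisian matrices at $x_0$ form the Galois group $\mathrm{Gal}(x_0,X)\subseteq\mathrm{GL}(n,\mathbb C)$. *)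

(* Defs.v *)
From HB Require Import structures.
From mathcomp Require Import all_boot all_order all_algebra.
From mathcomp Require Import complex.
From mathcomp Require Import all_classical all_reals.
From mathcomp Require Import topology normedtype derive.

Set Implicit Arguments.
Unset Strict Implicit.
Unset Printing Implicit Defensive.

Import Order.TTheory GRing.Theory Num.Theory.
Import numFieldNormedType.Exports.

Local Open Scope classical_set_scope.
Local Open Scope ring_scope.

(* The complex numbers, packed as a numClosedFieldType so that the topological
   and normed-module structures of MathComp-Analysis apply; all derivatives
   below are then complex derivatives. *)
Definition C (R : realType) : numClosedFieldType := R[i].

Definition CP1 (R : realType) : topologicalType :=
  one_point_compactification (C R).

Section Meromorphic.
Variable R : realType.
Local Notation C := (C R).
Local Notation CP1 := (CP1 R).
Implicit Types (U : set CP1) (p : CP1) (a : C) (f g : C -> C).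

(* Punctured neighbourhoods of p, read in the affine coordinate x.  At the point
   at infinity x = 1/t with t -> 0. *)
Definition pnbhs p : set_system C :=
  if p is Some a then a^' else (fun t : C => t^-1) @ 0^'.

(* P holds on U outside a subset without accumulation point in U. *)
Definition generically U (P : C -> Prop) : Prop :=
  forall p, U p -> \forall x \near pnbhs p, P x.

(* A meromorphic function is represented by any total function of the affine
   coordinate that agrees with it generically: the values at isolated points
   are irrelevant, and so is the convention 0^-1 = 0. *)

(* f has at worst a removable singularity at a, i.e. no pole. *)
Definition regular_at f a : Prop :=
  exists h : C -> C, (\forall z \near a, derivable h z 1) /\
                     (\forall z \near a^', f z = h z).

Definition meromorphic_at f a : Prop :=
  exists k : nat, regular_at (fun z => (z - a) ^+ k * f z) a.

Definition meromorphic_on U f : Prop :=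
  forall p, U p ->
    if p is Some a then meromorphic_at f a
    else meromorphic_at (fun t => f t^-1) 0.

(* A differential subfield of the field of meromorphic functions on U that
   contains the constants, as the set of all representatives of its elements. *)
Record function_field U (K : set (C -> C)) : Prop := FunctionField {
  ff_meromorphic : forall f, K f -> meromorphic_on U f;
  ff_saturated : forall f g, K f -> generically U (fun x => g x = f x) -> K g;
  ff_cst : forall c : C, K (fun=> c);
  ff_add : forall f g, K f -> K g -> K (fun x => f x + g x);
  ff_opp : forall f, K f -> K (fun x => - f x);
  ff_mul : forall f g, K f -> K g -> K (fun x => f x * g x);
  ff_inv : forall f, K f -> K (fun x => (f x)^-1);
  ff_derive : forall f, K f -> K (derive1 f)
}.

Definition mx_over (K : set (C -> C)) m n (M : C -> 'M[C]_(m, n)) : Prop :=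
  forall i j, K (fun x => M x i j).

End Meromorphic.

Section LinearSystem.
Variables (R : realType) (n : nat).
Local Notation C := (C R).
Local Notation CP1 := (CP1 R).
Implicit Types (U : set CP1) (K : set (C -> C)) (A B : C -> 'M[C]_n).

(* With t = 1/x the system dy/dx = A(x) y becomes dy/dt = - t^-2 A(1/t) y. *)
Definition nonsingular A (x0 : CP1) : Prop :=
  forall i j,
    if x0 is Some a then regular_at (fun x => A x i j) a
    else regular_at (fun t => - (t ^- 2) * A t^-1 i j) 0.

(* Vector fields on C x C^n, given by their components. *)
Definition vfield := (C * 'cV[C]_n)%type -> (C * 'cV[C]_n)%type.

Definition lie_bracket (X Y : vfield) : vfield :=
  fun q => 'D_(X q) Y q - 'D_(Y q) X q.

(* d/dx + sum a_ij(x) y_j d/dy_i *)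
Definition system_vfield A : vfield := fun q => (1, A q.1 *m q.2).

(* sum b_ij(x) y_j d/dy_i *)
Definition linear_vfield B : vfield := fun q => (0, B q.1 *m q.2).

(* A linear vector field is given by its matrix B. *)
Definition sym1 U K A B : Prop :=
  mx_over K B /\
  generically U (fun x => forall y : 'cV[C]_n,
    lie_bracket (system_vfield A) (linear_vfield B) (x, y) = 0).

(* The eigenvalues of a symmetry and their multiplicities do not depend on x. *)
Definition sym_eigenvalue U B (c : C) : Prop :=
  generically U (fun x => eigenvalue (B x) c).

Definition sym_multiplicity U B (c : C) (r : nat) : Prop :=
  generically U (fun x => mup c (char_poly (B x)) = r).

Definition decomposer_symmetry U K A B : Prop :=
  sym1 U K A B /\
  exists c d, [/\ c != d, sym_eigenvalue U B c & sym_eigenvalue U B d].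

(* The eigenvalues are exactly the k distinct numbers l i, with multiplicities
   r i. *)
Definition has_spectrum U B k (r : 'I_k -> nat) : Prop :=
  exists l : 'I_k -> C,
    [/\ injective l,
        forall c, sym_eigenvalue U B c <-> exists i, c = l i
      & forall i, sym_multiplicity U B (l i) (r i)].

End LinearSystem.

Section GaloisGroup.
Variables (R : realType) (n : nat).
Local Notation C := (C R).
Local Notation CP1 := (CP1 R).

(* The coordinate ring C[x_ij, 1/det] of GL(n, C), as functions of the matrix. *)
Inductive regular_fun : ('M[C]_n -> C) -> Prop :=
| Reg_cst c : regular_fun (fun=> c)
| Reg_coord i j : regular_fun (fun s => s i j)
| Reg_invdet : regular_fun (fun s => (\det s)^-1)
| Reg_add f g : regular_fun f -> regular_fun g ->
    regular_fun (fun s => f s + g s)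
| Reg_mul f g : regular_fun f -> regular_fun g ->
    regular_fun (fun s => f s * g s).

(* Algebraic representations GL(n, C) -> GL(m, C); only the values of Psi at
   invertible matrices matter, and these are invertible by the first two
   axioms. *)
Record algebraic_rep m (Psi : 'M[C]_n -> 'M[C]_m) : Prop := AlgebraicRep {
  rep_one : Psi 1%:M = 1%:M;
  rep_mul : {in unitmx &, forall s t, Psi (s *m t) = Psi s *m Psi t};
  rep_regular : forall i j, exists2 f, regular_fun f &
    {in unitmx, forall s, Psi s i j = f s}
}.

Definition rep_diff m (Psi : 'M[C]_n -> 'M[C]_m) (M : 'M[C]_n) : 'M[C]_m :=
  'D_M Psi 1%:M.

Definition rational_solution (U : set CP1) (K : set (C -> C))
    (A : C -> 'M[C]_n) m (Psi : 'M[C]_n -> 'M[C]_m) (v : C -> 'cV[C]_m) : Prop :=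
  mx_over K v /\
  generically U (fun x => derive1 v x = rep_diff Psi (A x) *m v x).

Definition exponential_presolution (U : set CP1) (K : set (C -> C))
    (A : C -> 'M[C]_n) m (Psi : 'M[C]_n -> 'M[C]_m) (w : C -> 'cV[C]_m) : Prop :=
  mx_over K w /\
  exists2 b : C -> C, K b &
    generically U (fun x =>
      derive1 w x - rep_diff Psi (A x) *m w x = - b x *: w x).

(* The value at x0 of a meromorphic function regular at x0 is its limit there. *)
Definition value_at m (x0 : CP1) (v : C -> 'cV[C]_m) (v0 : 'cV[C]_m) : Prop :=
  v @ pnbhs x0 --> v0.

Definition Gal (U : set CP1) (K : set (C -> C)) (A : C -> 'M[C]_n) (x0 : CP1) :
    set 'M[C]_n :=
  [set s | s \in unitmx /\
    forall m (Psi : 'M[C]_n -> 'M[C]_m), algebraic_rep Psi ->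
      (forall v v0, rational_solution U K A Psi v -> value_at x0 v v0 ->
         Psi s *m v0 = v0) /\
      (forall w w0, exponential_presolution U K A Psi w -> value_at x0 w w0 ->
         exists c : C, Psi s *m w0 = c *: w0)].

Definition block_diag_GL k (r : 'I_k -> nat) : set 'M[C]_(\sum_i r i) :=
  [set M | exists D : forall i, 'M[C]_(r i),
     (forall i, D i \in unitmx) /\ M = \mxdiag_i D i].

Definition conjugated_to_block_diag k (r : 'I_k -> nat)
    (rn : (\sum_i r i)%N = n) (G : set 'M[C]_n) : Prop :=
  exists2 P : 'M[C]_n, P \in unitmx &
    forall s, G s ->
      @block_diag_GL k r (castmx (esym rn, esym rn) (P *m s *m invmx P)).

End GaloisGroup.

(* Main.v *)
Require Import Defs.
From HB Require Import structures.
From mathcomp Require Import all_boot all_order all_algebra.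
From mathcomp Require Import perm complex.
From mathcomp Require Import all_classical all_reals.
From mathcomp Require Import topology normedtype derive realfun exp sequences.
From mathcomp Require Import measure lebesgue_measure lebesgue_integral ftc.
From mathcomp Require Import ring lra.

Set Implicit Arguments.
Unset Strict Implicit.
Unset Printing Implicit Defensive.

Import Order.TTheory GRing.Theory Num.Theory.
Import numFieldNormedType.Exports.

Local Open Scope classical_set_scope.
Local Open Scope ring_scope.

(** Write Phi for a fundamental matrix of the system.  Both directions turn
matrices over K that solve B' = A B - B A, the equation to which the vanishing
of the Lie bracket amounts ([sym1_ode]), into constant matrices commuting with
the Galois group.

From a symmetry to blocks.  A solution B over K is a priori only meromorphic at
x0.  The coefficients of the equation are bounded there, so by Gronwall's
inequality along the rays issuing from x0 the solution is bounded too, its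
derivative is bounded, and B has a limit B0 at x0 ([symmetry_limit]).  The
entries of B form a rational solution of the Lie-Vessiot system of the
conjugation representation s |-> (X |-> s X s^-1), hence each Galoisian matrix
commutes with B0 ([Gal_commutes]) and preserves its generalized eigenspaces,
whose dimensions are the prescribed multiplicities ([commutant_block]).

From blocks to a symmetry.  In a basis adapted to the blocks, a matrix M0
equal to a scalar l_i on the i-th one, the l_i being distinct, commutes with the
Galois group, and B = Phi M0 Phi^-1
solves B' = A B - B A with the spectrum of M0.  The point is that B has its
entries in K.  This is half of the Galois correspondence, and it is proved
without a Picard-Vessiot extension.  Everything is restricted to a real ray
issuing from x0: the elements of K become a field of germs of complex functions
of a real variable ([ray_germ_field]), and Phi exists there by Picard iteration
for a real linear system ([fundamental_matrix]).

Let I be the ideal of the regular functions on GL_n with coefficients in K that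
vanish at Phi, and G its stabilizer, the set of the s such that P(t, Phi s) = 0
for all P in I.  A rational solution v is Psi(Phi) v0, which is a family of
relations in I; a presolution w is parallel to Psi(Phi) w0, which is such a
family again.  Hence G is contained in the Galois group ([ideal_galois_sub_Gal])
and M0 commutes with G.

Let J be the set of the regular functions q such that, at each t of the ray, the
function q(Phi(t)^-1 Y) of Y is a linear combination of members of I with
arbitrary complex coefficients depending on t.  It is an ideal whose zeros lie
in G ([galois_ideal_zeros]): a relation between the functions of a finite
dimensional translation-stable space, transported back by Phi, spans together
with the others a space that does not depend on t, because that space is the row
space of a solution of a linear differential equation ([Phi_relations_projector]).
The entries of Y M0 Y^-1 - M0 vanish on G, so by the Nullstellensatz a power of
each of them is in J.  Transporting by Phi, for an entry phi of Phi M0 Phi^-1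
and the corresponding entry g(Y) of Y M0 Y^-1 a power of g(Y) - phi(t) is, at
each t, a combination of members of I.  Linear algebra over K
([projector], [generalized_inverse]) replaces these members by polynomials in
g(Y) alone, that is by polynomials over K vanishing at phi.  The polynomial of
least degree among them divides a power of X - phi, so it is itself a power of
X - phi up to a factor, and phi is read off its two leading coefficients
([power_span_rational]).  Thus phi is in K ([descent]).

Finally the differential equation and the characteristic polynomial of B, known
on the ray, hold generically on U by the identity theorem for K on the connected
set U ([K_identity]).  That theorem rests on a dichotomy: for f in K the function
f / f takes only the values 0 and 1 and is again meromorphic, so it is constant
near every point. *)

(** * Regular functions on the general linear group and a Nullstellensatz *)
Section Regular.
Variables (R : realType) (n : nat).
Local Notation C := (C R).
Implicit Types (f g h : 'M[C]_n -> C).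

Lemma reg_opp f : regular_fun f -> regular_fun (fun s => - f s).
Proof.
move=> rf; have := Reg_mul (Reg_cst n (-1 : C)) rf.
by under eq_fun do rewrite mulN1r.
Qed.

Lemma reg_sub f g : regular_fun f -> regular_fun g -> regular_fun (fun s => f s - g s).
Proof. by move=> rf /reg_opp; exact: Reg_add. Qed.

Lemma reg_sum (I : Type) (r : seq I) (P : pred I) (F : I -> 'M[C]_n -> C) :
  (forall i, P i -> regular_fun (F i)) -> regular_fun (fun s => \sum_(i <- r | P i) F i s).
Proof.
move=> H; elim: r => [|a r IH].
  by under eq_fun do rewrite big_nil; exact: Reg_cst.
under eq_fun do rewrite big_cons.
by case: (boolP (P a)) => // Pa; apply: Reg_add => //; exact: H.
Qed.

Lemma reg_prod (I : Type) (r : seq I) (P : pred I) (F : I -> 'M[C]_n -> C) :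
  (forall i, P i -> regular_fun (F i)) -> regular_fun (fun s => \prod_(i <- r | P i) F i s).
Proof.
move=> H; elim: r => [|a r IH].
  by under eq_fun do rewrite big_nil; exact: Reg_cst.
under eq_fun do rewrite big_cons.
by case: (boolP (P a)) => // Pa; apply: Reg_mul => //; exact: H.
Qed.

Lemma reg_exp f k : regular_fun f -> regular_fun (fun s => f s ^+ k).
Proof.
move=> rf; elim: k => [|k IH]; first by under eq_fun do rewrite expr0; exact: Reg_cst.
by under eq_fun do rewrite exprS; exact: Reg_mul.
Qed.

Lemma reg_det m (F : 'M[C]_n -> 'M[C]_m) :
  (forall i j, regular_fun (fun s => F s i j)) -> regular_fun (fun s => \det (F s)).
Proof.
move=> H; rewrite /determinant; apply: reg_sum => p _.
by apply: Reg_mul; [exact: Reg_cst|apply: reg_prod].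
Qed.

(** Cramer's formula: the entries of the inverse are cofactors times the inverse of
    the determinant, the generator [Reg_invdet]. *)
Lemma reg_inv i j : exists2 f, regular_fun f &
  {in unitmx, forall s : 'M[C]_n, (invmx s) i j = f s}.
Proof.
exists (fun s => (\det s)^-1 * (\adj s i j)); last first.
  by move=> s us; rewrite /invmx us !mxE.
apply: Reg_mul; first exact: Reg_invdet.
under eq_fun do rewrite mxE; apply: Reg_mul; first exact: Reg_cst.
by apply: reg_det => k l; under eq_fun do rewrite !mxE; exact: Reg_coord.
Qed.

(** The generators of the coordinate ring, [None] standing for the inverse of the
    determinant. *)
Definition gen := option ('I_n * 'I_n).
Definition gval (a : gen) (s : 'M[C]_n) : C :=
  if a is Some ij then s ij.1 ij.2 else (\det s)^-1.
Definition mono (w : seq gen) s : C := \prod_(a <- w) gval a s.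

(** There are countably many words in the generators, and they span all regular
    functions: this countability drives the Nullstellensatz below. *)
Lemma reg_words f : regular_fun f ->
  exists ps : seq (C * seq gen), forall s, f s = \sum_(p <- ps) p.1 * mono p.2 s.
Proof.
elim=> [c|i j||{}f g _ [p fE] _ [q gE]|{}f g _ [p fE] _ [q gE]].
- by exists [:: (c, [::])] => s; rewrite big_seq1 /mono big_nil mulr1.
- by exists [:: (1, [:: Some (i, j)])] => s; rewrite big_seq1 /mono big_seq1 mul1r.
- by exists [:: (1, [:: None])] => s; rewrite big_seq1 /mono big_seq1 mul1r.
- by exists (p ++ q) => s; rewrite big_cat -fE -gE.
- exists [seq (x.1 * y.1, x.2 ++ y.2) | x <- p, y <- q] => s.
  rewrite fE gE big_allpairs_dep big_distrl; apply: eq_bigr => x _.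
  rewrite big_distrr; apply: eq_bigr => y _ /=.
  by rewrite /mono big_cat /=; ring.
Qed.

(** An ideal is a set of functions on invertible matrices; only multiplication by
    regular functions is required, so the set may contain others. *)
Record ideal (J : ('M[C]_n -> C) -> Prop) : Prop := Ideal {
  ideal_ext : forall f g, {in unitmx, f =1 g} -> J f -> J g;
  ideal0 : J (fun=> 0);
  idealD : forall f g, J f -> J g -> J (fun s => f s + g s);
  idealM : forall f g, J f -> regular_fun g -> J (fun s => f s * g s)
}.

Lemma ideal_sum J (I : Type) (r : seq I) (F : I -> 'M[C]_n -> C) : ideal J ->
  (forall i, J (F i)) -> J (fun s => \sum_(i <- r) F i s).
Proof.
move=> iJ H; elim: r => [|a r IH].
  by under eq_fun do rewrite big_nil; exact: ideal0.
by under eq_fun do rewrite big_cons; apply: (idealD iJ).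
Qed.

(** The complex numbers are uncountable, because Lebesgue measure vanishes on
    countable sets. *)
Lemma countable_union_C (T : countType) (A : T -> set C) :
  (forall i, finite_set (A i)) -> exists c, forall i, ~ A i c.
Proof.
move=> fA; apply: contrapT => /forallNP H.
have : countable [set: R].
  have cA : countable (\bigcup_(i in [set: T]) A i).
    by apply: bigcup_countable => // i _; exact: finite_set_countable.
  have /countable_injP[f fI] := cA.
  have rcA (x : R) : (x%:C)%C \in \bigcup_(i in [set: T]) A i.
    rewrite inE; have /existsNP[i /contrapT Ai] := H ((x%:C)%C : C).
    by exists i.
  apply/countable_injP; exists (fun x => f (x%:C)%C) => x y _ _ fxy.
  exact/complexI/(fI _ _ (rcA x) (rcA y) fxy).
move/(sub_countable (subset_card_le (@subsetT _ `[0 : R, 1 : R]%classic))).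
move/countable_lebesgue_measure0.
rewrite lebesgue_measure_itv /= lte01 sube0 => /eqP.
by rewrite eqe oner_eq0.
Qed.

(** Nullstellensatz in the form of Rabinowitsch.  Take an ideal M above [J] maximal
    among those that contain no power of [h].  It is prime, and modulo M every
    regular function outside M divides a power of [h]: inverting [h] gives a field
    of countable dimension over C.  Such a field is C itself, since otherwise some x
    would have all the x - c invertible, and their inverses would be uncountably
    many linearly independent elements.  The residues of the coordinates are then
    the entries of the matrix. *)
Lemma nullstellensatz J h : ideal J -> regular_fun h ->
  (forall m, ~ J (fun s => h s ^+ m)) ->
  exists s, [/\ s \in unitmx, h s != 0 & forall f, regular_fun f -> J f -> f s = 0].
Proof.
move=> iJ rh hJ.
pose P (X : set ('M[C]_n -> C)) :=
  X = set0 \/ [/\ J `<=` X, ideal X & forall m, ~ X (fun s => h s ^+ m)].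
(* The empty set is admitted so that the union of the empty chain is. *)
have [|M [PM maxM]] := @Zorn_bigcup _ P.
  move=> F FP totF; rewrite /P.
  have [[X0 FX0 nX0]|all0] := pselect (exists2 X, F X & X !=set0); last first.
    left; apply/seteqP; split => // f [X FX Xf]; apply: all0; exists X => //.
    by exists f.
  right.
  have good X f : F X -> X f -> [/\ J `<=` X, ideal X & forall m, ~ X (fun s => h s ^+ m)].
    by move=> FX Xf; have [X00|//] := FP _ FX; rewrite X00 in Xf.
  have [f0 X0f0] := nX0; have [JX0 iX0 _] := good _ _ FX0 X0f0.
  split.
  - by move=> f Jf; exists X0 => //; exact: JX0.
  - split.
    + move=> f g fg [X FX Xf]; have [_ iX _] := good _ _ FX Xf.
      by exists X => //; apply: (ideal_ext iX fg).
    + by exists X0 => //; apply: (ideal0 iX0).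
    + move=> f g [X FX Xf] [Y FY Yg].
      have [_ iX _] := good _ _ FX Xf; have [_ iY _] := good _ _ FY Yg.
      have [XY|YX] := totF _ _ FX FY.
        by exists Y => //; apply: (idealD iY) => //; exact: XY.
      by exists X => //; apply: (idealD iX) => //; exact: YX.
    + move=> f g [X FX Xf] rg; have [_ iX _] := good _ _ FX Xf.
      by exists X => //; apply: (idealM iX).
  - by move=> m [X FX Xh]; have [_ _ /(_ m)] := good _ _ FX Xh.
have {PM} [JM iM hM] : [/\ J `<=` M, ideal M & forall m, ~ M (fun s => h s ^+ m)].
  case: PM => // M0; exfalso; apply: (maxM J); last by right; split.
  split; first by rewrite M0; exact: sub0set.
  by rewrite M0 => /(_ _ (ideal0 iJ)).
have MZ f c : M f -> M (fun s => f s * c) by move=> Mf; apply: (idealM iM) => //; exact: Reg_cst.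
have M1 : ~ M (fun=> 1) by move=> H; apply: (hM 0).
(* A regular function outside M divides a power of h modulo M. *)
have inv f : regular_fun f -> ~ M f -> exists m q, regular_fun q /\ M (fun s => h s ^+ m - q s * f s).
  move=> rf nMf; pose N : set _ := fun u => exists2 q, regular_fun q & M (fun s => u s - q s * f s).
  have MN : M `<=` N.
    move=> u Mu; exists (fun=> 0); first exact: Reg_cst.
    by apply: (ideal_ext iM) Mu => s _; rewrite mul0r subr0.
  have iN : ideal N.
    split.
    - move=> u v uv [q rq Mu]; exists q => //; apply: (ideal_ext iM) Mu => s us.
      by rewrite uv.
    - exact/MN/(ideal0 iM).
    - move=> u v [q rq Mu] [q' rq' Mv]; exists (fun s => q s + q' s); first exact: Reg_add.
      by apply: (ideal_ext iM) (idealD iM Mu Mv) => s _; ring.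
    - move=> u v [q rq Mu] rv; exists (fun s => q s * v s); first exact: Reg_mul.
      by apply: (ideal_ext iM) (idealM iM Mu rv) => s _; ring.
  apply: contrapT => Hn; apply: (maxM N).
    split => // NM; apply: nMf; apply: NM; exists (fun=> 1); first exact: Reg_cst.
    by apply: (ideal_ext iM) (ideal0 iM) => s _; ring.
  right; split => //; first exact: subset_trans MN.
  move=> m [q rq Mq]; apply: Hn; by exists m, q.
have prime f g : regular_fun f -> regular_fun g -> M (fun s => f s * g s) -> M f \/ M g.
  move=> rf rg Mfg; apply: contrapT => /not_orP[nf ng].
  have [a [p [rp Mp]]] := inv _ rf nf; have [b [q [rq Mq]]] := inv _ rg ng.
  apply: (hM (a + b)%N).
  have M1' := idealM iM Mp (reg_exp b rh).
  have M2 := idealM iM Mq (Reg_mul rp rf).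
  have M3 := idealM iM Mfg (Reg_mul rp rq).
  apply: (ideal_ext iM) (idealD iM (idealD iM M1' M2) M3) => s _.
  by rewrite exprD; ring.
have primeX k f g : regular_fun f -> regular_fun g -> ~ M g ->
    M (fun s => g s ^+ k * f s) -> M f.
  move=> rf rg nMg; elim: k => [|k IH].
    by apply: (ideal_ext iM) => s _; rewrite expr0 mul1r.
  move=> H; apply: IH.
  case: (@prime g (fun s => g s ^+ k * f s)) => //.
    by apply: Reg_mul => //; exact: reg_exp.
  by apply: (ideal_ext iM) H => s _; rewrite exprS mulrA.
have nMh : ~ M h by move=> H; apply: (hM 1%N).
have point x : regular_fun x -> exists c : C, M (fun s => x s - c).
  move=> rx; apply: contrapT => /forallNP noc.
  (* The c for which x - c divides h ^ a.1 modulo M with a cofactor spanned by the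
     words a.2; there are countably many such a. *)
  pose T (a : nat * seq (seq gen)) : set C := fun c =>
    exists l : 'I_(size a.2) -> C,
      M (fun s => h s ^+ a.1 - (\sum_i l i * mono (nth [::] a.2 i) s) * (x s - c)).
  have [|c cP] := @countable_union_C _ T; last first.
    have rxc : regular_fun (fun s => x s - c) by apply: reg_sub => //; exact: Reg_cst.
    have [m [q [rq Mq]]] := inv _ rxc (noc c).
    have [ps qE] := reg_words rq.
    apply: (cP (m, [seq p.2 | p <- ps])) => /=.
    have sz : size [seq p.2 | p <- ps] = size ps by rewrite size_map.
    exists (fun i => (nth (0, [::]) ps i).1).
    apply: (ideal_ext iM) Mq => s us /=; rewrite qE; congr (_ - _ * _).
    rewrite (big_nth (0, [::])) big_mkord sz; apply: eq_bigr => i _.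
    by rewrite (nth_map (0, [::])).
  (* More values of c than words: the cofactors are linearly dependent, and the
     dependence relation gives a nonzero polynomial r with r(x) in M. *)
  move=> [m ws]; apply: contrapT => /(@infinite_set_fset _ _ (size ws).+1)[B BT sB].
  set N := size ws in sB.
  pose c (k : 'I_N.+1) : C := nth 0 (finmap.enum_fset B) k.
  have szB : (N < size (finmap.enum_fset B))%N by [].
  have cB k : c k \in finmap.enum_fset B by apply: mem_nth; apply: leq_ltn_trans szB; rewrite -ltnS.
  have cI : injective c.
    move=> k k' /eqP; rewrite nth_uniq ?finmap.fset_uniq //.
    - by move/eqP/val_inj.
    - by apply: leq_ltn_trans szB; rewrite -ltnS.
    - by apply: leq_ltn_trans szB; rewrite -ltnS.
  have /choice[l lP] (k : 'I_N.+1) : exists l : 'I_N -> C,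
      M (fun s => h s ^+ m - (\sum_i l i * mono (nth [::] ws i) s) * (x s - c k)).
    exact: (BT _ (cB k)).
  pose L := \matrix_(k < N.+1, i < N) l k i.
  have : kermx L != 0.
    rewrite -mxrank_eq0 mxrank_ker subn_eq0 -ltnNge.
    exact: leq_ltn_trans (rank_leq_col _) _.
  move/rowV0Pn => [v /sub_kermxP vL v0].
  pose r : {poly C} := \sum_k v 0 k *: \prod_(k' | k' != k) ('X - (c k')%:P).
  have rn0 : r != 0.
    have /existsP[k vk] : [exists k, v 0 k != 0].
      apply: contraNT v0; rewrite negb_exists => /forallP H.
      by apply/eqP/rowP => k; rewrite mxE; apply/eqP; move: (H k); rewrite negbK.
    apply/eqP => /(congr1 (fun p => p.[c k])); rewrite horner0 horner_sum (bigD1 k) //=.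
    rewrite [X in _ + X]big1 ?addr0; last first.
      move=> j jk; rewrite hornerZ horner_prod (bigD1 k) 1?eq_sym //=.
      by rewrite hornerXsubC subrr mul0r mulr0.
    rewrite hornerZ horner_prod => /eqP; rewrite mulf_eq0 (negbTE vk) /=.
    apply/negP/prodf_neq0 => j jk; rewrite hornerXsubC subr_eq0.
    by apply: contraNneq jk => /cI ->.
  have rr (p : {poly C}) : regular_fun (fun s => p.[x s]).
    rewrite /=; under eq_fun do rewrite horner_coef.
    by apply: reg_sum => i _; apply: Reg_mul; [exact: Reg_cst|exact: reg_exp].
  have Mr : M (fun s => r.[x s]).
    apply: (@primeX m _ h) => //.
    have := @ideal_sum M _ (index_enum 'I_N.+1) (fun k s =>
      (h s ^+ m - (\sum_i l k i * mono (nth [::] ws i) s) * (x s - c k)) *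
       (v 0 k * (\prod_(k' | k' != k) ('X - (c k')%:P)).[x s])) iM.
    move=> /(_ (fun k => idealM iM (lP k) (Reg_mul (Reg_cst _ _) (rr _)))).
    apply: (ideal_ext iM) => s _.
    under eq_bigr => k _ do rewrite mulrBl.
    rewrite big_split /= sumrN [X in _ - X](_ : _ = 0) ?subr0.
      rewrite horner_sum mulr_sumr; apply: eq_bigr => k _.
      by rewrite hornerZ.
    transitivity ((\sum_k v 0 k * (\sum_i l k i * mono (nth [::] ws i) s)) *
       (\prod_k ('X - (c k)%:P)).[x s]).
      rewrite mulr_suml; apply: eq_bigr => k _.
      rewrite [in RHS](bigD1 k) //= [in RHS]hornerM hornerXsubC; ring.
    rewrite [X in X * _](_ : _ = 0) ?mul0r //.
    under eq_bigr do rewrite mulr_sumr.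
    rewrite exchange_big big1 // => i _ /=.
    under eq_bigr do rewrite mulrA.
    rewrite -mulr_suml.
    have := congr1 (fun A : 'M_(1, N) => A 0 i) vL; rewrite !mxE.
    by under eq_bigr do rewrite mxE; move=> ->; rewrite mul0r.
  (* A factor x - z of r(x) is in M because M is prime. *)
  have [zs rE] := closed_field_poly_normal r.
  have lc0 : lead_coef r != 0 by rewrite lead_coef_eq0.
  have {}Mr : M (fun s => (\prod_(z <- zs) ('X - z%:P)).[x s]).
    apply: (ideal_ext iM) (MZ _ (lead_coef r)^-1 Mr) => s _.
    by rewrite {1}rE hornerZ mulrAC mulfV // mul1r.
  elim: zs Mr {rE} => [|z zs IH] Mr.
    by apply: M1; apply: (ideal_ext iM) Mr => s _; rewrite big_nil hornerC.
  case: (@prime (fun s => x s - z) (fun s => (\prod_(z <- zs) ('X - z%:P)).[x s])).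
  - by apply: reg_sub => //; exact: Reg_cst.
  - exact: rr.
  - by apply: (ideal_ext iM) Mr => s _; rewrite big_cons hornerM hornerXsubC.
  - exact: noc.
  - exact: IH.
have /choice[c cP] (ij : 'I_n * 'I_n) : exists c : C, M (fun s => s ij.1 ij.2 - c).
  by apply: point; exact: Reg_coord.
pose s0 : 'M[C]_n := \matrix_(i, j) c (i, j).
have [d dP] := point _ (Reg_invdet R n).
have MB f g : M f -> M g -> M (fun s => f s - g s).
  move=> Mf Mg; apply: (ideal_ext iM) (idealD iM Mf (MZ _ (-1) Mg)) => s _; ring.
(* Modulo M the coordinates are the entries of s0; so every regular function is
   congruent to its value at s0. *)
have congM f g a b : regular_fun f -> M (fun s => f s - a) -> M (fun s => g s - b) ->
    M (fun s => f s * g s - a * b).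
  move=> rf Mf Mg; apply: (ideal_ext iM) (idealD iM (idealM iM Mg rf) (MZ _ b Mf)) => s _; ring.
have congdet : M (fun s => \det s - \det s0).
  pose F (p : {perm 'I_n}) (s : 'M[C]_n) := (-1) ^+ p * \prod_i s i (p i).
  have := @ideal_sum M _ (index_enum _) (fun p s => F p s - F p s0) iM.
  move=> H; apply: (ideal_ext iM) (H _) => [s _|p]; first by rewrite sumrB.
  rewrite /F.
  suff HP : M (fun s => \prod_i s i (p i) - \prod_i s0 i (p i)).
    apply: (ideal_ext iM) (MZ _ ((-1) ^+ p) HP) => s _; by rewrite mulrC mulrBr.
  elim: (index_enum _) => [|i r IH].
    apply: (ideal_ext iM) (ideal0 iM) => s _; by rewrite !big_nil subrr.
  apply: (ideal_ext iM) (congM (fun s => s i (p i)) (fun s => \prod_(i <- r) s i (p i)) (s0 i (p i)) (\prod_(i <- r) s0 i (p i)) _ _ _) => //.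
  - by move=> s _; rewrite !big_cons.
  - exact: Reg_coord.
  - by have := cP (i, p i); rewrite mxE.
have dd : \det s0 * d = 1.
  have H := congM _ _ _ _ (reg_det (F := id) (fun i j => Reg_coord R i j)) congdet dP.
  apply/eqP; rewrite eq_sym -subr_eq0; apply/negP => /negP nz; apply: M1.
  apply: (ideal_ext iM) (MZ _ ((1 - \det s0 * d)^-1) H) => s us.
  by rewrite mulfV ?mulfV // -unitfE -unitmxE.
have us0 : s0 \in unitmx.
  by rewrite unitmxE unitfE; apply: contra_eq_neq dd => ->; rewrite mul0r eq_sym oner_neq0.
have ev f : regular_fun f -> M (fun s => f s - f s0).
  elim=> [a|i j||{}f g _ fP _ gP|{}f g rf fP _ gP].
  - by apply: (ideal_ext iM) (ideal0 iM) => s _; rewrite subrr.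
  - by have := cP (i, j); rewrite mxE.
  - suff <- : d = (\det s0)^-1 by [].
    by rewrite -[LHS]mul1r -(mulVf (x := \det s0)) -?mulrA ?dd ?mulr1 // -unitfE -unitmxE.
  - by apply: (ideal_ext iM) (idealD iM fP gP) => s _; ring.
  - exact: congM.
exists s0; split => //.
- apply/eqP => h0; apply: nMh; apply: (ideal_ext iM) (ev h rh) => s _.
  by rewrite h0 subr0.
- move=> f rf /JM Mf; apply/eqP/negP => /negP nz; apply: M1.
  apply: (ideal_ext iM) (MZ _ (f s0)^-1 (MB _ _ Mf (ev f rf))) => s _.
  by rewrite opprB addrC subrK mulfV.
Qed.
End Regular.

(** * Difference quotients along a filter, and real curves in the complex plane *)
Section Quot.
Variable K : numFieldType.

(** The derivative of [g] at a point of value [g0] as a limit of difference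
    quotients with increment [k] along any filter.  Complex derivatives,
    derivatives of curves with a real parameter and derivatives along a one-sided
    filter are all instances, so that the rules of calculus are proved once. *)
Definition qder {T : Type} (F : set_system T) (k g : T -> K) (g0 d : K) : Prop :=
  (fun x => (k x)^-1 * (g x - g0)) @ F --> d.

Section F.
Variables (T : Type) (F : set_system T) (FF : ProperFilter F) (k : T -> K).
Hypothesis k0 : k @ F --> (0 : K).
Hypothesis kn0 : \forall x \near F, k x != 0.

Lemma qder_cvg (g : T -> K) g0 d : qder F k g g0 d -> g @ F --> g0.
Proof.
move=> gd; have H : (fun x => k x * ((k x)^-1 * (g x - g0)) + g0) @ F --> (0 * d + g0 : K).
  by apply: cvgD; [exact: cvgM|exact: cvg_cst].
rewrite mul0r add0r in H; apply: cvg_trans H.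
apply: near_eq_cvg; near=> x.
have kx : k x != 0 by near: x.
by rewrite mulrA mulfV // mul1r subrK.
Unshelve. all: by end_near. Qed.

Lemma qder_eq (g f : T -> K) g0 d : (\forall x \near F, f x = g x) -> qder F k g g0 d -> qder F k f g0 d.
Proof.
move=> fg; apply: cvg_trans; apply: near_eq_cvg; near=> x.
suff -> : f x = g x by []. by near: x.
Unshelve. all: by end_near. Qed.

Lemma qder_cst c : qder F k (fun=> c) c 0.
Proof.
rewrite /qder; under eq_fun do rewrite subrr mulr0; exact: cvg_cst.
Qed.

Lemma qderD (g f : T -> K) g0 f0 d e : qder F k g g0 d -> qder F k f f0 e ->
  qder F k (fun x => g x + f x) (g0 + f0) (d + e).
Proof.
move=> gd fd; rewrite /qder.
under eq_fun => x.
  have -> : (k x)^-1 * (g x + f x - (g0 + f0)) =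
    (k x)^-1 * (g x - g0) + (k x)^-1 * (f x - f0) by ring.
  over.
exact: cvgD.
Qed.

Lemma qderM (g f : T -> K) g0 f0 d e : qder F k g g0 d -> qder F k f f0 e ->
  qder F k (fun x => g x * f x) (g0 * f0) (d * f0 + g0 * e).
Proof.
move=> gd fd; rewrite /qder.
under eq_fun => x.
  have -> : (k x)^-1 * (g x * f x - (g0 * f0)) =
    (k x)^-1 * (g x - g0) * f x + g0 * ((k x)^-1 * (f x - f0)) by ring.
  over.
apply: cvgD; apply: cvgM => //; [exact: qder_cvg fd | exact: cvg_cst].
Qed.

Lemma qderN (g : T -> K) g0 d : qder F k g g0 d -> qder F k (fun x => - g x) (- g0) (- d).
Proof.
move=> gd; rewrite /qder.
under eq_fun => x.
  have -> : (k x)^-1 * (- g x - - g0) = - ((k x)^-1 * (g x - g0)) by ring.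
  over.
exact: cvgN.
Qed.

Lemma qderB (g f : T -> K) g0 f0 d e : qder F k g g0 d -> qder F k f f0 e ->
  qder F k (fun x => g x - f x) (g0 - f0) (d - e).
Proof. by move=> gd /qderN; exact: qderD. Qed.

Lemma qderZ c (g : T -> K) g0 d : qder F k g g0 d -> qder F k (fun x => c * g x) (c * g0) (c * d).
Proof.
move=> gd; have := qderM (qder_cst c) gd; by rewrite mul0r add0r.
Qed.

Lemma qderV (g : T -> K) g0 d : g0 != 0 -> qder F k g g0 d ->
  qder F k (fun x => (g x)^-1) g0^-1 (- d * g0^-1 ^+ 2).
Proof.
move=> gn0 gd; rewrite /qder.
have gc := qder_cvg gd.
have gx0 : \forall x \near F, g x != 0.
  have := gc; move/cvgrPdist_lt => /(_ `|g0|); rewrite normr_gt0 => /(_ gn0).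
  apply: filterS => x; apply: contraTneq => ->; by rewrite subr0 ltxx.
apply: (@cvg_trans _ ((fun x => - ((k x)^-1 * (g x - g0)) * ((g x)^-1 * g0^-1)) @ F)).
  apply: near_eq_cvg; near=> x.
  have gx : g x != 0 by near: x.
  have kx : k x != 0 by near: x.
  by field; rewrite gn0 gx kx.
rewrite expr2; apply: cvgM; first exact: cvgN.
apply: cvgM; [exact: cvgV | exact: cvg_cst].
Unshelve. all: by end_near. Qed.

Lemma qder_sum (I : Type) (r : seq I) (P : pred I) (g : I -> T -> K) (g0 d : I -> K) :
  (forall i, P i -> qder F k (g i) (g0 i) (d i)) ->
  qder F k (fun x => \sum_(i <- r | P i) g i x) (\sum_(i <- r | P i) g0 i)
     (\sum_(i <- r | P i) d i).
Proof.
move=> H; elim: r => [|a r IH].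
  rewrite !big_nil; under eq_fun do rewrite big_nil; exact: qder_cst.
rewrite !big_cons; under eq_fun do rewrite big_cons.
by case: ifP => // Pa; apply: qderD => //; exact: H.
Qed.

(** The difference quotient of [h], extended by its limit at 0, is continuous,
    which deals with the increments of [g] that vanish. *)
Lemma qder_comp (h : K -> K) (g : T -> K) g0 d e :
  qder (0 : K)^' id (fun z => h (g0 + z)) (h g0) e ->
  qder F k g g0 d -> qder F k (fun x => h (g x)) (h g0) (d * e).
Proof.
move=> he gd.
pose q (z : K) := if z == 0 then e else z^-1 * (h (g0 + z) - h g0).
have q0 : q 0 = e by rewrite /q eqxx.
have qc : q @ nbhs (0 : K) --> q 0.
  apply/(@cvgrPdist_lt _ _ _ (nbhs (0 : K))) => eps eps0.
  have := he; rewrite /qder => /cvgrPdist_lt /(_ _ eps0).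
  rewrite !near_simpl !near_withinE q0.
  apply: filterS => z zP; rewrite /q; case: eqP => [_|/eqP z0]; last exact: zP.
  by rewrite subrr normr0.
have gc := qder_cvg gd.
have gc0 : (fun x => g x - g0) @ F --> (0 : K).
  by rewrite -(subrr g0); apply: cvgB => //; exact: cvg_cst.
have qg : (fun x => q (g x - g0)) @ F --> e.
  by rewrite -q0; exact: (cvg_comp _ _ gc0 qc).
apply: (@cvg_trans _ ((fun x => ((k x)^-1 * (g x - g0)) * q (g x - g0)) @ F)).
  apply: near_eq_cvg; near=> x.
  rewrite /q; case: eqP => [gx|/eqP gx].
    by move/eqP: gx; rewrite subr_eq0 => /eqP ->; rewrite !subrr !mulr0 mul0r.
  have kx : k x != 0 by near: x.
  by rewrite (addrC g0) subrK; field; rewrite gx kx.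
exact: cvgM.
Unshelve. all: by end_near. Qed.

End F.
End Quot.

Section RCurve.
Variable R : realType.
Local Notation C := (C R).
(** The embedding of the reals with values in the type [C], whose topology and norm
    it transports. *)
Definition rc (x : R) : C := (x%:C)%C.

Lemma rcD x y : rc (x + y) = rc x + rc y. Proof. exact: rmorphD. Qed.
Lemma rcM x y : rc (x * y) = rc x * rc y. Proof. exact: rmorphM. Qed.
Lemma rcN x : rc (- x) = - rc x. Proof. exact: rmorphN. Qed.
Lemma rcV x : rc (x^-1) = (rc x)^-1. Proof. exact: fmorphV. Qed.
Lemma rc0 : rc 0 = 0. Proof. exact: rmorph0. Qed.
Lemma rc1 : rc 1 = 1. Proof. exact: rmorph1. Qed.
Lemma rc_eq0 x : (rc x == 0) = (x == 0). Proof. exact: fmorph_eq0. Qed.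
Lemma rc_norm x : `|rc x| = rc `|x|.
Proof. by rewrite /rc normc_def /= expr0n addr0 sqrtr_sqr. Qed.
Lemma rc_lt x y : (rc x < rc y) = (x < y). Proof. exact: ltcR. Qed.
Lemma rc_le x y : (rc x <= rc y) = (x <= y). Proof. exact: lecR. Qed.

Lemma pos_rc (e : C) : 0 < e -> exists2 x, 0 < x & e = rc x.
Proof.
case: e => a b; rewrite ltcE /= => /andP[/eqP -> a0]; by exists a.
Qed.

Lemma rc_cts : continuous rc.
Proof.
move=> x; apply/cvgrPdist_lt => e /pos_rc[d d0 ->].
near=> y; rewrite -rcN -rcD rc_norm rc_lt; near: y.
exact: cvgr_dist_lt.
Unshelve. all: by end_near. Qed.

Lemma Re_norm (z : C) : rc `|complex.Re z| <= `|z|. Proof. exact: normc_ge_Re. Qed.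
Lemma Im_norm (z : C) : rc `|complex.Im z| <= `|z|.
Proof.
rewrite /rc normc_def lecR -sqrtr_sqr ler_sqrt ?lerDr ?sqr_ge0 //.
by rewrite addr_ge0 ?sqr_ge0.
Qed.

Lemma Re_cvg T (F : set_system T) (FF : Filter F) (g : T -> C) (l : C) :
  g @ F --> l -> (fun x => complex.Re (g x)) @ F --> complex.Re l.
Proof.
move=> /cvgrPdist_lt gl; apply/cvgrPdist_lt => e e0.
have := gl (rc e); rewrite ltcR => /(_ e0); apply: filterS => x.
move=> H; rewrite -rc_lt; apply: le_lt_trans H.
by apply: le_trans (Re_norm _); rewrite rc_le; case: (l) (g x) => ? ? [].
Qed.

Lemma Im_cvg T (F : set_system T) (FF : Filter F) (g : T -> C) (l : C) :
  g @ F --> l -> (fun x => complex.Im (g x)) @ F --> complex.Im l.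
Proof.
move=> /cvgrPdist_lt gl; apply/cvgrPdist_lt => e e0.
have := gl (rc e); rewrite ltcR => /(_ e0); apply: filterS => x.
move=> H; rewrite -rc_lt; apply: le_lt_trans H.
by apply: le_trans (Im_norm _); rewrite rc_le; case: (l) (g x) => ? ? [].
Qed.

Lemma complex_split (z : C) : z = rc (complex.Re z) + 'i%C * rc (complex.Im z).
Proof. exact: complexE. Qed.

Lemma ReIm_cvg T (F : set_system T) (FF : Filter F) (g : T -> C) (l : C) :
  (fun x => complex.Re (g x)) @ F --> complex.Re l ->
  (fun x => complex.Im (g x)) @ F --> complex.Im l ->  g @ F --> l.
Proof.
move=> rl il; rewrite (complex_split l).
rewrite (_ : g = fun x => rc (complex.Re (g x)) + 'i%C * rc (complex.Im (g x))); last first.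
  by apply/funext => x; rewrite -complex_split.
apply: cvgD; first by apply: continuous_cvg => //; exact: rc_cts.
apply: cvgM; first exact: cvg_cst.
by apply: continuous_cvg => //; exact: rc_cts.
Qed.

Definition rder (c : R -> C) (t : R) (d : C) : Prop :=
  qder (0 : R)^' rc (fun h => c (t + h)) (c t) d.

Lemma cvg_rc_dnbhs : rc @ (0 : R)^' --> (0 : C).
Proof. rewrite -rc0; apply: cvg_within_filter; exact: rc_cts. Qed.
Lemma near_rc_neq0 : \forall x \near (0 : R)^', rc x != 0.
Proof. by rewrite near_withinE; near=> x => x0; rewrite rc_eq0.
Unshelve. all: by end_near. Qed.

Lemma Re_scale (x : R) (z : C) : complex.Re (rc x * z) = x * complex.Re z.
Proof. by case: z => a b /=; rewrite mul0r subr0. Qed.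
Lemma Im_scale (x : R) (z : C) : complex.Im (rc x * z) = x * complex.Im z.
Proof. by case: z => a b /=; rewrite mul0r addr0. Qed.
Lemma Re_add (x y : C) : complex.Re (x + y) = complex.Re x + complex.Re y.
Proof. by case: x y => ? ? []. Qed.
Lemma Im_add (x y : C) : complex.Im (x + y) = complex.Im x + complex.Im y.
Proof. by case: x y => ? ? []. Qed.
Lemma Re_opp (x : C) : complex.Re (- x) = - complex.Re x. Proof. by case: x. Qed.
Lemma Im_opp (x : C) : complex.Im (- x) = - complex.Im x. Proof. by case: x. Qed.
Lemma Re_mul (x y : C) : complex.Re (x * y) = complex.Re x * complex.Re y - complex.Im x * complex.Im y.
Proof. by case: x y => ? ? []. Qed.
Lemma Im_mul (x y : C) : complex.Im (x * y) = complex.Re x * complex.Im y + complex.Im x * complex.Re y.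
Proof. by case: x y => ? ? []. Qed.

Lemma is_deriveP (f : R -> R) t d :
  (fun h => h^-1 * (f (t + h) - f t)) @ (0 : R)^' --> d <-> is_derive t 1 f d.
Proof.
have E : (fun h : R => h^-1 * (f (t + h) - f t)) =
         (fun h => h^-1 *: ((f \o shift t) (h *: 1) - f t)).
  by apply/funext => h /=; rewrite /GRing.scale /= mulr1 (addrC h).
split=> [H|[H1 <-]].
  apply: DeriveDef; first by apply/cvg_ex; exists d; rewrite -E.
  by apply: cvg_lim => //; rewrite -E.
rewrite E; exact: H1.
Qed.

Lemma rder_Re (c : R -> C) (t : R) d : rder c t d ->
  is_derive t (1 : R) (fun x => complex.Re (c x)) (complex.Re d).
Proof.
move=> /Re_cvg H; apply/is_deriveP; apply: cvg_trans H.
apply: near_eq_cvg; near=> h.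
by rewrite -rcV Re_scale Re_add Re_opp.
Unshelve. all: by end_near. Qed.

Lemma rder_Im (c : R -> C) (t : R) d : rder c t d ->
  is_derive t (1 : R) (fun x => complex.Im (c x)) (complex.Im d).
Proof.
move=> /Im_cvg H; apply/is_deriveP; apply: cvg_trans H.
apply: near_eq_cvg; near=> h.
by rewrite -rcV Im_scale Im_add Im_opp.
Unshelve. all: by end_near. Qed.

(** With [rder_Re] and [rder_Im] this passes between complex curves and pairs of
    real functions, for which the mean value theorem and integration are
    available. *)
Lemma rder_ReIm (c : R -> C) (t : R) d :
  is_derive t (1 : R) (fun x => complex.Re (c x)) (complex.Re d) ->
  is_derive t (1 : R) (fun x => complex.Im (c x)) (complex.Im d) -> rder c t d.
Proof.
move=> /is_deriveP H1 /is_deriveP H2; apply: ReIm_cvg.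
  apply: cvg_trans H1; apply: near_eq_cvg; near=> h.
  by rewrite -rcV Re_scale Re_add Re_opp.
apply: cvg_trans H2; apply: near_eq_cvg; near=> h.
by rewrite -rcV Im_scale Im_add Im_opp.
Unshelve. all: by end_near. Qed.

Lemma rder_cts (c : R -> C) (t : R) d : rder c t d -> {for t, continuous c}.
Proof.
move=> H; apply: ReIm_cvg.
  have [D _] := rder_Re H.
  by have/derivable1_diffP/differentiable_continuous := D.
have [D _] := rder_Im H.
by have/derivable1_diffP/differentiable_continuous := D.
Qed.

(** Mean value inequality, with the end points in either order. *)
Lemma deriv_le (f f' : R -> R) (a b s t M : R) :
  (forall x, a < x < b -> is_derive x 1 f (f' x)) ->
  (forall x, a < x < b -> `|f' x| <= M) ->
  a < s < b -> a < t < b -> `|f s - f t| <= M * `|s - t|.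
Proof.
move=> df bf.
have W : forall s t, a < s < b -> a < t < b -> s <= t -> `|f s - f t| <= M * `|s - t|.
  move=> {}s {}t /andP[as_ sb] /andP[at_ tb] st.
  have [||c] := @MVT_segment _ f f' s t st.
  - move=> x; rewrite in_itv /= => /andP[sx xt]; apply: df.
    by rewrite (lt_trans as_) //= (lt_trans xt).
  - apply: derivable_within_continuous => x; rewrite in_itv /= => /andP[sx xt].
    have [] // := df x _.
    by rewrite (lt_le_trans as_) //= (le_lt_trans xt).
  rewrite in_itv /= => /andP[sc ct] E.
  rewrite distrC E normrM (distrC s) ler_wpM2r //; apply: bf.
  by rewrite (lt_le_trans as_) //= (le_lt_trans ct).
move=> sI tI; case: (leP s t) => [|/ltW] st; first exact: W.
by rewrite distrC (distrC s); exact: W.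
Qed.

(** There is no mean value theorem for complex curves: it is applied to both the
    real and the imaginary part, at the cost of the factor 2. *)
Lemma rder_le (c c' : R -> C) (a b s t M : R) :
  (forall x, a < x < b -> rder c x (c' x)) ->
  (forall x, a < x < b -> `|c' x| <= rc M) ->
  a < s < b -> a < t < b -> `|c s - c t| <= rc (2 * M * `|s - t|).
Proof.
move=> dc bc sI tI.
have HR : `|complex.Re (c s) - complex.Re (c t)| <= M * `|s - t|.
  apply: (@deriv_le (fun x => complex.Re (c x)) (fun x => complex.Re (c' x)) a b) => // x xI.
    exact/rder_Re/dc.
  rewrite -rc_le; apply: le_trans (bc _ xI); exact: Re_norm.
have HI : `|complex.Im (c s) - complex.Im (c t)| <= M * `|s - t|.
  apply: (@deriv_le (fun x => complex.Im (c x)) (fun x => complex.Im (c' x)) a b) => // x xI.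
    exact/rder_Im/dc.
  rewrite -rc_le; apply: le_trans (bc _ xI); exact: Im_norm.
rewrite (complex_split (c s - c t)).
apply: (le_trans (ler_normD _ _)); rewrite normrM !rc_norm.
have -> : `|'i%C : C| = 1 by rewrite normc_def /= expr0n expr1n add0r sqrtr1.
rewrite mul1r -rcD rc_le Re_add Im_add Re_opp Im_opp.
by rewrite -mulrA mulr_natl mulr2n lerD.
Qed.

Lemma rder0_cst (c : R -> C) (a b s t : R) :
  (forall x, a < x < b -> rder c x 0) ->
  a < s < b -> a < t < b -> c s = c t.
Proof.
move=> dc sI tI.
have H := fun B => @rder_le c (fun=> 0 : C) a b s t 0 dc B sI tI.
have {}H : `|c s - c t| <= rc (2 * 0 * `|s - t|).
  by apply: H => x _; rewrite normr0 rc0.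
by move: H; rewrite mulr0 mul0r rc0 normr_le0 subr_eq0 => /eqP.
Qed.
End RCurve.

(** * Derivatives of regular functions and of algebraic representations *)
Section MxLimits.
Variable K : numFieldType.

Lemma cvg_mxP m n T (F : set_system T) (FF : Filter F) (f : T -> 'M[K]_(m, n)) (l : 'M[K]_(m, n)) :
  f @ F --> l <-> forall i j, (fun x => f x i j) @ F --> l i j.
Proof.
split=> [fl i j|H].
  exact: (cvg_comp _ _ fl (@coord_continuous _ _ _ i j l)).
move=> A [P Pl PA]; rewrite /nbhs /=.
have : \forall x \near F, forall i j, P i j (f x i j).
  apply: filter_forall => i; apply: filter_forall => j.
  exact: (H i j _ (Pl i j)).
by apply: filterS => x Hx; apply: PA.
Qed.
End MxLimits.

Section Pairing.
Variables (K : comPzRingType) (m n : nat).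
Implicit Types (G H M : 'M[K]_(m, n)).
(** The bilinear pairing of matrices by which a gradient acts on a tangent
    vector. *)
Definition ip G M : K := \sum_a \sum_b G a b * M a b.

Lemma ip_delta i j M : ip (delta_mx i j) M = M i j.
Proof.
rewrite /ip (bigD1 i) //= (bigD1 j) //= mxE !eqxx mul1r.
rewrite big1 => [|j' jj]; last by rewrite mxE (negbTE jj) andbF mul0r.
rewrite big1 => [|i' ii]; first by rewrite !addr0.
by rewrite big1 // => j' _; rewrite mxE (negbTE ii) mul0r.
Qed.

Lemma ip0 M : ip 0 M = 0.
Proof. by rewrite /ip big1 // => i _; rewrite big1 // => j _; rewrite mxE mul0r. Qed.

Lemma ipD G H M : ip (G + H) M = ip G M + ip H M.
Proof.
rewrite /ip -big_split; apply: eq_bigr => i _; rewrite -big_split.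
by apply: eq_bigr => j _; rewrite mxE mulrDl.
Qed.

Lemma ipZ c G M : ip (c *: G) M = c * ip G M.
Proof.
rewrite /ip mulr_sumr; apply: eq_bigr => i _; rewrite mulr_sumr.
by apply: eq_bigr => j _; rewrite mxE mulrA.
Qed.

Lemma ipZr c G M : ip G (c *: M) = c * ip G M.
Proof.
rewrite /ip mulr_sumr; apply: eq_bigr => i _; rewrite mulr_sumr.
by apply: eq_bigr => j _; rewrite mxE mulrCA.
Qed.
End Pairing.

Lemma mulmx_leibniz (K : pzSemiRingType) p q r (M s0 : 'M[K]_(p, q)) (t0 N : 'M[K]_(q, r)) i j :
  (M *m t0 + s0 *m N) i j = \sum_l (M i l * t0 l j + s0 i l * N l j).
Proof. by rewrite !mxE -big_split. Qed.

Lemma mulmx_add0 (K : pzSemiRingType) p q r t (A : 'M[K]_(p, q)) (B : 'M[K]_(q, r)) (D : 'M[K]_(p, t)) :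
  A *m B + D *m 0 = A *m B.
Proof. by rewrite mulmx0 addr0. Qed.

Local Opaque C.

Section RegDer.
Variables (R : realType) (n : nat).
Local Notation C := (C R).

Definition mxqder p q (T : Type) (F : set_system T) (k : T -> C) (u : T -> 'M[C]_(p, q)) (s0 M : 'M[C]_(p, q)) :=
  forall i j, qder F k (fun x => u x i j) (s0 i j) (M i j).

(** [G] is the gradient of [f] at [s0], in the strong sense that the chain rule
    holds along every differentiable family of matrices through [s0].  Quantifying
    over the family makes the property stable under sums and products, so that it
    follows for all regular functions by induction. *)
Definition has_grad (f : 'M[C]_n -> C) (s0 : 'M[C]_n) (G : 'M[C]_n) : Prop :=
  forall (T : Type) (F : set_system T) (k : T -> C) (u : T -> 'M[C]_n) M,
    ProperFilter F -> k @ F --> (0 : C) -> (\forall x \near F, k x != 0) ->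
    mxqder F k u s0 M ->
    qder F k (fun x => f (u x)) (f s0) (ip G M).

Lemma grad_cst c s0 : has_grad (fun=> c) s0 0.
Proof. by move=> T F k u M FF k0 kn uM; rewrite ip0; exact: qder_cst. Qed.

Lemma grad_coord i j s0 : has_grad (fun s => s i j) s0 (delta_mx i j).
Proof. by move=> T F k u M FF k0 kn uM; rewrite ip_delta; exact: uM. Qed.

Lemma gradD f g s0 G H : has_grad f s0 G -> has_grad g s0 H ->
  has_grad (fun s => f s + g s) s0 (G + H).
Proof.
move=> fG gH T F k u M FF k0 kn uM; rewrite ipD.
exact: (qderD FF (fG _ _ _ _ _ FF k0 kn uM) (gH _ _ _ _ _ FF k0 kn uM)).
Qed.

Lemma gradM f g s0 G H : has_grad f s0 G -> has_grad g s0 H ->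
  has_grad (fun s => f s * g s) s0 (g s0 *: G + f s0 *: H).
Proof.
move=> fG gH T F k u M FF k0 kn uM; rewrite ipD !ipZ (mulrC (g s0) (ip _ _)).
exact: (qderM FF k0 kn (fG _ _ _ _ _ FF k0 kn uM) (gH _ _ _ _ _ FF k0 kn uM)).
Qed.

Lemma gradV f s0 G : f s0 != 0 -> has_grad f s0 G ->
  has_grad (fun s => (f s)^-1) s0 (- (f s0)^-1 ^+ 2 *: G).
Proof.
move=> fn fG T F k u M FF k0 kn uM; rewrite ipZ mulNr mulrC -mulNr.
exact: (qderV FF k0 kn fn (fG _ _ _ _ _ FF k0 kn uM)).
Qed.

Lemma grad_sum (I : Type) (r : seq I) (f : I -> 'M[C]_n -> C) s0 :
  (forall i, exists G, has_grad (f i) s0 G) ->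
  exists G, has_grad (fun s => \sum_(i <- r) f i s) s0 G.
Proof.
move=> H; elim: r => [|a r [G IH]].
  by exists 0; under eq_fun do rewrite big_nil; exact: grad_cst.
have [G' aG] := H a; exists (G' + G).
by under eq_fun do rewrite big_cons; exact: (gradD aG IH).
Qed.

Lemma grad_prod (I : Type) (r : seq I) (f : I -> 'M[C]_n -> C) s0 :
  (forall i, exists G, has_grad (f i) s0 G) ->
  exists G, has_grad (fun s => \prod_(i <- r) f i s) s0 G.
Proof.
move=> H; elim: r => [|a r [G IH]].
  by exists 0; under eq_fun do rewrite big_nil; exact: grad_cst.
have [G' aG] := H a.
have -> : (fun s => \prod_(i <- a :: r) f i s) = (fun s => f a s * \prod_(i <- r) f i s).
  by apply/funext => s; rewrite big_cons.
exact: (ex_intro _ _ (gradM aG IH)).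
Qed.

Lemma grad_det s0 : exists G, has_grad (fun s => \det s) s0 G.
Proof.
rewrite /determinant; apply: grad_sum => p.
have [G pG] : exists G, has_grad (fun s => \prod_i s i (p i)) s0 G.
  by apply: grad_prod => i; exists (delta_mx i (p i)); exact: grad_coord.
have aG : has_grad (fun=> ((-1) ^+ p : C)) s0 0 by apply: grad_cst.
by eexists; exact: (gradM aG pG).
Qed.

Lemma reg_grad f s0 : s0 \in unitmx -> regular_fun f -> exists G, has_grad f s0 G.
Proof.
rewrite unitmxE unitfE => us; elim=> [c|i j||{}f g _ [G fG] _ [H gH]|{}f g _ [G fG] _ [H gH]].
- by exists 0; exact: grad_cst.
- by exists (delta_mx i j); exact: grad_coord.
- by have [G dG] := grad_det s0; exact: (ex_intro _ _ (gradV us dG)).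
- exact: (ex_intro _ _ (gradD fG gH)).
- exact: (ex_intro _ _ (gradM fG gH)).
Qed.

Section F.
Variables (T : Type) (F : set_system T) (FF : ProperFilter F) (k : T -> C).
Hypothesis k0 : k @ F --> (0 : C).
Hypothesis kn0 : \forall x \near F, k x != 0.

Lemma mxqder_unit (u : T -> 'M[C]_n) s0 M : s0 \in unitmx -> mxqder F k u s0 M ->
  \forall x \near F, u x \in unitmx.
Proof.
rewrite unitmxE unitfE => us uM; have [G dG] := grad_det s0.
have /(qder_cvg FF k0 kn0) H := dG _ _ _ _ _ FF k0 kn0 uM.
have := H; move/cvgrPdist_lt => /(_ `|\det s0|); rewrite normr_gt0 => /(_ us).
apply: filterS => x; rewrite unitmxE unitfE; apply: contraTneq => ->; by rewrite subr0 ltxx.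
Qed.

Lemma mxqder_cvg p q (u : T -> 'M[C]_(p, q)) s0 M : mxqder F k u s0 M -> u @ F --> s0.
Proof. by move=> H; apply/cvg_mxP => i j; exact: (qder_cvg FF k0 kn0 (H i j)). Qed.

Lemma mxqderM p q r (u : T -> 'M[C]_(p, q)) (v : T -> 'M[C]_(q, r)) s0 t0 M N :
  mxqder F k u s0 M -> mxqder F k v t0 N ->
  mxqder F k (fun x => u x *m v x) (s0 *m t0) (M *m t0 + s0 *m N).
Proof.
move=> uM vN i j; rewrite mulmx_leibniz [(s0 *m t0) i j]mxE.
have -> : (fun x => (u x *m v x) i j) = (fun x => \sum_l u x i l * v x l j).
  by apply/funext => x; rewrite mxE.
by apply: (qder_sum FF) => l _; exact: (qderM FF k0 kn0 (uM i l) (vN l j)).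
Qed.

Lemma mxqder_cst p q (M : 'M[C]_(p, q)) : mxqder F k (fun=> M) M 0.
Proof. by move=> i j; rewrite mxE; exact: (qder_cst FF). Qed.

Lemma mxqder_eq p q (u v : T -> 'M[C]_(p, q)) s0 M : (\forall x \near F, u x = v x) ->
  mxqder F k v s0 M -> mxqder F k u s0 M.
Proof.
move=> uv H i j; apply: (qder_eq FF _ (H i j)); by apply: filterS uv => x ->.
Qed.

Lemma mxqder_unique p q (u : T -> 'M[C]_(p, q)) s0 M N :
  mxqder F k u s0 M -> mxqder F k u s0 N -> M = N.
Proof.
move=> uM uN; apply/matrixP => i j; have a := uM i j; have b := uN i j.
exact: (cvg_unique _ a b).
Qed.
End F.

Lemma cvg_id_dnbhsC : id @ (0 : C)^' --> (0 : C).
Proof. apply: cvg_within_filter; exact: cvg_id. Qed.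
Lemma near_dnbhsC_neq0 : \forall x \near (0 : C)^', x != 0.
Proof. by rewrite near_withinE; near=> x => x0.
Unshelve. all: by end_near. Qed.

Lemma mxqder_derive p q p' q' (f : 'M[C]_(p, q) -> 'M[C]_(p', q')) s0 M D :
  mxqder (0 : C)^' id (fun h => f (s0 + h *: M)) (f s0) D -> 'D_M f s0 = D.
Proof.
move=> H; apply: cvg_lim; first exact: norm_hausdorff.
apply/cvg_mxP => i j; apply: cvg_trans (H i j).
apply: near_eq_cvg; near=> h.
by rewrite !mxE /= (addrC s0).
Unshelve. all: by end_near. Qed.

Section Rep.
Variables (m : nat) (Psi : 'M[C]_n -> 'M[C]_m) (PR : algebraic_rep Psi).

(** The entries of a representation are regular near the identity and so have
    gradients there. *)
Lemma rep_qder_ex : exists G : 'I_m -> 'I_m -> 'M[C]_n,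
  forall (T : Type) (F : set_system T) (k : T -> C) (u : T -> 'M[C]_n) M,
    ProperFilter F -> k @ F --> (0 : C) -> (\forall x \near F, k x != 0) ->
    mxqder F k u 1%:M M ->
    mxqder F k (fun x => Psi (u x)) 1%:M (\matrix_(i, j) ip (G i j) M).
Proof.
have H ij : exists G : 'M[C]_n,
  forall (T : Type) (F : set_system T) (k : T -> C) (u : T -> 'M[C]_n) M,
    ProperFilter F -> k @ F --> (0 : C) -> (\forall x \near F, k x != 0) ->
    mxqder F k u 1%:M M ->
    qder F k (fun x => Psi (u x) ij.1 ij.2) ((1%:M : 'M[C]_m) ij.1 ij.2) (ip G M).
  have [f rf Pf] := rep_regular PR ij.1 ij.2.
  have [G fG] := reg_grad (unitmx1 C n) rf.
  exists G => T F k u M FF k0 kn uM.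
  have Pf1 := Pf _ (unitmx1 C n); rewrite (rep_one PR) in Pf1.
  have := fG _ _ _ _ _ FF k0 kn uM; rewrite -Pf1.
  apply: (qder_eq FF); apply: filterS (mxqder_unit FF k0 kn (unitmx1 C n) uM) => x ux.
  exact: Pf.
have [G GP] := choice H; exists (fun i j => G (i, j)) => T F k u M FF k0 kn uM i j.
by rewrite [X in qder _ _ _ _ X]mxE; exact: (GP (i, j) _ _ _ _ _ FF k0 kn uM).
Qed.

Lemma line_qder (M : 'M[C]_n) : mxqder (0 : C)^' id (fun h => 1%:M + h *: M) 1%:M M.
Proof.
move=> i j; rewrite /qder; have H : (fun=> M i j) @ (0 : C)^' --> M i j by exact: cvg_cst.
apply: (cvg_trans _ H); apply: near_eq_cvg; near=> h.
have h0 : h != 0 by near: h; exact: near_dnbhsC_neq0.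
by rewrite !mxE addrAC subrr add0r mulrA mulVf // mul1r.
Unshelve. all: by end_near. Qed.

Lemma rep_qder (T : Type) (F : set_system T) (k : T -> C) (u : T -> 'M[C]_n) M :
  ProperFilter F -> k @ F --> (0 : C) -> (\forall x \near F, k x != 0) ->
  mxqder F k u 1%:M M -> mxqder F k (fun x => Psi (u x)) 1%:M (rep_diff Psi M).
Proof.
have [G GP] := rep_qder_ex => FF k0 kn uM.
rewrite /rep_diff (mxqder_derive (D := \matrix_(i, j) ip (G i j) M)).
  exact: GP.
rewrite (rep_one PR); apply: GP.
- exact: cvg_id_dnbhsC.
- exact: near_dnbhsC_neq0.
- exact: line_qder.
Qed.

Lemma rep_diff_linear : exists G : 'I_m -> 'I_m -> 'M[C]_n,
  forall M i j, rep_diff Psi M i j = ip (G i j) M.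
Proof.
have [G GP] := rep_qder_ex; exists G => M i j.
rewrite /rep_diff (mxqder_derive (D := \matrix_(i, j) ip (G i j) M)).
  by rewrite mxE.
rewrite (rep_one PR); apply: GP.
- exact: cvg_id_dnbhsC.
- exact: near_dnbhsC_neq0.
- exact: line_qder.
Qed.

Lemma rep_unit s : s \in unitmx -> Psi s *m Psi (invmx s) = 1%:M.
Proof. by move=> us; rewrite -(rep_mul PR) ?unitmx_inv // mulmxV // (rep_one PR). Qed.

Lemma rep_unitmx s : s \in unitmx -> Psi s \in unitmx.
Proof. by move=> us; have [] := mulmx1_unit (rep_unit us). Qed.

Lemma rep_diffZ c M : rep_diff Psi (c *: M) = c *: rep_diff Psi M.
Proof.
have [G GP] := rep_diff_linear; apply/matrixP => i j.
by rewrite (GP (c *: M)) ipZr [RHS]mxE (GP M).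
Qed.

(** Translating by the inverse of [s0] moves the base point to the identity, where
    the derivative is [rep_diff] by definition. *)
Lemma rep_qder_at (T : Type) (F : set_system T) (k : T -> C) (u : T -> 'M[C]_n) s0 M :
  ProperFilter F -> k @ F --> (0 : C) -> (\forall x \near F, k x != 0) ->
  s0 \in unitmx ->
  mxqder F k u s0 (M *m s0) -> mxqder F k (fun x => Psi (u x)) (Psi s0) (rep_diff Psi M *m Psi s0).
Proof.
move=> FF k0 kn us uM.
have vM : mxqder F k (fun x => u x *m invmx s0) 1%:M M.
  have := mxqderM FF k0 kn uM (mxqder_cst FF k (invmx s0)).
  by rewrite mulmx_add0 (mulmxK us) (mulmxV us).
have H := mxqderM FF k0 kn (rep_qder FF k0 kn vM) (mxqder_cst FF k (Psi s0)).
rewrite mulmx_add0 in H.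
rewrite (mul1mx (Psi s0)) in H.
apply: (mxqder_eq FF _ H).
have := mxqder_unit FF k0 kn us uM; apply: filterS => x ux.
rewrite -(rep_mul PR) ?unitmx_mul ?unitmx_inv ?ux //; by rewrite mulmxKV.
Qed.
End Rep.

End RegDer.

Local Transparent C.

(** * Linear algebra over a field of germs *)
Section GermField.
Variables (k : numFieldType) (T : Type) (F : set_system T) (FF : ProperFilter F).

(** A field of germs along [F]: the functions are total, equality is equality near
    [F], and [gf_dich] is what makes a nonzero germ invertible. *)
Record germ_field (Kr : (T -> k) -> Prop) : Prop := GermField {
  gf_ext : forall f g, (\forall t \near F, f t = g t) -> Kr f -> Kr g;
  gf_cst : forall c, Kr (fun=> c);
  gf_add : forall f g, Kr f -> Kr g -> Kr (fun t => f t + g t);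
  gf_mul : forall f g, Kr f -> Kr g -> Kr (fun t => f t * g t);
  gf_inv : forall f, Kr f -> Kr (fun t => (f t)^-1);
  gf_dich : forall f, Kr f -> (\forall t \near F, f t = 0) \/ (\forall t \near F, f t != 0)
}.

Variables (Kr : (T -> k) -> Prop) (KF : germ_field Kr).

Lemma gf_eq f g : f =1 g -> Kr f -> Kr g.
Proof. by move=> fg; apply: (gf_ext KF); apply: nearW => t; rewrite fg. Qed.

Lemma gf_opp f : Kr f -> Kr (fun t => - f t).
Proof. by move=> /(gf_mul KF (gf_cst KF (-1))); apply: gf_eq => t; rewrite mulN1r. Qed.

Lemma gf_sub f g : Kr f -> Kr g -> Kr (fun t => f t - g t).
Proof. by move=> rf /gf_opp; exact: gf_add. Qed.

Lemma gf_sum (I : Type) (r : seq I) (P : pred I) (f : I -> T -> k) :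
  (forall i, P i -> Kr (f i)) -> Kr (fun t => \sum_(i <- r | P i) f i t).
Proof.
move=> H; elim: r => [|a r IH].
  by under eq_fun do rewrite big_nil; exact: (gf_cst KF).
under eq_fun do rewrite big_cons.
by case: (boolP (P a)) => // Pa; apply: (gf_add KF) => //; exact: H.
Qed.

Definition germ_mx m n (M : T -> 'M[k]_(m, n)) := forall i j, Kr (fun t => M t i j).

Lemma germ_mx_mul m n p (M : T -> 'M[k]_(m, n)) (N : T -> 'M[k]_(n, p)) :
  germ_mx M -> germ_mx N -> germ_mx (fun t => M t *m N t).
Proof.
move=> kM kN i j; under eq_fun do rewrite mxE.
by apply: gf_sum => l _; exact: (gf_mul KF).
Qed.

Lemma germ_mx_add m n (M N : T -> 'M[k]_(m, n)) :
  germ_mx M -> germ_mx N -> germ_mx (fun t => M t + N t).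
Proof. by move=> kM kN i j; under eq_fun do rewrite mxE; exact: (gf_add KF). Qed.

Lemma germ_mx_sub m n (M N : T -> 'M[k]_(m, n)) :
  germ_mx M -> germ_mx N -> germ_mx (fun t => M t - N t).
Proof. by move=> kM kN i j; under eq_fun do rewrite !mxE; exact: gf_sub. Qed.

Lemma germ_mx_cst m n (M : 'M[k]_(m, n)) : germ_mx (fun=> M).
Proof. by move=> i j; exact: (gf_cst KF). Qed.

Lemma germ_mx_scale m n a (M : T -> 'M[k]_(m, n)) : Kr a -> germ_mx M -> germ_mx (fun t => a t *: M t).
Proof. by move=> ka kM i j; under eq_fun do rewrite mxE; exact: (gf_mul KF). Qed.

Lemma germ_mx_row m n (M : T -> 'M[k]_(m, n)) i : germ_mx M -> germ_mx (fun t => row i (M t)).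
Proof. by move=> kM a b; under eq_fun do rewrite mxE. Qed.

Lemma germ_mx_dich m n (M : T -> 'M[k]_(m, n)) : germ_mx M ->
  ~ (\forall t \near F, M t = 0) -> exists i j, \forall t \near F, M t i j != 0.
Proof.
move=> kM nM; apply: contrapT => Hn; apply: nM.
have : \forall t \near F, forall i j, M t i j = 0.
  apply: filter_forall => i; apply: filter_forall => j.
  have [//|H] := gf_dich KF (kM i j).
  by exfalso; apply: Hn; exists i, j.
by apply: filterS => t H; apply/matrixP => i j; rewrite mxE H.
Qed.

Record germ_subspace n (I : (T -> 'rV[k]_n) -> Prop) : Prop := Subsp {
  ss_ext : forall c d, (\forall t \near F, c t = d t) -> I c -> I d;
  ss_zero : I (fun=> 0);
  ss_add : forall c d, I c -> I d -> I (fun t => c t + d t);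
  ss_scale : forall a c, Kr a -> I c -> I (fun t => a t *: c t);
  ss_germ_mx : forall c, I c -> germ_mx c
}.

Lemma ss_sum n (I : (T -> 'rV[k]_n) -> Prop) (J : Type) (r : seq J) (P : pred J) f :
  germ_subspace I -> (forall j, P j -> I (f j)) -> I (fun t => \sum_(j <- r | P j) f j t).
Proof.
move=> sI H; elim: r => [|a r IH].
  by under eq_fun do rewrite big_nil; exact: (ss_zero sI).
under eq_fun do rewrite big_cons.
by case: (boolP (P a)) => // Pa; apply: (ss_add sI) => //; exact: H.
Qed.

Section Echelon.
Variables (n : nat) (I : (T -> 'rV[k]_n) -> Prop) (sI : germ_subspace I).
Variables (S : {set 'I_n}) (P : 'I_n -> T -> 'rV[k]_n).
Hypothesis PI : forall j, j \in S -> I (P j).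
Hypothesis Pd : forall j l, j \in S -> l \in S -> \forall t \near F, P j t 0 l = (j == l)%:R.

(** The rows [P j] are a reduced echelon family with pivots in [S]. *)
Definition echelon t : 'M[k]_n := \matrix_(j, l) (if j \in S then P j t 0 l else 0).

Lemma echelon_row i : I (fun t => row i (echelon t)).
Proof.
have [iS|iS] := boolP (i \in S).
  apply: (ss_ext sI) (PI iS); apply: nearW => t.
  by apply/rowP => l; rewrite !mxE iS.
apply: (ss_ext sI) (ss_zero sI); apply: nearW => t.
by apply/rowP => l; rewrite !mxE (negbTE iS).
Qed.

Lemma echelon_germ_mx : germ_mx echelon.
Proof. by move=> i j; have := ss_germ_mx sI (echelon_row i) 0 j; apply: gf_eq => t; rewrite mxE. Qed.

Lemma echelon_mul c : I c -> I (fun t => c t *m echelon t).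
Proof.
move=> Ic; apply: (ss_ext sI) (_ : I (fun t => \sum_j c t 0 j *: row j (echelon t))).
  by apply: nearW => t; rewrite mulmx_sum_row.
apply: (ss_sum _ sI) => j _; apply: (ss_scale sI (ss_germ_mx sI Ic 0 j)); exact: echelon_row.
Qed.

(** Multiplication by the echelon matrix does not change the pivot coordinates, so a
    vector and its product differ by a vector vanishing at all pivots. *)
Lemma echelon_pivot (c : T -> 'rV[k]_n) l : l \in S -> \forall t \near F, (c t *m echelon t) 0 l = c t 0 l.
Proof.
move=> lS; have : \forall t \near F, forall j, j \in S -> P j t 0 l = (j == l)%:R.
  apply: filter_forall => j; have [jS|jS] := boolP (j \in S).
    by apply: filterS (Pd jS lS) => t.
  exact: nearW.
apply: filterS => t Pt; rewrite mxE (bigD1 l) //= mxE lS Pt // eqxx mulr1.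
rewrite big1 ?addr0 // => j jl; rewrite mxE; case: ifP => jS; last by rewrite mulr0.
by rewrite Pt // (negbTE jl) mulr0.
Qed.
End Echelon.

(** Every subspace is the row space of an idempotent matrix over the field: Gaussian
    elimination, carried out near [F].  As long as the echelon matrix does not fix
    the whole subspace, a vector that it moves provides a new pivot. *)
Lemma projector n (I : (T -> 'rV[k]_n) -> Prop) : germ_subspace I ->
  exists E : T -> 'M[k]_n, [/\ germ_mx E, forall i, I (fun t => row i (E t)) &
    forall c, I c -> \forall t \near F, c t *m E t = c t].
Proof.
move=> sI.
suff H m : forall (S : {set 'I_n}) (P : 'I_n -> T -> 'rV[k]_n), (#|~: S| <= m)%N ->
   (forall j, j \in S -> I (P j)) ->
   (forall j l, j \in S -> l \in S -> \forall t \near F, P j t 0 l = (j == l)%:R) ->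
   exists E : T -> 'M[k]_n, [/\ germ_mx E, forall i, I (fun t => row i (E t)) &
    forall c, I c -> \forall t \near F, c t *m E t = c t].
  apply: (H _ finset.set0 (fun _ _ => 0) (leqnn _)) => [j|j l]; by rewrite inE.
elim: m => [|m IH] S P Sm PI Pd.
  exists (echelon S P); split.
  - exact: (echelon_germ_mx sI PI).
  - exact: (echelon_row sI PI).
  - move=> c Ic; have allS l : l \in S.
      by move: Sm; rewrite leqn0 cards_eq0 => /eqP/setP/(_ l); rewrite !inE => /negbFE.
    have : \forall t \near F, forall l, (c t *m echelon S P t) 0 l = c t 0 l.
      by apply: filter_forall => l; exact: (echelon_pivot Pd).
    by apply: filterS => t H; apply/rowP.
pose E := echelon S P.
have IcE := echelon_mul sI PI.
have cEl := echelon_pivot Pd.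
have [full|] := pselect (forall c, I c -> \forall t \near F, c t *m E t = c t).
  by exists E; split; [exact: (echelon_germ_mx sI PI)|exact: (echelon_row sI PI)|].
move=> /existsNP[c /not_implyP[Ic ncE]].
(* The defect of c vanishes at all the old pivots. *)
pose d t := c t - c t *m E t.
have Id : I d.
  apply: (ss_ext sI) (ss_add sI Ic (ss_scale sI (gf_cst KF (-1)) (IcE _ Ic))).
  by apply: nearW => t; rewrite scaleN1r.
have [a [l0 dl0]] : exists a l, \forall t \near F, d t a l != 0.
  apply: germ_mx_dich (ss_germ_mx sI Id) _ => H; apply: ncE; apply: filterS H => t.
  by rewrite /d => /eqP; rewrite subr_eq0 => /eqP.
rewrite (ord1 a) {a} in dl0.
have dS l : l \in S -> \forall t \near F, d t 0 l = 0.
  move=> lS; apply: filterS (cEl c l lS) => t H.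
  by rewrite /d [LHS]mxE [X in _ + X]mxE H subrr.
have l0S : l0 \notin S.
  apply/negP => /dS H; have : \forall t \near F, False.
    by apply: filterS2 H dl0 => t ->; rewrite eqxx.
  by move/filter_ex => [].
pose Q t := (d t 0 l0)^-1 *: d t.
have IQ : I Q by apply: (ss_scale sI) => //; apply: (gf_inv KF); exact: (ss_germ_mx sI Id).
(* The new pivot column is cleared in the old rows. *)
pose P' j t := if j == l0 then Q t else P j t - P j t 0 l0 *: Q t.
apply: (IH (l0 |: S) P').
- have -> : ~: (l0 |: S) = (~: S) :\ l0.
    by apply/setP => x; rewrite !inE negb_or.
  by move: Sm; rewrite (cardsD1 l0) !inE l0S.
- move=> j; rewrite !inE /P'; case: eqP => [_ _|_ /= jS]; first exact: IQ.
  have kP := ss_germ_mx sI (PI j jS) 0 l0.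
  apply: (ss_ext sI) (ss_add sI (PI j jS) (ss_scale sI (gf_opp kP) IQ)).
  by apply: nearW => t; rewrite scaleNr.
move=> j l jS' lS'.
have Ql : \forall t \near F, Q t 0 l = (l == l0)%:R.
  move: lS'; rewrite !inE; case: eqP => [-> _|_ /= lS].
    by apply: filterS dl0 => t H; rewrite /Q mxE mulVf.
  by apply: filterS (dS l lS) => t H; rewrite /Q mxE H mulr0.
move: jS'; rewrite !inE /P'; case: eqP => [-> _|/eqP jl0 /= jS].
  by apply: filterS Ql => t ->; rewrite eq_sym.
move: lS'; rewrite !inE; case: (eqVneq l l0) => [ll _|ll0 /= lS].
  apply: filterS Ql => t H; rewrite 3!mxE H ll eqxx mulr1 subrr.
  by rewrite (negbTE jl0).
apply: filterS2 Ql (Pd j l jS lS) => t H H'.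
by rewrite 3!mxE H (negbTE ll0) mulr0 subr0.
Qed.

(** The field of germs is von Neumann regular on matrices.  Solving a linear system
    with this inverse keeps the solution over the field, whereas solving it
    separately at each t would not. *)
Lemma generalized_inverse m n (M : T -> 'M[k]_(m, n)) : germ_mx M ->
  exists2 X : T -> 'M[k]_(n, m), germ_mx X & \forall t \near F, M t *m X t *m M t = M t.
Proof.
move=> kM.
pose I (c : T -> 'rV[k]_n) := germ_mx c /\ exists2 a : T -> 'rV[k]_m, germ_mx a & \forall t \near F, c t = a t *m M t.
have sI : germ_subspace I.
  split.
  - move=> c d cd [kc [a ka ca]]; split.
      move=> i j; apply: (gf_ext KF) (kc i j); by apply: filterS cd => t ->.
    by exists a => //; apply: filterS2 cd ca => t ->.
  - split; first exact: germ_mx_cst.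
    by exists (fun=> 0); [exact: germ_mx_cst|apply: nearW => t; rewrite mul0mx].
  - move=> c d [kc [a ka ca]] [kd [b kb db]]; split; first exact: germ_mx_add.
    exists (fun t => a t + b t); first exact: germ_mx_add.
    by apply: filterS2 ca db => t -> ->; rewrite mulmxDl.
  - move=> e c ke [kc [a ka ca]]; split; first exact: germ_mx_scale.
    exists (fun t => e t *: a t); first exact: germ_mx_scale.
    by apply: filterS ca => t ->; rewrite scalemxAl.
  - by move=> c [].
have [E [kE EI cE]] := projector sI.
have /choice[a aP] i : exists a : T -> 'rV[k]_m, germ_mx a /\ \forall t \near F, row i (E t) = a t *m M t.
  by have [_ [a ka aM]] := EI i; exists a.
exists (fun t => \matrix_(i, j) a i t 0 j).
  by move=> i j; have [ka _] := aP i; apply: gf_eq (ka 0 j) => t; rewrite mxE.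
have H1 : \forall t \near F, forall i, row i (E t) = a i t *m M t.
  by apply: filter_forall => i; have [] := aP i.
have H2 : \forall t \near F, forall i, row i (M t) *m E t = row i (M t).
  apply: filter_forall => i; apply: cE; split; first exact: germ_mx_row.
  exists (fun=> delta_mx 0 i); first exact: germ_mx_cst.
  by apply: nearW => t; rewrite rowE.
apply: filterS2 H1 H2 => t H1 H2; apply/row_matrixP => i.
rewrite -mulmxA row_mul -[RHS]H2; congr (_ *m _); apply/row_matrixP => j.
rewrite H1 row_mul; congr (_ *m _); apply/rowP => l; by rewrite !mxE.
Qed.

End GermField.

(** A subspace closed under the operations is a row space: add to a matrix, while it
    is possible, a vector outside its row space. *)
Lemma subspace_mx (k : fieldType) n (S : 'rV[k]_n -> Prop) :
  S 0 -> (forall u v, S u -> S v -> S (u + v)) -> (forall a u, S u -> S (a *: u)) ->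
  exists M : 'M[k]_n, forall v, S v <-> (v <= M)%MS.
Proof.
move=> S0 SD SZ.
pose good (M : 'M[k]_n) := forall v : 'rV_n, (v <= M)%MS -> S v.
pose Q r := `[< exists2 M, good M & \rank M = r >].
have exQ : exists r, Q r.
  exists (\rank (0 : 'M[k]_n)); apply/asboolP; exists 0 => // v.
  by rewrite submx0 => /eqP ->.
have bQ r : Q r -> (r <= n)%N by move=> /asboolP[M _ <-]; exact: rank_leq_col.
have [r /asboolP[M gM rM] maxr] := ex_maxnP exQ bQ.
exists M => v; split; last exact: gM.
move=> Sv; apply: contrapT => /negP nv.
have : (\rank (M + v)%MS <= r)%N.
  apply: maxr; apply/asboolP; exists (M + v)%MS => // w /sub_addsmxP[[a b] /= ->].
  apply: SD; first by apply: gM; exact: submxMl.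
  by rewrite (mx11_scalar b) mul_scalar_mx; exact: SZ.
rewrite -rM leqNgt => /negP; apply.
by apply: rank_ltmx; rewrite /ltmx addsmxSl addsmx_sub submx_refl.
Qed.

Lemma coef_XsubC_exp (k : comNzRingType) (c : k) e :
  (('X - c%:P) ^+ e.+1)`_e = - c *+ e.+1 /\ (('X - c%:P) ^+ e)`_e = 1.
Proof.
elim: e => [|e [IH1 IH2]].
  by rewrite expr1 expr0 coefB coefX coefC !coef1 /= sub0r mulr1n.
have L : (('X - c%:P) ^+ e.+1)`_e.+1 = 1.
  have : lead_coef (('X - c%:P) ^+ e.+1) = 1 by apply/monicP; rewrite monic_exp // monicXsubC.
  by rewrite lead_coefE size_exp_XsubC.
split => //; rewrite exprS mulrBl coefB coefXM /= coefCM L mulr1 IH1.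
by rewrite [in RHS]mulrS addrC.
Qed.

Section MinPoly.
Variables (k : numFieldType) (T : Type) (F : set_system T) (FF : ProperFilter F).
Variables (Kr : (T -> k) -> Prop) (KF : germ_field F Kr) (phi : T -> k).

Definition vanishing_poly d (p : T -> {poly k}) : Prop :=
  [/\ forall j, Kr (fun t => (p t)`_j), \forall t \near F, (size (p t) <= d)%N
    & \forall t \near F, root (p t) (phi t)].

Lemma poly_lead d (p : T -> {poly k}) : (\forall t \near F, (size (p t) <= d.+1)%N) ->
  (\forall t \near F, (p t)`_d = 0) -> \forall t \near F, (size (p t) <= d)%N.
Proof.
move=> H1 H2; apply: filterS2 H1 H2 => t H1 H2.
apply/leq_sizeP => j; rewrite leq_eqVlt => /predU1P[<- //|dj].
by move/leq_sizeP: H1; apply.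
Qed.

(** The minimal polynomial of [phi] over the field divides all the [R i], hence
    pointwise a power of 'X - phi.  In characteristic 0 its two leading
    coefficients then determine [phi].  Only the coefficients [b i] are allowed to
    leave the field. *)
Lemma power_span_rational m s (N : nat) (R : 'I_N -> T -> {poly k}) :
  (forall i, vanishing_poly m (R i)) ->
  (\forall t \near F, exists b : 'I_N -> k, ('X - (phi t)%:P) ^+ s = \sum_i b i *: R i t) ->
  Kr phi.
Proof.
move=> RV span.
(* p will be a nonzero vanishing polynomial of least degree. *)
pose Q d := `[< exists2 p, vanishing_poly d p & ~ \forall t \near F, p t = 0 >].
have exQ : exists d, Q d.
  exists m; apply/asboolP.
  have [i Hi] : exists i, ~ \forall t \near F, R i t = 0.
    apply: contrapT => /forallNP H.
    have : \forall t \near F, forall i, R i t = 0.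
      by apply: filter_forall => i; apply: contrapT; exact: H.
    move=> H0; have : \forall t \near F, False.
      apply: filterS2 span H0 => t [b E] H0.
      have : ('X - (phi t)%:P) ^+ s != 0 by rewrite expf_neq0 // polyXsubC_eq0.
      by rewrite E big1 ?eqxx // => i _; rewrite H0 scaler0.
    by move/filter_ex => [].
  by exists (R i).
case: (ex_minnP exQ) => d /asboolP[p [pK ps pr] pn0] mind.
case: d ps mind => [|e] ps mind.
  by case: pn0; apply: filterS ps => t; rewrite leqn0 size_poly_eq0 => /eqP.
have small q : vanishing_poly e q -> \forall t \near F, q t = 0.
  move=> qV; apply: contrapT => qn; have : Q e by apply/asboolP; exists q.
  by move/mind; rewrite ltnn.
have lead0 : \forall t \near F, (p t)`_e != 0.
  have [H|//] := gf_dich KF (pK e).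
  by case: pn0; apply: small; split => //; exact: poly_lead.
(* Euclidean division by p keeps the coefficients in the field. *)
have dvd d' : forall q, vanishing_poly d' q -> \forall t \near F, (p t %| q t)%R.
  elim: d' => [|d' IH] q [qK qs qr].
    by apply: filterS qs => t; rewrite leqn0 size_poly_eq0 => /eqP ->; exact: dvdp0.
  have [d'e|ed'] := ltnP d' e.
    have : \forall t \near F, q t = 0.
      apply: small; split => //; apply: filterS qs => t H.
      by apply: leq_trans H d'e.
    by apply: filterS => t ->; exact: dvdp0.
  pose a t := (q t)`_d' / (p t)`_e.
  have ka : Kr a by apply: (gf_mul KF) => //; exact: (gf_inv KF).
  pose q' t := q t - a t *: ('X^(d' - e) * p t).
  have : \forall t \near F, (p t %| q' t)%R.
    apply: IH; split.
    - move=> j; rewrite /q'; under eq_fun do rewrite coefB coefZ coefXnM.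
      apply: (gf_sub FF KF) => //; apply: (gf_mul KF) => //.
      by case: ltnP => _ //; exact: (gf_cst KF).
    - apply: (poly_lead (d := d')).
        apply: filterS2 qs ps => t Hq Hp; rewrite /q'.
        apply: leq_trans (size_polyD _ _) _; rewrite geq_max Hq size_polyN.
        apply: leq_trans (size_scale_leq _ _) _.
        apply: leq_trans (size_polyMleq _ _) _; rewrite size_polyXn addSn /=.
        by rewrite -(leq_add2l (d' - e)) addnS subnK // in Hp.
      apply: filterS lead0 => t Hl; rewrite /q' coefB coefZ coefXnM.
      rewrite ltnNge leq_subr /= subKn // /a divfK ?subrr //.
    - apply: filterS2 qr pr => t /eqP Hq /eqP Hp; rewrite /root /q' hornerD hornerN hornerZ hornerM.
      by rewrite Hq Hp !mulr0 subr0.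
  apply: filterS => t H; have -> : q t = q' t + a t *: ('X^(d' - e) * p t) by rewrite subrK.
  by rewrite dvdp_addr // -mul_polyC mulrA dvdp_mull.
have {dvd} D : \forall t \near F, p t %| ('X - (phi t)%:P) ^+ s.
  have : \forall t \near F, forall i, p t %| R i t by apply: filter_forall => i; exact: dvd (RV i).
  apply: filterS2 span => t [b ->] H; apply: (big_ind (fun u => p t %| u)) => [|u v|i _].
  - exact: dvdp0.
  - exact: dvdp_add.
  - by rewrite -mul_polyC dvdp_mull.
case: e => [|e] in ps mind small lead0 *.
  have : \forall t \near F, False; last by move/filter_ex => [].
  apply: filterS3 ps lead0 pr => t /size1_polyC ->.
  by rewrite coefC rootC /= => /negbTE ->.
(* p is a scalar multiple of ('X - phi) ^ e.+1. *)
have phiE : \forall t \near F, - ((p t)`_e / ((e.+1)%:R * (p t)`_e.+1)) = phi t.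
  apply: filterS3 ps lead0 D => t ps lead0 /dvdp_exp_XsubCP[j _ /eqpP[[c1 c2] /= /andP[c10 c20] E]].
  have sp : size (p t) = e.+2.
    apply/eqP; rewrite eqn_leq ps ltnNge; apply: contra lead0.
    by move=> /leq_sizeP -> //.
  have jE : j = e.+1.
    have := congr1 (fun u : {poly k} => size u) E.
    by rewrite /= !size_scale // sp size_exp_XsubC => -[].
  have [L1 L2] := coef_XsubC_exp (phi t) e; have [_ L3] := coef_XsubC_exp (phi t) e.+1.
  rewrite jE in E.
  have E1 := congr1 (fun u : {poly k} => u`_e) E; have E2 := congr1 (fun u : {poly k} => u`_e.+1) E.
  rewrite /= !coefZ L1 in E1; rewrite /= !coefZ L3 mulr1 in E2.
  have e0 : (e.+1)%:R != 0 :> k by rewrite pnatr_eq0.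
  have -> : (p t)`_e = c1^-1 * (c2 * (- phi t *+ e.+1)) by rewrite -E1 mulrA mulVf // mul1r.
  rewrite -E2 -(mulr_natr (- phi t)); move: (e.+1%:R) e0 => N1 e0; field.
  by rewrite lead0 c10 e0.
apply: (gf_ext KF) phiE _; apply: (gf_opp FF KF); apply: (gf_mul KF) => //.
by apply: (gf_inv KF); apply: (gf_mul KF) => //; exact: (gf_cst KF).
Qed.
End MinPoly.

(** * Translation-stable spaces of regular functions *)
Section Sandwich.
Variables (K : comPzRingType) (p q : nat).
(** The matrix of X |-> L X Q acting on matrices written as column vectors; it
    serves both for tensor products of representations and for conjugation. *)
Definition sandwich (L : 'M[K]_p) (Q : 'M[K]_q) : 'M[K]_(p * q) :=
  (lin_mx (mulmxr Q \o mulmx L : 'M[K]_(p, q) -> _))^T.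

Lemma sandwichE L Q (X : 'M[K]_(p, q)) : sandwich L Q *m (mxvec X)^T = (mxvec (L *m X *m Q))^T.
Proof. by rewrite /sandwich -trmx_mul mul_vec_lin. Qed.

(** Matrices written as columns exhaust the column vectors. *)
Lemma cvec_ext m (M N : 'M[K]_(m, p * q)) : (forall X : 'M[K]_(p, q), M *m (mxvec X)^T = N *m (mxvec X)^T) -> M = N.
Proof.
move=> H; apply: trmx_inj; apply/row_matrixP => i; rewrite !rowE -(vec_mxK (delta_mx 0 i)).
by apply: trmx_inj; rewrite !trmx_mul !trmxK H.
Qed.

Lemma sandwich1 : sandwich 1%:M 1%:M = 1%:M.
Proof. by apply: cvec_ext => X; rewrite sandwichE mul1mx mulmx1 mul1mx. Qed.

Lemma sandwichM L Q L' Q' : sandwich L Q *m sandwich L' Q' = sandwich (L *m L') (Q' *m Q).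
Proof. by apply: cvec_ext => X; rewrite -mulmxA !sandwichE !mulmxA. Qed.

Lemma sandwich_entry L Q i j k l :
  sandwich L Q (mxvec_index i j) (mxvec_index k l) = L i k * Q l j.
Proof.
have := congr1 (fun M : 'cV_(p * q) => M (mxvec_index i j) 0) (sandwichE L Q (delta_mx k l)).
rewrite mxvec_delta trmx_delta -colE [LHS]mxE => ->.
rewrite mxE mxvecE -(mul_delta_mx (0 : 'I_1)) !mulmxA -mulmxA -colE -rowE mxE big_ord1.
by rewrite !mxE.
Qed.

Lemma mxvec_tensor (x : 'rV[K]_p) (y : 'rV[K]_q) (u : 'cV[K]_p) (v : 'cV[K]_q) :
  (mxvec (x^T *m y) *m (mxvec (u *m v^T))^T) 0 0 = (x *m u) 0 0 * (y *m v) 0 0.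
Proof.
rewrite [LHS]mxE (reindex _ (curry_mxvec_bij _ _)) /=.
rewrite [X in X * _]mxE [X in _ * X]mxE mulr_suml.
under [RHS]eq_bigr do rewrite mulr_sumr.
rewrite pair_bigA; apply: eq_bigr => -[i j] _ /=.
by rewrite [X in _ * X]mxE !mxvecE !mxE !big_ord1 !mxE mulrACA.
Qed.
End Sandwich.

Section Stable.
Variables (R : realType) (n : nat).
Local Notation C := (C R).

(** Only the values at invertible matrices matter. *)
Definition unit_regular (f : 'M[C]_n -> C) := exists2 g, regular_fun g & {in unitmx, f =1 g}.

Lemma sandwich_rep p q (L : 'M[C]_n -> 'M[C]_p) (Q : 'M[C]_n -> 'M[C]_q) :
  L 1%:M = 1%:M -> Q 1%:M = 1%:M ->
  {in unitmx &, forall s t, L (s *m t) = L s *m L t} ->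
  {in unitmx &, forall s t, Q (s *m t) = Q t *m Q s} ->
  (forall i j, unit_regular (fun s => L s i j)) ->
  (forall i j, unit_regular (fun s => Q s i j)) ->
  algebraic_rep (fun s => sandwich (L s) (Q s)).
Proof.
move=> L1 Q1 LM QM Lr Qr; split.
- by rewrite L1 Q1 sandwich1.
- by move=> s t us ut; rewrite sandwichM LM ?QM.
- move=> x y; case/mxvec_indexP: x => i j; case/mxvec_indexP: y => k l.
  have [f rf Lf] := Lr i k; have [g rg Qg] := Qr l j.
  exists (fun s => f s * g s); first exact: Reg_mul.
  by move=> s us; rewrite sandwich_entry Lf // Qg.
Qed.

(** [mu] collects functions on GL_n whose span is stable under left translation,
    which acts on them through the representation [T]. *)
Record stable N (mu : 'M[C]_n -> 'cV[C]_N) (T : 'M[C]_n -> 'M[C]_N) : Prop := Stable {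
  st_rep : algebraic_rep T;
  st_reg : forall i, unit_regular (fun s => mu s i 0);
  st_mul : {in unitmx &, forall s t, mu (s *m t) = T s *m mu t}
}.

Lemma stable_sum N1 N2 mu1 mu2 T1 T2 : @stable N1 mu1 T1 -> @stable N2 mu2 T2 ->
  stable (fun s => col_mx (mu1 s) (mu2 s)) (fun s => block_mx (T1 s) 0 0 (T2 s)).
Proof.
move=> [r1 g1 m1] [r2 g2 m2]; split.
- split.
  + by rewrite (rep_one r1) (rep_one r2) -scalar_mx_block.
  + move=> s t us ut; rewrite (rep_mul r1 us ut) (rep_mul r2 us ut) mulmx_block.
    by rewrite !mul0mx !mulmx0 !addr0 add0r.
  + move=> i j; rewrite -(fintype.splitK i) -(fintype.splitK j); case: (fintype.split i) => i'; case: (fintype.split j) => j' /=.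
    * have [f rf fE] := rep_regular r1 i' j'; exists f => // s us; by rewrite block_mxEul fE.
    * exists (fun=> 0); [exact: Reg_cst|move=> s us; by rewrite block_mxEur mxE].
    * exists (fun=> 0); [exact: Reg_cst|move=> s us; by rewrite block_mxEdl mxE].
    * have [f rf fE] := rep_regular r2 i' j'; exists f => // s us; by rewrite block_mxEdr fE.
- move=> i; rewrite -(fintype.splitK i); case: (fintype.split i) => i' /=.
    have [f rf fE] := g1 i'; exists f => // s us; by rewrite col_mxEu fE.
  have [f rf fE] := g2 i'; exists f => // s us; by rewrite col_mxEd fE.
- move=> s t us ut; rewrite (m1 _ _ us ut) (m2 _ _ us ut) mul_block_col.
  by rewrite !mul0mx addr0 add0r.
Qed.

Lemma stable_prod N1 N2 mu1 mu2 T1 T2 : @stable N1 mu1 T1 -> @stable N2 mu2 T2 ->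
  stable (fun s => (mxvec (mu1 s *m (mu2 s)^T))^T) (fun s => sandwich (T1 s) (T2 s)^T).
Proof.
move=> [r1 g1 m1] [r2 g2 m2]; split.
- apply: sandwich_rep.
  + exact: (rep_one r1).
  + by rewrite (rep_one r2) trmx1.
  + exact: (rep_mul r1).
  + by move=> s t us ut; rewrite (rep_mul r2 us ut) trmx_mul.
  + move=> i j; have [f rf fE] := rep_regular r1 i j; by exists f.
  + move=> i j; have [f rf fE] := rep_regular r2 j i; exists f => // s us; by rewrite mxE fE.
- move=> x; case/mxvec_indexP: x => i j.
  have [f rf fE] := g1 i; have [g rg gE] := g2 j.
  exists (fun s => f s * g s); first exact: Reg_mul.
  by move=> s us; rewrite mxE mxvecE mxE big_ord1 [in X in _ * X]mxE fE // gE.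
- move=> s t us ut; rewrite sandwichE (m1 _ _ us ut) (m2 _ _ us ut) trmx_mul.
  by rewrite !mulmxA.
Qed.

Lemma stable_coord j : stable (col j : 'M[C]_n -> 'cV[C]_n) id.
Proof.
split.
- split => // i l; exists (fun s => s i l) => //; exact: Reg_coord.
- move=> i; exists (fun s => s i j); first exact: Reg_coord.
  by move=> s us; rewrite mxE.
- by move=> s t us ut; rewrite (colE j (s *m t)) (colE j t) mulmxA.
Qed.

Lemma stable_cst c : stable (fun _ : 'M[C]_n => c%:M : 'cV[C]_1) (fun=> 1%:M).
Proof.
split.
- split => //; first by move=> s t us ut; rewrite mulmx1.
  move=> i l; exists (fun s => (1%:M : 'M[C]_1) i l) => //; exact: Reg_cst.
- move=> i; exists (fun=> (c%:M : 'M[C]_1) i 0) => //; exact: Reg_cst.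
- by move=> s t us ut; rewrite mul1mx.
Qed.

Lemma stable_invdet : stable (fun s : 'M[C]_n => ((\det s)^-1)%:M : 'cV[C]_1) (fun s => ((\det s)^-1)%:M).
Proof.
have H i j : exists2 f, regular_fun f &
    {in unitmx, forall s : 'M[C]_n, (((\det s)^-1)%:M : 'M[C]_1) i j = f s}.
  exists (fun s => (\det s)^-1); first exact: Reg_invdet.
  by move=> s us; rewrite (ord1 i) (ord1 j) mxE eqxx mulr1n.
split.
- split => //; first by rewrite det1 invr1.
  by move=> s t us ut; rewrite det_mulmx invfM scalar_mxM.
- by move=> i; exact: H.
- by move=> s t us ut; rewrite det_mulmx invfM scalar_mxM.
Qed.

(** A regular function lies in a finite dimensional space stable under
    translations: coordinates are in the standard representation, the inverse of
    the determinant in a character, and sums and products correspond to direct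
    sums and tensor products. *)
Lemma regular_stable f : regular_fun f -> exists N mu T (xi : 'rV[C]_N),
  @stable N mu T /\ {in unitmx, forall s, f s = (xi *m mu s) 0 0}.
Proof.
elim=> [c|i j||{}f g _ [N1 [mu1 [T1 [x1 [S1 E1]]]]] _ [N2 [mu2 [T2 [x2 [S2 E2]]]]]
  |{}f g _ [N1 [mu1 [T1 [x1 [S1 E1]]]]] _ [N2 [mu2 [T2 [x2 [S2 E2]]]]]].
- exists 1, (fun=> c%:M), (fun=> 1%:M), 1%:M; split; first exact: stable_cst.
  by move=> s us; rewrite mul1mx mxE eqxx mulr1n.
- exists n, (col j), id, (delta_mx 0 i); split; first exact: stable_coord.
  by move=> s us; rewrite -rowE !mxE.
- exists 1, (fun s => ((\det s)^-1)%:M), (fun s => ((\det s)^-1)%:M), 1%:M.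
  split; first exact: stable_invdet.
  by move=> s us; rewrite mul1mx mxE eqxx mulr1n.
- eexists _, _, _, (row_mx x1 x2); split; first exact: (stable_sum S1 S2).
  by move=> s us; rewrite mul_row_col mxE -E1 // -E2.
- eexists _, _, _, (mxvec (x1^T *m x2)); split; first exact: (stable_prod S1 S2).
  by move=> s us; rewrite mxvec_tensor -E1 // -E2.
Qed.
End Stable.

(** * Gronwall's inequality for complex linear systems *)
Section Gronwall.
Variable R : realType.

Lemma dnbhsR_filter : ProperFilter (0 : R)^'. Proof. exact: Proper_dnbhs_numFieldType. Qed.
Lemma cvg_id_dnbhsR : id @ (0 : R)^' --> (0 : R).
Proof. apply: cvg_within_filter; exact: cvg_id. Qed.
Lemma near_dnbhsR_neq0 : \forall x \near (0 : R)^', x != 0.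
Proof. by rewrite near_withinE; near=> x => x0.
Unshelve. all: by end_near. Qed.

(** The functions N exp(M x) and N exp(- M x) are respectively nondecreasing and
    nonincreasing. *)
Lemma gronwall (N N' : R -> R) (a b M s t : R) :
  (forall x, a < x < b -> is_derive x 1 N (N' x)) ->
  (forall x, a < x < b -> `|N' x| <= M * N x) ->
  a < s < b -> a < t < b -> N s <= N t * expR (M * `|s - t|).
Proof.
move=> dN bN sI tI.
(* Mean value theorem for N x * exp (c x). *)
have key (c u v : R) : a < u < b -> a < v < b -> u <= v ->
    exists2 z, a < z < b & N v * expR (c * v) - N u * expR (c * u) =
       (N' z + c * N z) * expR (c * z) * (v - u).
  move=> uI vI uv.
  have dg (x : R) : a < x < b -> is_derive x 1 (fun x => N x * expR (c * x))
      ((N' x + c * N x) * expR (c * x)).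
    move=> xI.
    have q1 : qder (0 : R)^' id (fun h => N (x + h)) (N x) (N' x).
      exact: (proj2 (is_deriveP _ _ _) (dN x xI)).
    have q2 : qder (0 : R)^' id (fun h => x + h) x 1.
      rewrite /qder; have H : (fun=> 1 : R) @ (0 : R)^' --> (1 : R) by exact: cvg_cst.
      apply: (cvg_trans _ H); apply: near_eq_cvg; near=> h.
      have h0 : h != 0 by near: h; exact: near_dnbhsR_neq0.
      by rewrite /= addrAC subrr add0r mulVf.
    have q3 : qder (0 : R)^' id (fun h => expR (c * x + h)) (expR (c * x)) (expR (c * x)).
      exact: (proj2 (is_deriveP _ _ _) (is_derive_expR (c * x))).
    have q4 := qder_comp dnbhsR_filter cvg_id_dnbhsR near_dnbhsR_neq0 q3 (qderZ dnbhsR_filter cvg_id_dnbhsR near_dnbhsR_neq0 (c := c) q2).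
    apply/is_deriveP.
    have := qderM dnbhsR_filter cvg_id_dnbhsR near_dnbhsR_neq0 q1 q4.
    suff -> : N' x * expR (c * x) + N x * (c * 1 * expR (c * x)) =
      (N' x + c * N x) * expR (c * x) by [].
    by ring.
  have sub x : u <= x <= v -> a < x < b.
    move: uI vI => /andP[au _] /andP[_ vb] /andP[ux xv].
    by rewrite (lt_le_trans au ux) (le_lt_trans xv vb).
  have [||z] := @MVT_segment _ (fun x => N x * expR (c * x)) (fun x => (N' x + c * N x) * expR (c * x)) u v uv.
  - move=> x; rewrite in_itv /= => /andP[ux xv]; apply/dg/sub.
    by rewrite !ltW.
  - apply: derivable_within_continuous => x; rewrite in_itv /= => xI.
    by have [] := dg x (sub x xI).
  by rewrite in_itv /= => zI E; exists z => //; exact: sub.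
have [st|/ltW ts] := leP s t.
  have [z zI E] := key M s t sI tI st.
  have /ler_normlP[H _] := bN z zI.
  have : 0 <= N t * expR (M * t) - N s * expR (M * s).
    rewrite E; apply: mulr_ge0; last by rewrite subr_ge0.
    by apply: mulr_ge0; [lra|exact: expR_ge0].
  rewrite subr_ge0 -ler_pdivlMr ?expR_gt0 // -mulrA -expRN -expRD.
  have -> : M * t + - (M * s) = M * `|s - t|; last by [].
  by rewrite ler0_norm ?subr_le0 //; ring.
have [z zI E] := key (- M) t s tI sI ts.
have /ler_normlP[_ H] := bN z zI.
have : 0 <= N t * expR (- M * t) - N s * expR (- M * s).
  rewrite -oppr_le0 opprB E -mulrA; apply: mulr_le0_ge0; first by lra.
  by apply: mulr_ge0; [exact: expR_ge0|rewrite subr_ge0].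
rewrite subr_ge0 -ler_pdivlMr ?expR_gt0 // -mulrA -expRN -expRD.
have -> : - M * t + - (- M * s) = M * `|s - t|; last by [].
by rewrite ger0_norm ?subr_ge0 //; ring.
Unshelve. all: by end_near. Qed.

Local Notation C := (C R).

(** The squared norm, as a real number: unlike the norm it is differentiable at
    0. *)
Definition sqn (z : C) : R := complex.Re z ^+ 2 + complex.Im z ^+ 2.

Lemma sqn_ge0 z : 0 <= sqn z. Proof. by rewrite addr_ge0 ?sqr_ge0. Qed.
Lemma sqn_eq0 z : sqn z = 0 -> z = 0.
Proof.
move=> /eqP; rewrite paddr_eq0 ?sqr_ge0 // !sqrf_eq0 => /andP[/eqP a /eqP b].
by rewrite (complex_split z) a b rc0 mulr0 addr0.
Qed.
Lemma sqn0 : sqn 0 = 0. Proof. by rewrite /sqn /= expr0n addr0. Qed.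
Lemma sqnM z u : sqn (z * u) = sqn z * sqn u.
Proof. by rewrite /sqn Re_mul Im_mul; ring. Qed.
Lemma sqn_norm z : rc (sqn z) = `|z| ^+ 2. Proof. exact: add_Re2_Im2. Qed.

Lemma sqn_cts (c : R -> C) t : {for t, continuous c} -> {for t, continuous (fun x => sqn (c x))}.
Proof.
move=> cc; apply: cvgD; rewrite /=; apply: cvgM; first [exact: Re_cvg cc|exact: Im_cvg cc].
Qed.

(** The derivative of [sqn] at [z] in the direction [d]. *)
Definition dsqn (z d : C) : R := 2 * (complex.Re z * complex.Re d + complex.Im z * complex.Im d).

(** The inequality 2 |Re (z conj v)| <= |z|^2 + |v|^2. *)
Lemma dsqn_le z u m beta : sqn m <= beta -> `|dsqn z (m * u)| <= sqn z + beta * sqn u.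
Proof.
move=> mb.
have H : sqn z + sqn (m * u) <= sqn z + beta * sqn u.
  by rewrite lerD2l sqnM ler_wpM2r // sqn_ge0.
apply: le_trans H; rewrite /dsqn /sqn; move: (m * u) => v.
case: z v => p q [r t] /=.
have h1 := sqr_ge0 (p + r); have h2 := sqr_ge0 (p - r).
have h3 := sqr_ge0 (q + t); have h4 := sqr_ge0 (q - t).
by rewrite ler_norml; apply/andP; split; nra.
Qed.

Lemma dsqn_sum (I : finType) z (d : I -> C) : dsqn z (\sum_i d i) = \sum_i dsqn z (d i).
Proof.
rewrite /dsqn (big_morph _ (@Re_add R) (erefl _)) (big_morph _ (@Im_add R) (erefl _)).
by rewrite !mulr_sumr -big_split mulr_sumr.
Qed.

Lemma sqn_derive (c : R -> C) (t : R) d : rder c t d -> is_derive t (1 : R) (fun x => sqn (c x)) (dsqn (c t) d).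
Proof.
move=> cd; apply/is_deriveP.
have r := proj2 (is_deriveP _ _ _) (rder_Re cd).
have i := proj2 (is_deriveP _ _ _) (rder_Im cd).
have := qderD dnbhsR_filter (qderM dnbhsR_filter cvg_id_dnbhsR near_dnbhsR_neq0 r r) (qderM dnbhsR_filter cvg_id_dnbhsR near_dnbhsR_neq0 i i).
suff -> : dsqn (c t) d = complex.Re d * complex.Re (c t) + complex.Re (c t) * complex.Re d +
   (complex.Im d * complex.Im (c t) + complex.Im (c t) * complex.Im d) by [].
by rewrite /dsqn; ring.
Qed.

Lemma system_gronwall (I : finType) (z : I -> R -> C) (m : I -> I -> R -> C) (a b : R) beta s t :
  (forall i x, a < x < b -> rder (z i) x (\sum_j m i j x * z j x)) ->
  (forall i j x, a < x < b -> sqn (m i j x) <= beta) ->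
  a < s < b -> a < t < b -> \sum_i sqn (z i s) <= (\sum_i sqn (z i t)) * expR ((1 + beta) *+ #|I| * `|s - t|).
Proof.
move=> dz mb; pose N x := \sum_i sqn (z i x); rewrite -/(N s) -/(N t).
apply: (@gronwall _ (fun x => \sum_i dsqn (z i x) (\sum_j m i j x * z j x))).
  move=> x xI; apply/is_deriveP.
  apply: (@qder_sum _ _ _ dnbhsR_filter id I _ _ (fun i h => sqn (z i (x + h))) (fun i => sqn (z i x))
    (fun i => dsqn (z i x) (\sum_j m i j x * z j x))) => i _.
  by have /is_deriveP H := sqn_derive (@dz i x xI).
move=> x xI; apply: le_trans (ler_norm_sum _ _ _) _.
apply: (@le_trans _ _ (\sum_i \sum_j (sqn (z i x) + beta * sqn (z j x)))).
  apply: ler_sum => i _; rewrite dsqn_sum; apply: le_trans (ler_norm_sum _ _ _) _.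
  by apply: ler_sum => j _; apply: dsqn_le; exact: mb.
under eq_bigr do rewrite big_split -mulr_sumr sumr_const /=.
rewrite big_split sumr_const sumrMnl /= -/(N x) -mulrnDl.
by rewrite mulrnAl mulrDl mul1r.
Qed.

(** Gronwall's inequality on a compact interval around the two points, where the
    continuous coefficients are bounded. *)
Lemma system_unique (I : finType) (z : I -> R -> C) (m : I -> I -> R -> C) (a b : R) s t :
  (forall i x, a < x < b -> rder (z i) x (\sum_j m i j x * z j x)) ->
  (forall i j x, a < x < b -> {for x, continuous (m i j)}) ->
  a < s < b -> a < t < b -> (forall i, z i t = 0) -> forall i, z i s = 0.
Proof.
move=> dz mc sI tI zt.
pose u := Num.min s t; pose v := Num.max s t.
have [uI vI] : a < u < b /\ a < v < b.
  by rewrite /u /v; case: (leP s t).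
have [us vs] : u <= s <= v /\ u <= t <= v.
  by rewrite /u /v; case: (leP s t) => H; split; rewrite ?lexx ?H ?(ltW H).
pose a' := (a + u) / 2; pose b' := (v + b) / 2.
have aa' : a < a' by rewrite /a'; move: uI => /andP[? _]; lra.
have a'u : a' < u by rewrite /a'; move: uI => /andP[? _]; lra.
have vb' : v < b' by rewrite /b'; move: vI => /andP[_ ?]; lra.
have b'b : b' < b by rewrite /b'; move: vI => /andP[_ ?]; lra.
have uv : u <= v by move: us => /andP[]; exact: le_trans.
have a'b' : a' <= b' by rewrite ltW // (lt_trans a'u) // (le_lt_trans uv).
have [beta betaP] : exists beta, forall i j x, a' < x < b' -> sqn (m i j x) <= beta.
  have /choice[g gP] (ij : I * I) : exists g, forall x, x \in `[a', b'] -> sqn (m ij.1 ij.2 x) <= g.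
    have [|c _ cP] := @EVT_max _ (fun x => sqn (m ij.1 ij.2 x)) a' b' a'b'.
      apply: continuous_in_subspaceT => x; rewrite inE /= in_itv /= => /andP[ax xb].
      by apply/sqn_cts/mc; rewrite (lt_le_trans aa' ax) (le_lt_trans xb b'b).
    by exists (sqn (m ij.1 ij.2 c)).
  have g0 ij : 0 <= g ij.
    by apply: le_trans (gP ij a' _); rewrite ?sqn_ge0 // in_itv /= lexx.
  exists (\sum_ij g ij) => i j x /andP[ax xb].
  have xI : x \in `[a', b'] by rewrite in_itv /= !ltW.
  apply: le_trans (gP (i, j) x xI) _.
  by rewrite (bigD1 (i, j)) //= lerDl sumr_ge0.
have sI' : a' < s < b'.
  by move: us => /andP[x1 x2]; rewrite (lt_le_trans a'u x1) (le_lt_trans x2 vb').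
have tI' : a' < t < b'.
  by move: vs => /andP[x1 x2]; rewrite (lt_le_trans a'u x1) (le_lt_trans x2 vb').
have dz' i x : a' < x < b' -> rder (z i) x (\sum_j m i j x * z j x).
  move=> /andP[ax xb]; apply: dz; by rewrite (lt_trans aa' ax) (lt_trans xb b'b).
have := system_gronwall dz' betaP sI' tI'.
rewrite [X in _ <= X * _]big1 ?mul0r => [H|i _]; last by rewrite zt sqn0.
have N0 : \sum_i sqn (z i s) = 0.
  by apply/eqP; rewrite eq_le H sumr_ge0 // => i _; exact: sqn_ge0.
move=> i; apply: sqn_eq0; move/eqP: N0.
rewrite psumr_eq0 => [/allP/(_ i)|j _]; last exact: sqn_ge0.
by rewrite mem_index_enum => /(_ isT)/eqP.
Qed.
End Gronwall.

(** * Relations over a field of germs satisfied by a fundamental matrix *)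
Local Opaque C.

Section RightGerms.
Variables (R : realType).
Local Notation C := (C R).
Local Notation F := (at_right (0 : R)).

Lemma near_at_rightP (P : R -> Prop) :
  (\forall t \near F, P t) <-> exists2 e, 0 < e & forall t, 0 < t < e -> P t.
Proof.
split.
  rewrite near_withinE => /nbhs_ballP[e /= e0 He]; exists e => // t /andP[t0 te].
  by apply: He => //; rewrite /ball /= sub0r normrN gtr0_norm.
move=> [e e0 H]; near=> t; apply: H; apply/andP; split.
- near: t; exact: nbhs_right_gt.
- near: t; exact: nbhs_right_lt.
Unshelve. all: by end_near. Qed.

Lemma FF : ProperFilter F. Proof. exact: at_right_proper_filter. Qed.
Local Hint Resolve FF : core.

Definition mrder p q (S : R -> 'M[C]_(p, q)) (t : R) (D : 'M[C]_(p, q)) :=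
  mxqder (0 : R)^' (@rc R) (fun h => S (t + h)) (S t) D.

Lemma mrderM p q r (S : R -> 'M[C]_(p, q)) (V : R -> 'M[C]_(q, r)) t D E :
  mrder S t D -> mrder V t E -> mrder (fun x => S x *m V x) t (D *m V t + S t *m E).
Proof.
by move=> SD VE; exact: (mxqderM (dnbhsR_filter R) (@cvg_rc_dnbhs R) (@near_rc_neq0 R) SD VE).
Qed.

Lemma mrder_cst p q (M : 'M[C]_(p, q)) t : mrder (fun=> M) t 0.
Proof. exact: (mxqder_cst (dnbhsR_filter R) (@rc R) M). Qed.

Lemma mrder_unique p q (S : R -> 'M[C]_(p, q)) t D E :  mrder S t D -> mrder S t E -> D = E.
Proof. exact: (mxqder_unique (dnbhsR_filter R) (k := @rc R) (u := fun h => S (t + h))). Qed.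

Lemma mrder_near0 p q (S : R -> 'M[C]_(p, q)) e t D : (forall x, 0 < x < e -> S x = 0) ->
  0 < t < e -> mrder S t D -> D = 0.
Proof.
move=> S0 tI SD; apply: (mrder_unique SD).
have H0 := mrder_cst (0 : 'M[C]_(p, q)) t.
rewrite /mrder (S0 t tI); apply: (mxqder_eq (dnbhsR_filter R) _ H0).
move: tI => /andP[t0 te].
have H : \forall h \near (0 : R), 0 < t + h < e.
  have c : (fun h : R => t + h) @ (0 : R) --> t.
    have H1 : (fun h : R => t + h) @ (0 : R) --> t + 0 by apply: cvgD; [exact: cvg_cst|exact: cvg_id].
    by rewrite addr0 in H1.
  have L1 : \forall h \near (0 : R), 0 < t + h by move: c => /cvgr_gt; apply.
  have L2 : \forall h \near (0 : R), t + h < e by move: c => /cvgr_lt; apply.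
  by apply: filterS2 L1 L2 => h -> ->.
rewrite near_withinE; near=> h => _; rewrite S0; [by []|by near: h].
Unshelve. all: by end_near. Qed.

(** A vector killed at one point gives a solution of the same linear system that
    vanishes at that point, hence everywhere. *)
Lemma mrder_kernel p q (S c : R -> 'M[C]_(p, _)) e s t (w : 'M[C]_(p, q)) :
  (forall x, 0 < x < e -> mrder S x (c x *m S x)) ->
  (forall i j x, 0 < x < e -> {for x, continuous (fun y => c y i j)}) ->
  0 < s < e -> 0 < t < e -> S t *m w = 0 -> S s *m w = 0.
Proof.
move=> dS cc sI tI Stw; apply/matrixP => i j.
have H := @system_unique R 'I_p (fun i x => (S x *m w) i j) (fun i l x => c x i l) 0 e s t.
rewrite [RHS]mxE; apply: H => //.
- move=> a x xI.
  have D : mrder (fun y => S y *m w) x (c x *m (S x *m w)).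
    by have := mrderM (dS x xI) (mrder_cst w x); rewrite mulmx_add0 -(mulmxA (c x)).
  have E : (c x *m (S x *m w)) a j = \sum_l c x a l * (S x *m w) l j by rewrite mxE.
  by rewrite -E; exact: (D a j).
- by move=> a; rewrite Stw [LHS]mxE.
Qed.

Section Descent.
Variables (n : nat) (Kr : (R -> C) -> Prop) (KF : germ_field F Kr) (w : R -> C).
Hypothesis w0 : \forall t \near F, w t != 0.
Hypothesis wc : \forall t \near F, {for t, continuous w}.
Hypothesis Kder : forall f, Kr f -> exists2 f', Kr f' & \forall t \near F, rder f t (w t * f' t).
Variables (A Phi : R -> 'M[C]_n).
Hypothesis kA : germ_mx Kr A.
Hypothesis Phiu : \forall t \near F, Phi t \in unitmx.
Hypothesis dPhi : \forall t \near F, mrder Phi t (w t *: A t *m Phi t).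

Lemma germ_mx_der p q (M : R -> 'M[C]_(p, q)) : germ_mx Kr M ->
  exists2 M', germ_mx Kr M' & \forall t \near F, mrder M t (w t *: M' t).
Proof.
move=> kM.
have /choice[g gP] (ij : 'I_p * 'I_q) : exists g, Kr g /\
    \forall t \near F, rder (fun x => M x ij.1 ij.2) t (w t * g t).
  by have [g kg H] := Kder (kM ij.1 ij.2); exists g.
exists (fun t => \matrix_(i, j) g (i, j) t).
  move=> i j; have [kg _] := gP (i, j); apply: (gf_eq FF KF) kg => t; by rewrite mxE.
have : \forall t \near F, forall i j, rder (fun x => M x i j) t (w t * g (i, j) t).
  apply: filter_forall => i; apply: filter_forall => j; exact: (proj2 (gP (i, j))).
apply: filterS => t H i j; rewrite [X in qder _ _ _ _ X]mxE [X in _ * X]mxE; exact: (H i j).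
Qed.

Lemma germ_cts f : Kr f -> \forall t \near F, {for t, continuous f}.
Proof.
move=> /Kder[f' _]; apply: filterS => t; exact: rder_cts.
Qed.

Section Rep.
Variables (N : nat) (mu : 'M[C]_n -> 'cV[C]_N) (T : 'M[C]_n -> 'M[C]_N).
Hypothesis st : stable mu T.

Lemma rep_der m (Psi : 'M[C]_n -> 'M[C]_m) : algebraic_rep Psi ->
  \forall t \near F, mrder (fun x => Psi (Phi x)) t (w t *: rep_diff Psi (A t) *m Psi (Phi t)).
Proof.
move=> PR; apply: filterS2 Phiu dPhi => t ut dt.
have := rep_qder_at PR (dnbhsR_filter R) (@cvg_rc_dnbhs R) (@near_rc_neq0 R) ut dt.
by rewrite (rep_diffZ PR).
Qed.

Lemma germ_mx_rep_diff m (Psi : 'M[C]_n -> 'M[C]_m) : algebraic_rep Psi ->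
  germ_mx Kr (fun t => rep_diff Psi (A t)).
Proof.
move=> PR i j; have [G GP] := rep_diff_linear PR.
apply: (gf_eq FF KF) (_ : Kr (fun t => ip (G i j) (A t))); first by move=> t; rewrite GP.
rewrite /ip; apply: (gf_sum KF) => a _.
apply: (gf_sum KF) => b _.
exact: (gf_mul KF (gf_cst KF (G i j a b)) (kA a b)).
Qed.

Lemma mu_Phi : \forall t \near F, mu (Phi t) = T (Phi t) *m mu 1%:M.
Proof.
apply: filterS Phiu => t ut; by rewrite -(st_mul st ut (unitmx1 C n)) mulmx1.
Qed.

Definition Phi_relations (c : R -> 'rV[C]_N) := germ_mx Kr c /\ \forall t \near F, c t *m mu (Phi t) = 0.

Lemma Phi_relations_subspace : germ_subspace F Kr Phi_relations.
Proof.
split.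
- move=> c d cd [kc c0]; split; first by move=> i j; apply: (gf_ext KF) (kc i j); apply: filterS cd => t ->.
  by apply: filterS2 cd c0 => t ->.
- by split; [exact: (germ_mx_cst KF)|apply: nearW => t; rewrite mul0mx].
- move=> c d [kc c0] [kd d0]; split; first exact: (germ_mx_add KF).
  by apply: filterS2 c0 d0 => t c0 d0; rewrite mulmxDl c0 d0 addr0.
- move=> a c ka [kc c0]; split; first exact: (germ_mx_scale KF).
  by apply: filterS c0 => t c0; rewrite -scalemxAl c0 scaler0.
- by move=> c [].
Qed.

(** Differentiating the relation c T(Phi) mu(1) = 0 gives another one: the
    derivative of T(Phi) is w T'(A) T(Phi). *)
Lemma Phi_relations_der c c' : Phi_relations c -> germ_mx Kr c' ->
  (\forall t \near F, mrder c t (w t *: c' t)) ->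
  Phi_relations (fun t => c' t + c t *m rep_diff T (A t)).
Proof.
move=> [kc c0] kc' cder; split.
  apply: (germ_mx_add KF) => //; apply: (germ_mx_mul KF) => //; exact: (germ_mx_rep_diff (st_rep st)).
have [e e0 He] := proj1 (near_at_rightP _) (filterI c0 (filterI cder (filterI (rep_der (st_rep st)) (filterI mu_Phi w0)))).
apply/near_at_rightP; exists e => // t tI.
have [c0t [cdt [dTt [mut wt]]]] := He t tI.
have D := mrderM (mrderM cdt dTt) (mrder_cst (mu 1%:M) t).
have Z x : 0 < x < e -> c x *m T (Phi x) *m mu 1%:M = 0.
  move=> xI; have [c0x [_ [_ [mux _]]]] := He x xI.
  by rewrite -mulmxA -mux.
have := mrder_near0 Z tI D.
rewrite mulmx_add0 -!scalemxAl -scalemxAr -scalerDr -scalemxAl => /eqP.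
rewrite scaler_eq0 (negbTE wt) /= => /eqP <-.
by rewrite mut mulmxA (mulmxDl (c' t)) -mulmxA.
Qed.

(** Let E be the idempotent whose rows span the relations.  By [Phi_relations_der] the
    derivative of E T(Phi) is w D E T(Phi) for a matrix D over the field, so the
    kernel of E T(Phi), equivalently its row space, does not depend on t. *)
Lemma Phi_relations_projector : exists E : R -> 'M[C]_N,
  [/\ germ_mx Kr E, forall i, Phi_relations (fun t => row i (E t)),
    forall c, Phi_relations c -> \forall t \near F, c t *m E t = c t &
    exists2 e, 0 < e & forall s t, 0 < s < e -> 0 < t < e ->
      (E s *m T (Phi s) <= E t *m T (Phi t))%MS].
Proof.
have [E [kE EI cE]] := projector FF KF Phi_relations_subspace.
exists E; split => //.
have [E' kE' dE] := germ_mx_der kE.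
(* The rows of D are relations, hence D E = D. *)
pose tau t := rep_diff T (A t); pose D t := E' t + E t *m tau t.
have ktau : germ_mx Kr tau := germ_mx_rep_diff (st_rep st).
have kD : germ_mx Kr D by apply: (germ_mx_add KF) => //; apply: (germ_mx_mul KF).
have DE : \forall t \near F, D t *m E t = D t.
  have : \forall t \near F, forall i, row i (D t) *m E t = row i (D t).
    apply: filter_forall => i; apply: cE.
    apply: (ss_ext Phi_relations_subspace) (Phi_relations_der (EI i) (germ_mx_row i kE') _).
      apply: nearW => t; rewrite /D -row_mul.
      by apply/rowP => j; rewrite !mxE.
    apply: filterS dE => t dE a b.
    have := dE i b.
    rewrite !mxE => H; apply: (qder_eq (dnbhsR_filter R)) H.
    by apply: nearW => h; rewrite mxE.
  apply: filterS => t H; apply/row_matrixP => i; by rewrite row_mul H.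
have cD : \forall t \near F, forall i j, {for t, continuous (fun x => D x i j)}.
  by apply: filter_forall => i; apply: filter_forall => j; exact: germ_cts.
have [e e0 He] := proj1 (near_at_rightP _) (filterI dE (filterI (rep_der (st_rep st)) (filterI DE (filterI cD wc)))).
exists e => // s t sI tI; rewrite submxE; apply/eqP.
apply: (@mrder_kernel _ _ (fun x => E x *m T (Phi x)) (fun x => w x *: D x) e s t) => //.
- move=> x xI; have [dEx [dTx [DEx _]]] := He x xI.
  have := mrderM dEx dTx.
  suff -> : w x *: E' x *m T (Phi x) + E x *m (w x *: rep_diff T (A x) *m T (Phi x)) =
    w x *: D x *m (E x *m T (Phi x)) by [].
  rewrite -!scalemxAl -scalemxAr -scalerDr (mulmxA (D x)) DEx /D mulmxDl.
  by rewrite -mulmxA.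
- move=> i j x xI; have [_ [_ [_ [cDx wx]]]] := He x xI.
  have -> : (fun y => (w y *: D y) i j) = (fun y => w y * D y i j).
    by apply/funext => y; rewrite mxE.
  exact: (cvgM wx (cDx i j)).
- by rewrite mulmx_coker.
Qed.

End Rep.
End Descent.
End RightGerms.

Local Transparent C.

(** * Descent of constant matrices commuting with the stabilizer of the relations *)
Lemma horner_rV (K : comNzRingType) d (b : 'rV[K]_d) (g : K) :
  (rVpoly b).[g] = \sum_j b 0 j * g ^+ j.
Proof.
rewrite (horner_coef_wide _ (size_poly _ _)).
by apply: eq_bigr => j _; rewrite coef_rVpoly_ord.
Qed.

Lemma row_mul_entry (K : pzSemiRingType) m n (A : 'M[K]_(m, n)) (v : 'cV[K]_n) l :
  (row l A *m v) 0 0 = (A *m v) l 0.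
Proof. by rewrite -row_mul mxE. Qed.

Lemma sub_mxE (K : zmodType) m n (A B : 'M[K]_(m, n)) i j : (A - B) i j = A i j - B i j.
Proof. by rewrite !mxE. Qed.

Lemma invmx_Vmul (K : comUnitRingType) n (A B : 'M[K]_n) : A \in unitmx -> B \in unitmx ->
  invmx (invmx A *m B) = invmx B *m A.
Proof.
move=> uA uB; have uX : invmx A *m B \in unitmx by rewrite unitmx_mul unitmx_inv uA uB.
have E : invmx A *m B *m (invmx B *m A) = 1%:M by rewrite mulmxA mulmxK // mulVmx.
by rewrite -[LHS]mulmx1 -E mulKmx.
Qed.

Local Opaque C.

Section Stabilizer.
Variables (R : realType).
Local Notation C := (C R).
Local Notation F := (at_right (0 : R)).
Local Hint Resolve FF : core.
Variables (n : nat) (Kr : (R -> C) -> Prop) (KF : germ_field F Kr) (w : R -> C).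
Hypothesis w0 : \forall t \near F, w t != 0.
Hypothesis wc : \forall t \near F, {for t, continuous w}.
Hypothesis Kder : forall f, Kr f -> exists2 f', Kr f' & \forall t \near F, rder f t (w t * f' t).
Variables (A Phi : R -> 'M[C]_n).
Hypothesis kA : germ_mx Kr A.
Hypothesis Phiu : \forall t \near F, Phi t \in unitmx.
Hypothesis dPhi : \forall t \near F, mrder Phi t (w t *: A t *m Phi t).

Implicit Types (P Q q u : R -> 'M[C]_n -> C).

(** Regular functions on GL_n with coefficients in the field of germs, written in
    one stable space so that they become row vectors over the field. *)
Definition Kreg P := exists N mu T (c : R -> 'rV[C]_N),
  [/\ @stable R n N mu T, germ_mx Kr c & forall t, {in unitmx, forall Y, P t Y = (c t *m mu Y) 0 0}].

Lemma Kreg_reg f : unit_regular f -> Kreg (fun _ => f).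
Proof.
move=> [g rg fg]; have [N [mu [T [xi [S E]]]]] := regular_stable rg.
exists N, mu, T, (fun=> xi); split => //; first exact: (germ_mx_cst KF).
by move=> t Y uY; rewrite fg ?E.
Qed.

Lemma Kreg_coef a : Kr a -> Kreg (fun t _ => a t).
Proof.
move=> ka; exists 1, (fun=> 1%:M), (fun=> 1%:M), (fun t => (a t)%:M); split.
- exact: stable_cst.
- move=> i j; rewrite (ord1 i) (ord1 j); apply: (gf_eq (FF R) KF) ka => t.
  by rewrite mxE eqxx mulr1n.
- by move=> t Y uY; rewrite mulmx1 mxE eqxx mulr1n.
Qed.

Lemma Kreg_ext P Q : (forall t, {in unitmx, P t =1 Q t}) -> Kreg P -> Kreg Q.
Proof.
move=> PQ [N [mu [T [c [S kc E]]]]]; exists N, mu, T, c; split => // t Y uY.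
by rewrite -PQ ?E.
Qed.

Lemma Kreg_add P Q : Kreg P -> Kreg Q -> Kreg (fun t Y => P t Y + Q t Y).
Proof.
move=> [N1 [mu1 [T1 [c1 [S1 k1 E1]]]]] [N2 [mu2 [T2 [c2 [S2 k2 E2]]]]].
eexists _, _, _, (fun t => row_mx (c1 t) (c2 t)); split; first exact: (stable_sum S1 S2).
- move=> i j; rewrite -(fintype.splitK j); case: (fintype.split j) => j' /=.
    apply: (gf_eq (FF R) KF) (k1 i j') => t; by rewrite row_mxEl.
  apply: (gf_eq (FF R) KF) (k2 i j') => t; by rewrite row_mxEr.
- by move=> t Y uY; rewrite mul_row_col [RHS]mxE -E1 // -E2.
Qed.

Lemma Kreg_mul P Q : Kreg P -> Kreg Q -> Kreg (fun t Y => P t Y * Q t Y).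
Proof.
move=> [N1 [mu1 [T1 [c1 [S1 k1 E1]]]]] [N2 [mu2 [T2 [c2 [S2 k2 E2]]]]].
eexists _, _, _, (fun t => mxvec ((c1 t)^T *m (c2 t))); split; first exact: (stable_prod S1 S2).
- move=> i j; rewrite (ord1 i); case/mxvec_indexP: j => j l.
  apply: (gf_eq (FF R) KF) (gf_mul KF (k1 0 j) (k2 0 l)) => t.
  by rewrite mxvecE mxE big_ord1 mxE.
- by move=> t Y uY; rewrite mxvec_tensor -E1 // -E2.
Qed.

Lemma Kreg_sum (I : Type) (r : seq I) (P : I -> R -> 'M[C]_n -> C) : (forall i, Kreg (P i)) ->
  Kreg (fun t Y => \sum_(i <- r) P i t Y).
Proof.
move=> H; elim: r => [|a r IH].
  apply: Kreg_ext (Kreg_coef (gf_cst KF 0)) => t Y _; by rewrite big_nil.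
by apply: Kreg_ext (Kreg_add (H a) IH) => t Y _; rewrite big_cons.
Qed.

(** Finitely many such functions have a common stable space, the direct sum. *)
Lemma Kreg_family m (P : nat -> R -> 'M[C]_n -> C) : (forall i, Kreg (P i)) ->
  exists N mu T, @stable R n N mu T /\ forall i, (i < m)%N -> exists c : R -> 'rV[C]_N,
    germ_mx Kr c /\ forall t, {in unitmx, forall Y, P i t Y = (c t *m mu Y) 0 0}.
Proof.
move=> H; elim: m => [|m [N1 [mu1 [T1 [S1 E1]]]]].
  by exists 1, (fun=> 1%:M), (fun=> 1%:M); split => //; exact: stable_cst.
have [N2 [mu2 [T2 [c2 [S2 k2 E2]]]]] := H m.
eexists _, _, _; split; first exact: (stable_sum S1 S2).
move=> i; rewrite ltnS leq_eqVlt => /predU1P[->|im].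
  exists (fun t => row_mx 0 (c2 t)); split.
    move=> a j; rewrite -(fintype.splitK j); case: (fintype.split j) => j' /=.
      by apply: (gf_eq (FF R) KF) (gf_cst KF 0) => t; rewrite row_mxEl mxE.
    by apply: (gf_eq (FF R) KF) (k2 a j') => t; rewrite row_mxEr.
  by move=> t Y uY; rewrite mul_row_col mul0mx add0r E2.
have [c1 [k1 E]] := E1 i im.
exists (fun t => row_mx (c1 t) 0); split.
  move=> a j; rewrite -(fintype.splitK j); case: (fintype.split j) => j' /=.
    by apply: (gf_eq (FF R) KF) (k1 a j') => t; rewrite row_mxEl.
  by apply: (gf_eq (FF R) KF) (gf_cst KF 0) => t; rewrite row_mxEr mxE.
by move=> t Y uY; rewrite mul_row_col mul0mx addr0 E.
Qed.

Definition fundamental_ideal P := Kreg P /\ \forall t \near F, P t (Phi t) = 0.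

Lemma fundamental_ideal_mul P Q : fundamental_ideal P -> Kreg Q -> fundamental_ideal (fun t Y => P t Y * Q t Y).
Proof.
move=> [kP P0] kQ; split; first exact: Kreg_mul.
by apply: filterS P0 => t ->; rewrite mul0r.
Qed.

(** The span of the ideal of the fundamental matrix over all functions of t, without
    regularity: the extension of scalars from the field to the complex numbers at
    each t. *)
Definition pspan q := exists m (P : 'I_m -> R -> 'M[C]_n -> C), (forall i, fundamental_ideal (P i)) /\
  \forall t \near F, exists l : 'I_m -> C, {in unitmx, forall Y, q t Y = \sum_i l i * P i t Y}.

Lemma pspan_ext q q' : (\forall t \near F, {in unitmx, q t =1 q' t}) -> pspan q -> pspan q'.
Proof.
move=> qq' [m [P [PI H]]]; exists m, P; split => //.
by apply: filterS2 qq' H => t qq' [l E]; exists l => Y uY; rewrite -qq' ?E.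
Qed.

Lemma pspan0 : pspan (fun _ _ => 0).
Proof.
exists 0%N, (fun _ _ _ => 0); split; first by case.
by apply: nearW => t; exists (fun=> 0) => Y _; rewrite big_ord0.
Qed.

Lemma pspanD q q' : pspan q -> pspan q' -> pspan (fun t Y => q t Y + q' t Y).
Proof.
move=> [m [P [PI H]]] [m' [P' [PI' H']]].
exists (m + m')%N, (fun i => match fintype.split i with inl j => P j | inr j => P' j end).
split; first by move=> i; case: (fintype.split i).
apply: filterS2 H H' => t [l E] [l' E'].
exists (fun i => match fintype.split i with inl j => l j | inr j => l' j end) => Y uY.
rewrite E // E' // big_split_ord; congr (_ + _); apply: eq_bigr => i _.
  by rewrite (unsplitK (inl i)).
by rewrite (unsplitK (inr i)).
Qed.

Lemma pspanZ (a : R -> C) q : pspan q -> pspan (fun t Y => q t Y * a t).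
Proof.
move=> [m [P [PI H]]]; exists m, P; split => //.
apply: filterS H => t [l E]; exists (fun i => a t * l i) => Y uY.
by rewrite E // mulrC mulr_sumr; apply: eq_bigr => i _; rewrite mulrA.
Qed.

Lemma pspanM q Q : pspan q -> Kreg Q -> pspan (fun t Y => q t Y * Q t Y).
Proof.
move=> [m [P [PI H]]] kQ; exists m, (fun i t Y => P i t Y * Q t Y); split.
  by move=> i; exact: fundamental_ideal_mul.
apply: filterS H => t [l E]; exists l => Y uY.
by rewrite E // mulr_suml; apply: eq_bigr => i _; rewrite mulrA.
Qed.

(** The regular functions and all functions of t alone are such, hence also the pulled
    back regular functions ([mult_pull]), whose coefficients are functions of t
    outside the field. *)
Definition multiplier u := forall q, pspan q -> pspan (fun t Y => q t Y * u t Y).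

Lemma mult_ext u v : (\forall t \near F, {in unitmx, u t =1 v t}) -> multiplier u -> multiplier v.
Proof.
move=> uv mu q /mu; apply: pspan_ext; apply: filterS uv => t uv Y uY; by rewrite uv.
Qed.

Lemma mult_mul u v : multiplier u -> multiplier v -> multiplier (fun t Y => u t Y * v t Y).
Proof.
move=> mu mv q /mu/mv; apply: pspan_ext; apply: nearW => t Y _; by rewrite mulrA.
Qed.

Lemma mult_add u v : multiplier u -> multiplier v -> multiplier (fun t Y => u t Y + v t Y).
Proof.
move=> mu mv q Jq; apply: pspan_ext (pspanD (mu _ Jq) (mv _ Jq)); apply: nearW => t Y _; by rewrite mulrDr.
Qed.

Lemma mult_sum (I : Type) (r : seq I) (u : I -> R -> 'M[C]_n -> C) :
  (forall i, multiplier (u i)) -> multiplier (fun t Y => \sum_(i <- r) u i t Y).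
Proof.
move=> H; elim: r => [|a r IH].
  move=> q Jq; apply: pspan_ext pspan0; apply: nearW => t Y _; by rewrite big_nil mulr0.
by apply: mult_ext (mult_add (H a) IH); apply: nearW => t Y _; rewrite big_cons.
Qed.

Lemma mult_coef (a : R -> C) : multiplier (fun t _ => a t).
Proof. by move=> q /(pspanZ a). Qed.

Lemma mult_reg f : unit_regular f -> multiplier (fun _ => f).
Proof. by move=> /Kreg_reg kf q Jq; exact: pspanM. Qed.

Lemma mult_exp u m : multiplier u -> multiplier (fun t Y => u t Y ^+ m).
Proof.
move=> mu; elim: m => [|m IH].
  move=> q; apply: pspan_ext; apply: nearW => t Y _; by rewrite expr0 mulr1.
by apply: mult_ext (mult_mul mu IH); apply: nearW => t Y _; rewrite exprS.
Qed.

(** In a stable space the values at Phi(t)^-1 Y are combinations of the values at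
    Y, with coefficients depending on t only. *)
Lemma mult_pull f : unit_regular f -> multiplier (fun t Y => f (invmx (Phi t) *m Y)).
Proof.
move=> [g rg fg]; have [N [mu [T [xi [S E]]]]] := regular_stable rg.
have H : multiplier (fun t Y => \sum_j (xi *m T (invmx (Phi t))) 0 j * mu Y j 0).
  apply: mult_sum => j; apply: mult_mul; first exact: (mult_coef (fun t => (xi *m T (invmx (Phi t))) 0 j)).
  exact/mult_reg/(st_reg S).
apply: mult_ext H; apply: filterS Phiu => t ut Y uY.
have uPY : invmx (Phi t) *m Y \in unitmx by rewrite unitmx_mul unitmx_inv ut uY.
have uI : invmx (Phi t) \in unitmx by rewrite unitmx_inv.
by rewrite fg // E // (st_mul S uI uY) mulmxA [RHS]mxE.
Qed.

Definition radical u := multiplier u /\ exists m, pspan (fun t Y => u t Y ^+ m).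

(** Binomial expansion: in degree a + b each term contains either a power of u or a
    power of v that is large enough. *)
Lemma radicalD u v : radical u -> radical v -> radical (fun t Y => u t Y + v t Y).
Proof.
move=> [mu [a ua]] [mv [b vb]]; split; first exact: mult_add.
exists (a + b)%N.
have H (i : 'I_(a + b).+1) : pspan (fun t Y => (u t Y ^+ (a + b - i) * v t Y ^+ i) *+ 'C(a + b, i)).
  have Z q : pspan q -> pspan (fun t Y => q t Y *+ 'C(a + b, i)).
    move=> /(pspanZ (fun=> ('C(a + b, i))%:R)); apply: pspan_ext; apply: nearW => t Y _.
    by rewrite mulr_natr.
  apply: Z; have [ib|bi] := leqP b i.
    have := mult_mul (mult_exp (a + b - i) mu) (mult_exp (i - b) mv) vb.
    apply: pspan_ext; apply: nearW => t Y _.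
    by rewrite mulrCA -exprD subnKC.
  have := mult_mul (mult_exp (a + b - i - a) mu) (mult_exp i mv) ua.
  apply: pspan_ext; apply: nearW => t Y _.
  have ai : (a <= a + b - i)%N by rewrite -addnBA ?leq_addr // ltnW.
  by rewrite mulrA -exprD subnKC.
have : pspan (fun t Y => \sum_(i < (a + b).+1) (u t Y ^+ (a + b - i) * v t Y ^+ i) *+ 'C(a + b, i)).
  elim: (index_enum _) => [|i r IH].
    apply: pspan_ext pspan0; apply: nearW => t Y _; by rewrite big_nil.
  by apply: pspan_ext (pspanD (H i) IH); apply: nearW => t Y _; rewrite big_cons.
by apply: pspan_ext; apply: nearW => t Y _; rewrite exprDn.
Qed.

Lemma radical_sum (I : Type) (r : seq I) (u : I -> R -> 'M[C]_n -> C) :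
  (forall i, radical (u i)) -> radical (fun t Y => \sum_(i <- r) u i t Y).
Proof.
move=> H; elim: r => [|a r IH].
  have E : (fun (t : R) (Y : 'M[C]_n) => \sum_(i <- [::]) u i t Y) = (fun _ _ => 0).
    by apply/funext => t; apply/funext => Y; rewrite big_nil.
  rewrite E; split; first exact: (mult_coef (fun=> 0)).
  by exists 1%N; apply: pspan_ext pspan0; apply: nearW => t Y _; rewrite expr1.
have E : (fun (t : R) (Y : 'M[C]_n) => \sum_(i <- a :: r) u i t Y) =
    (fun t Y => u a t Y + \sum_(i <- r) u i t Y).
  by apply/funext => t; apply/funext => Y; rewrite big_cons.
by rewrite E; exact: radicalD.
Qed.

Lemma radicalZ (a : R -> C) u : radical u -> radical (fun t Y => u t Y * a t).
Proof.
move=> [mu [m um]]; split; first by apply: mult_mul => //; exact: mult_coef.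
exists m; have := pspanZ (fun t => a t ^+ m) um; apply: pspan_ext; apply: nearW => t Y _.
by rewrite exprMn.
Qed.

(** Its zeros lie in the stabilizer of the ideal of the fundamental matrix. *)
Definition galois_ideal (q : 'M[C]_n -> C) := pspan (fun t Y => q (invmx (Phi t) *m Y)).

Lemma galois_ideal_ideal : ideal galois_ideal.
Proof.
split.
- move=> f g fg; apply: pspan_ext; apply: filterS Phiu => t ut Y uY.
  by rewrite fg // unitmx_mul unitmx_inv ut uY.
- exact: pspan0.
- by move=> f g; exact: pspanD.
- by move=> f g Jf rg; apply: (mult_pull (f := g)) => //; exists g.
Qed.

(** The stabilizer of the ideal of the fundamental matrix, defined by its action on
    Phi by right translation. *)
Definition ideal_galois (s : 'M[C]_n) := s \in unitmx /\
  forall P, fundamental_ideal P -> \forall t \near F, P t (Phi t *m s) = 0.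

(** Fix P in the ideal of the fundamental matrix and t1.  The function Y |-> P(t1,
    Phi(t1) Y) is in [galois_ideal], because by [Phi_relations_projector] the row space
    of E(t) T(Phi(t)) is the same at t1 and at any other t.  It therefore vanishes
    at s. *)
Lemma galois_ideal_zeros s : s \in unitmx -> (forall f, regular_fun f -> galois_ideal f -> f s = 0) -> ideal_galois s.
Proof.
move=> us H; split => // P [[N [mu [T [c [S kc PE]]]]] P0].
have [E [kE EI cE [e e0 rowE]]] := Phi_relations_projector KF w0 wc Kder kA Phiu dPhi S.
have cI : Phi_relations Kr Phi mu c.
  split => //; apply: filterS2 P0 Phiu => t Pt ut; apply/matrixP => i j.
  by rewrite (ord1 i) (ord1 j) -PE // Pt mxE.
have he : \forall t \near F, 0 < t < e by apply/near_at_rightP; exists e.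
have := he; apply: filterS3 (cE c cI) Phiu => t1 cE1 ut1 t1e.
(* v is the coordinate vector of Y |-> P t1 (Phi t1 *m Y) in the stable space. *)
pose v := c t1 *m T (Phi t1).
have Pv Y : Y \in unitmx -> P t1 (Phi t1 *m Y) = (v *m mu Y) 0 0.
  move=> uY; rewrite PE ?unitmx_mul ?ut1 //.
  by rewrite (st_mul S ut1 uY) mulmxA.
have [f rf fE] : unit_regular (fun Y => (v *m mu Y) 0 0).
  have /choice[g gP] j : exists g, regular_fun g /\ {in unitmx, forall s, mu s j 0 = g s}.
    by have [g rg gE] := st_reg S j; exists g.
  exists (fun Y => \sum_j v 0 j * g j Y).
    apply: reg_sum => j _; apply: Reg_mul; [exact: Reg_cst|exact: (proj1 (gP j))].
  move=> Y uY; rewrite mxE; apply: eq_bigr => j _; by rewrite (proj2 (gP j)).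
rewrite Pv // fE //; apply: H => //.
apply: (ideal_ext galois_ideal_ideal) fE _ .
exists N, (fun i t Y => (row i (E t) *m mu Y) 0 0); split.
  move=> i; split.
    exists N, mu, T, (fun t => row i (E t)); split => //; exact: germ_mx_row.
  have [_ Ei0] := EI i; apply: filterS Ei0 => t ->; by rewrite mxE.
apply: filterS2 he Phiu => t te ut.
(* The relations at t1 are read at t: the coefficients X depend on t. *)
have /submxP[X XE] := rowE t1 t t1e te.
have vE : v = c t1 *m X *m E t *m T (Phi t).
  by rewrite /v -{1}cE1 -mulmxA XE !mulmxA.
exists (fun i => (c t1 *m X) 0 i) => Y uY.
have uI : invmx (Phi t) \in unitmx by rewrite unitmx_inv.
rewrite vE (st_mul S uI uY) mulmxA -(mulmxA _ (T (Phi t))) (rep_unit (st_rep S) ut) mulmx1.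
rewrite -mulmxA [LHS]mxE; apply: eq_bigr => i _; congr (_ * _).
by rewrite -row_mul [RHS]mxE.
Qed.

(** The entries of Y M0 Y^-1 - M0 vanish at the zeros of [galois_ideal], so a power of
    each is in it; pulled back by Phi, a power of g(Y) - phi(t) is in [pspan],
    where g(Y) is an entry of Y M0 Y^-1 and phi its value at Phi.  It remains to
    eliminate: in a common stable space, the combinations of the powers of g that
    are relations are, up to order s, the solutions of a linear system over the
    field, and the given one is a combination of solutions over the field by
    [generalized_inverse].  Those are polynomials over the field vanishing at phi,
    and [power_span_rational] concludes. *)
Theorem descent (M0 : 'M[C]_n) : (forall s, ideal_galois s -> s *m M0 = M0 *m s) ->
  germ_mx Kr (fun t => Phi t *m M0 *m invmx (Phi t)).
Proof.
move=> comm i j.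
have greg a b : unit_regular (fun Y : 'M[C]_n => (Y *m M0 *m invmx Y) a b).
  have /choice[g gP] c : exists g, regular_fun g /\ {in unitmx, forall Y : 'M[C]_n, invmx Y c b = g Y}.
    by have [g rg gE] := @reg_inv R n c b; exists g.
  exists (fun Y : 'M[C]_n => \sum_c (\sum_d Y a d * M0 d c) * g c Y).
    apply: reg_sum => c _; apply: Reg_mul; last exact: (proj1 (gP c)).
    apply: reg_sum => d _; apply: Reg_mul; [exact: Reg_coord|exact: Reg_cst].
  by move=> Y uY; rewrite mxE; apply: eq_bigr => c _; rewrite (proj2 (gP c)) // mxE.
pose h a b (Y : 'M[C]_n) := (Y *m M0 *m invmx Y) a b - M0 a b.
have hreg a b : unit_regular (h a b).
  have [g rg gE] := greg a b; exists (fun Y => g Y - M0 a b).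
    by apply: reg_sub => //; exact: Reg_cst.
  by move=> Y uY; rewrite /h gE.
(* If no power of an entry of Y M0 Y^-1 - M0 were in the ideal, that entry would
   be nonzero at a matrix of the stabilizer. *)
have hJ a b : exists m, galois_ideal (fun Y => h a b Y ^+ m).
  apply: contrapT => /forallNP Hn; have [g rg hg] := hreg a b.
  have [|s [us gs zs]] := nullstellensatz galois_ideal_ideal rg.
    move=> m Jm; apply: (Hn m); apply: (ideal_ext galois_ideal_ideal) Jm => Y uY.
    by rewrite hg.
  have := comm s (galois_ideal_zeros us zs) => E.
  by move/eqP: gs; apply; rewrite -hg // /h E mulmxK // subrr.
pose phi t := (Phi t *m M0 *m invmx (Phi t)) i j.
pose g0 (Y : 'M[C]_n) := (Y *m M0 *m invmx Y) i j.
(* Conjugating by Phi mixes the entries, but the radical is stable under this. *)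
have rad : radical (fun t Y => \sum_a \sum_b h a b (invmx (Phi t) *m Y) * (Phi t i a * invmx (Phi t) b j)).
  apply: radical_sum => a; apply: radical_sum => b.
  apply: (@radicalZ (fun t => Phi t i a * invmx (Phi t) b j) (fun t Y => h a b (invmx (Phi t) *m Y))).
  split; first exact: mult_pull.
  exact: hJ.
have [_ [s gs]] := rad.
have {gs rad} : pspan (fun t Y => (g0 Y - phi t) ^+ s).
  move: gs; apply: pspan_ext; apply: filterS Phiu => t ut Y uY; congr (_ ^+ _).
  have E : Y *m M0 *m invmx Y - Phi t *m M0 *m invmx (Phi t) =
    Phi t *m (invmx (Phi t) *m Y *m M0 *m invmx (invmx (Phi t) *m Y) - M0) *m invmx (Phi t).
    rewrite invmx_Vmul // mulmxBr mulmxBl; congr (_ - _).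
    by rewrite !mulmxA mulmxV // mul1mx mulmxK.
  have -> : g0 Y - phi t = (Y *m M0 *m invmx Y - Phi t *m M0 *m invmx (Phi t)) i j.
    by rewrite sub_mxE.
  rewrite E [RHS]mxE exchange_big; apply: eq_bigr => b _ /=.
  rewrite [X in _ = X * _]mxE mulr_suml; apply: eq_bigr => a _.
  rewrite /h [X in _ = _ * X * _]sub_mxE.
  by rewrite mulrCA mulrA.
move=> [m [P [PI span]]].
(* A common stable space for the relations P l and the powers 1, ..., g0 ^ s. *)
pose G (l : nat) : R -> 'M[C]_n -> C :=
  if insub l is Some l' then P l' else fun _ Y => g0 Y ^+ (l - m).
have kG l : Kreg (G l).
  rewrite /G; case: insubP => [l' _ _|_]; first exact: (proj1 (PI l')).
  have [g rg gE] := greg i j.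
  apply: Kreg_reg; exists (fun Y => g Y ^+ (l - m)); first exact: reg_exp.
  by move=> Y uY; rewrite /g0 gE.
have [N [mu [T [S fam]]]] := Kreg_family (m + s.+1) kG.
have /choice[cP cPE] (l : 'I_m) : exists c : R -> 'rV[C]_N,
    germ_mx Kr c /\ forall t, {in unitmx, forall Y, P l t Y = (c t *m mu Y) 0 0}.
  have [|c [kc cE]] := fam l; first by rewrite (leq_trans (ltn_ord l)) ?leq_addr.
  by exists c; split => // t Y uY; rewrite -cE // /G valK.
have /choice[xi xiE] (l : 'I_s.+1) : exists c : R -> 'rV[C]_N,
    germ_mx Kr c /\ forall t, {in unitmx, forall Y, g0 Y ^+ l = (c t *m mu Y) 0 0}.
  have [|c [kc cE]] := fam (m + l)%N; first by rewrite ltn_add2l.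
  exists c; split => // t Y uY; rewrite -cE // /G insubN ?addKn //.
  by rewrite -leqNgt leq_addr.
have [E [kE EI cE _]] := Phi_relations_projector KF w0 wc Kder kA Phiu dPhi S.
(* Kx: the coordinate vectors of the zero function, which are relations. *)
have [Kx KxP] : exists Kx : 'M[C]_N, forall v : 'rV[C]_N, {in unitmx, forall Y, v *m mu Y = 0} <-> (v <= Kx)%MS.
  apply: (@subspace_mx _ _ (fun v : 'rV[C]_N => {in unitmx, forall Y, v *m mu Y = 0})) => [Y _|u v Su Sv Y uY|a u Su Y uY].
  - by rewrite mul0mx.
  - by rewrite mulmxDl Su // Sv // addr0.
  - by rewrite -scalemxAl Su // scaler0.
have KxE : \forall t \near F, Kx *m E t = Kx.
  have : \forall t \near F, forall l, row l Kx *m E t = row l Kx.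
    apply: filter_forall => l; apply: (cE (fun=> row l Kx)); split; first exact: (germ_mx_cst KF).
    apply: filterS Phiu => t ut; apply: (proj2 (KxP _)) => //; exact: row_sub.
  by apply: filterS => t H; apply/row_matrixP => l; rewrite row_mul H.
have cPI : \forall t \near F, forall l, cP l t *m E t = cP l t.
  apply: filter_forall => l; apply: cE; split; first exact: (proj1 (cPE l)).
  have [_ P0] := PI l; apply: filterS2 P0 Phiu => t P0 ut; apply/matrixP => a b.
  by rewrite (ord1 a) (ord1 b) -(proj2 (cPE l)) // P0 mxE.
have EPhi : \forall t \near F, E t *m mu (Phi t) = 0.
  have : \forall t \near F, forall l, row l (E t) *m mu (Phi t) = 0.
    by apply: filter_forall => l; exact: (proj2 (EI l)).
  by apply: filterS => t H; apply/row_matrixP => l; rewrite row_mul H row0.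
pose XI t : 'M[C]_(s.+1, N) := \matrix_l xi l t.
have kXI : germ_mx Kr XI.
  move=> a b; apply: (gf_eq (FF R) KF) (proj1 (xiE a) 0 b) => t; by rewrite mxE.
have XImu (b : 'rV[C]_s.+1) t Y : Y \in unitmx -> (b *m XI t *m mu Y) 0 0 = (rVpoly b).[g0 Y].
  move=> uY; rewrite horner_rV -mulmxA mxE; apply: eq_bigr => l _; congr (_ * _).
  rewrite (proj2 (xiE l) t) // -row_mul_entry; congr ((_ *m _) 0 0).
  by rewrite rowK.
(* b eta = 0 expresses that, at t, the polynomial b in g0 is a combination of
   relations. *)
pose eta t := XI t *m (1%:M - E t).
have keta : germ_mx Kr eta.
  by apply: (germ_mx_mul KF) => //; apply: (germ_mx_sub (FF R) KF) => //; exact: (germ_mx_cst KF).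
have [X kX etaX] := generalized_inverse (FF R) KF keta.
(* The rows of Rm span the kernel of eta, over the field. *)
pose Rm t := 1%:M - eta t *m X t.
have kRm : germ_mx Kr Rm.
  apply: (germ_mx_sub (FF R) KF); first exact: (germ_mx_cst KF).
  exact: (germ_mx_mul KF).
change (Kr phi).
apply: (power_span_rational (FF R) KF (m := s.+1) (s := s) (R := fun l t => rVpoly (row l (Rm t)))).
  move=> l; split.
  - move=> d; case: (ltnP d s.+1) => [ds|sd].
      apply: (gf_eq (FF R) KF) (kRm l (Ordinal ds)) => t.
      by rewrite (coef_rVpoly_ord (row l (Rm t)) (Ordinal ds)) [RHS]mxE.
    apply: (gf_eq (FF R) KF) (gf_cst KF 0) => t; rewrite nth_default //.
    exact: leq_trans (size_poly _ _) sd.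
  - by apply: nearW => t; exact: size_poly.
  - apply: filterS3 etaX EPhi Phiu => t etaX EPhi ut.
    have pg : phi t = g0 (Phi t) by [].
    rewrite rootE pg -(XImu _ t (Phi t) ut); apply/eqP.
    have Z : row l (Rm t) *m XI t = row l (Rm t) *m XI t *m E t.
      apply/eqP; rewrite -subr_eq0 -[X in X - _]mulmx1 -mulmxBr -mulmxA -/(eta t).
      by rewrite -row_mul /Rm mulmxBl mul1mx etaX subrr row0.
    by rewrite Z -(mulmxA _ (E t)) EPhi mulmx0 [LHS]mxE.
apply: filterS3 span (filterI KxE cPI) (filterI etaX Phiu) => t [l lE] [KxEt cPIt] [etaXt ut].
pose b : 'rV[C]_s.+1 := poly_rV (('X - (phi t)%:P) ^+ s).
have bE : rVpoly b = ('X - (phi t)%:P) ^+ s by rewrite poly_rV_K // size_exp_XsubC.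
have beta : b *m eta t = 0.
  pose rho := b *m XI t.
  have rE : rho *m E t = rho.
    have : (rho - \sum_a l a *: cP a t <= Kx)%MS.
      apply/KxP => Y uY; apply/matrixP => u v; rewrite (ord1 u) (ord1 v) {u v}.
      rewrite mulmxBl [LHS]mxE XImu // bE mulmx_suml [X in _ + X]mxE summxE.
      rewrite horner_exp hornerXsubC lE // [RHS]mxE; apply/eqP; rewrite subr_eq0; apply/eqP.
      by apply: eq_bigr => a _; rewrite (proj2 (cPE a)) // -scalemxAl [RHS]mxE.
    move=> /submxP[D DE].
    have : (rho - \sum_a l a *: cP a t) *m E t = rho - \sum_a l a *: cP a t.
      by rewrite DE -mulmxA KxEt.
    rewrite mulmxBl mulmx_suml.
    under eq_bigr do rewrite -scalemxAl cPIt.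
    by move/addIr.
  by rewrite /eta mulmxA mulmxBr mulmx1 -/rho rE subrr.
exists (fun a => b 0 a); rewrite -bE.
have bR : b = b *m Rm t by rewrite /Rm mulmxBr mulmx1 mulmxA beta mul0mx subr0.
rewrite {1}bR mulmx_sum_row linear_sum; apply: eq_bigr => a _; by rewrite linearZ.
Qed.
End Stabilizer.

Local Transparent C.

(** * Solutions of real linear differential systems *)
Section Picard.
Variable R : realType.

Lemma primitive (f : R -> R) : continuous f ->
  exists F : R -> R, F 0 = 0 /\ forall x : R, -1 < x < 1 -> is_derive x (1 : R) F (f x).
Proof.
move=> cf.
pose G (x : R) : R := (\int[lebesgue_measure]_(t in [set` `[(-1 : R), x]]) f t)%R.
have dG (x : R) : -1 < x < 1 -> is_derive x (1 : R) G (f x).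
  move=> /andP[x1 x2].
  have fi : (@lebesgue_measure R).-integrable [set` `[(-1 : R), 1]] (EFin \o f).
    apply: continuous_compact_integrable; first exact: segment_compact.
    by apply: continuous_subspaceT.
  have [dG G'] := continuous_FTC1_closed x2 fi x1 (cf x).
  apply: DeriveDef; first exact: dG.
  by rewrite -derive1E.
exists (fun x => G x - G 0); split; first by rewrite subrr.
move=> x xI; have := dG x xI => /is_deriveP H; apply/is_deriveP.
apply: cvg_trans H; apply: near_eq_cvg; near=> h.
by rewrite opprB addrA subrK.
Unshelve. all: by end_near. Qed.

(** The Cauchy criterion with an explicit rate, which yields uniform convergence of
    the iterates below. *)
Lemma geometric_limit (u : nat -> R) D : (forall k, `|u k.+1 - u k| <= D * 2^-1 ^+ k) ->
  exists l, forall k, `|l - u k| <= 2 * D * 2^-1 ^+ k.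
Proof.
move=> H.
have D0 : 0 <= D by have := le_trans (normr_ge0 _) (H 0%N); rewrite expr0 mulr1.
have cu : cvgn u.
  have -> : u = (fun n => u 0%N + series (telescope u) n).
    by apply/funext => n; exact: eq_sum_telescope.
  apply: is_cvgD; first exact: is_cvg_cst.
  apply: normed_cvg; apply: (@series_le_cvg _ _ (geometric D 2^-1)) => [n|n|n|].
  - exact: normr_ge0.
  - by apply: mulr_ge0 => //; apply: exprn_ge0; rewrite invr_ge0.
  - exact: H.
  - by apply: is_cvg_geometric_series; rewrite gtr0_norm ?invr_gt0 // invf_lt1 ?ltr1n.
exists (limn u) => k.
have B m : `|u (m + k)%N - u k| <= 2 * D * (2^-1 ^+ k - 2^-1 ^+ (m + k)).
  elim: m => [|m IH]; first by rewrite add0n !subrr normr0 mulr0.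
  have -> : u (m.+1 + k)%N - u k = (u (m + k).+1 - u (m + k)%N) + (u (m + k)%N - u k).
    by rewrite addrA subrK addSn.
  apply: le_trans (ler_normD _ _) _; apply: le_trans (lerD (H _) IH) _.
  rewrite addSn exprS; set a := _ ^+ (m + k); set b := _ ^+ k; lra.
have cv : (fun m => `|u (m + k)%N - u k|) @ \oo --> `|limn u - u k|.
  apply: cvg_norm; apply: cvgB; last exact: cvg_cst.
  by rewrite (@cvg_shiftn k _ u).
apply: (cvgr_to_le cv); near=> m; apply: le_trans (B m) _.
apply: ler_wpM2l; first by rewrite mulr_ge0.
by rewrite lerBlDr lerDl exprn_ge0 // invr_ge0.
Unshelve. all: by end_near. Qed.

(** The retraction of the line onto [-e, e].  It makes continuous data near 0 global
    and bounded, and turns the functions on an interval into functions on R. *)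
Definition clamp (e t : R) : R := (`|t + e| - `|t - e|) / 2.

Lemma clamp_le e t : 0 <= e -> `|clamp e t| <= e.
Proof.
move=> e0; rewrite /clamp normrM (ger0_norm (x := 2^-1)) ?invr_ge0 //.
rewrite ler_pdivrMr //; apply: le_trans (ler_dist_dist _ _) _.
have -> : t + e - (t - e) = e * 2 by ring.
by rewrite ger0_norm // mulr_ge0.
Qed.

Lemma clamp_id e t : `|t| <= e -> clamp e t = t.
Proof.
rewrite ler_norml => /andP[h1 h2]; rewrite /clamp.
rewrite ger0_norm; last by lra.
by rewrite ler0_norm; [lra|rewrite subr_le0].
Qed.

Lemma clamp_cts e : continuous (clamp e).
Proof.
move=> t; apply: cvgM; last exact: cvg_cst.
by apply: cvgB; apply: cvg_norm; [apply: cvgD|apply: cvgB]; (exact: cvg_cst || exact: cvg_id).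
Qed.

Lemma near_clamp_id e t : `|t| < e -> \forall x \near t, clamp e x = x.
Proof.
move=> te; have c : (fun x : R => `|x|) @ t --> `|t| by apply: cvg_norm; exact: cvg_id.
have : \forall x \near t, `|x| < e by move: c => /cvgr_lt; apply.
by apply: filterS => x /ltW /clamp_id.
Qed.

Lemma cts_sum (I : Type) (r : seq I) (f : I -> R -> R) (t : R) :
  (forall i, {for t, continuous (f i)}) -> {for t, continuous (fun x => \sum_(i <- r) f i x)}.
Proof.
move=> H; elim: r => [|i r IH].
  rewrite (_ : (fun x => _) = (fun=> 0)); first exact: cvg_cst.
  by apply/funext => x; rewrite big_nil.
rewrite (_ : (fun x => _) = (fun x => f i x + \sum_(i <- r) f i x)).
  exact: cvgD (H i) IH.
by apply/funext => x; rewrite big_cons.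
Qed.

Lemma deriv_le_center (f f' : R -> R) (e M s : R) :
  continuous f -> (forall x, `|x| < e -> is_derive x (1 : R) f (f' x)) ->
  (forall x, `|x| < e -> `|f' x| <= M) -> 0 < e -> `|s| <= e -> `|f s - f 0| <= M * e.
Proof.
move=> cf df bf e0 se.
have M0 : 0 <= M by apply: le_trans (bf 0 _); rewrite ?normr_ge0 // normr0.
suff H : `|f s - f 0| <= M * `|s| by apply: le_trans H _; exact: ler_wpM2l.
move: se; rewrite ler_norml => /andP[es se].
have [s0|s0|<-] := ltgtP 0 s; last by rewrite !subrr normr0 mulr_ge0.
- have [||c] := @MVT _ f f' 0 s s0.
  + move=> x; rewrite in_itv /= => /andP[h1 h2]; apply: df.
    by rewrite ltr_norml; apply/andP; split; lra.
  + exact: continuous_subspaceT.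
  rewrite in_itv /= => /andP[h1 h2] ->; rewrite subr0 normrM ler_wpM2r //.
  by apply: bf; rewrite ltr_norml; apply/andP; split; lra.
- have [||c] := @MVT _ f f' s 0 s0.
  + move=> x; rewrite in_itv /= => /andP[h1 h2]; apply: df.
    by rewrite ltr_norml; apply/andP; split; lra.
  + exact: continuous_subspaceT.
  rewrite in_itv /= => /andP[h1 h2]; rewrite distrC => ->.
  rewrite sub0r normrM normrN ler_wpM2r //.
  by apply: bf; rewrite ltr_norml; apply/andP; split; lra.
Qed.

Lemma le_geometric0 (x c : R) : (forall k, x <= c * 2^-1 ^+ k) -> x <= 0.
Proof.
move=> H; have cv : geometric c 2^-1 @ \oo --> (0 : R).
  by apply: cvg_geometric; rewrite gtr0_norm ?invr_gt0 // invf_lt1 ?ltr1n.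
apply: (cvgr_to_ge cv); apply: nearW => k; exact: H.
Qed.

Lemma geometric_small (c eps : R) : 0 < eps -> exists k, c * 2^-1 ^+ k < eps.
Proof.
move=> e0; apply: contrapT => /forallNP H.
have : eps <= 0; last by rewrite leNgt e0.
have cv : geometric c 2^-1 @ \oo --> (0 : R).
  by apply: cvg_geometric; rewrite gtr0_norm ?invr_gt0 // invf_lt1 ?ltr1n.
apply: (cvgr_to_ge cv); apply: nearW => k; rewrite leNgt; apply/negP; exact: H.
Qed.

Section LinearODE.
Variables (I : finType) (a : I -> I -> R -> R) (beta : R).
Hypothesis ac : forall i j, continuous (a i j).
Hypothesis ab : forall i j t, `|a i j t| <= beta.

(** Picard iteration on an interval so short that the integral operator halves
    distances; the interval depends on the bound of the coefficients only, not on
    the initial value. *)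
Lemma linear_ode : exists2 e, 0 < e & forall y0 : I -> R, exists y : I -> R -> R,
  [/\ forall i, continuous (y i), forall i, y i 0 = y0 i &
   forall i t, `|t| < e -> is_derive t (1 : R) (y i) (\sum_j a i j t * y j t)].
Proof.
have beta0 : #|I| = 0%N \/ 0 <= beta.
  case: (posnP #|I|) => [|/card_gt0P[i _]]; first by left.
  by right; apply: le_trans (ab i i 0); exact: normr_ge0.
pose b := #|I|%:R * beta.
have b0 : 0 <= b.
  by rewrite /b; case: beta0 => [->|H]; [rewrite mul0r|rewrite mulr_ge0].
pose e := (2 * (b + 1))^-1.
have e0 : 0 < e by rewrite invr_gt0; lra.
have be : b * e <= 2^-1.
  rewrite /e invfM mulrCA -[X in _ <= X]mulr1 ler_wpM2l ?invr_ge0 //.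
  by rewrite ler_pdivrMr; lra.
have e1 : e < 1 by rewrite invf_lt1; lra.
exists e => // y0.
(* The integral operator, with its values clamped outside [-e, e]. *)
have key (y : I -> R -> R) : (forall i, continuous (y i)) ->
    exists z : I -> R -> R, [/\ forall i, continuous (z i), forall i, z i 0 = y0 i,
      forall i t, z i t = z i (clamp e t) &
      forall i t, `|t| < e -> is_derive t (1 : R) (z i) (\sum_j a i j t * y j t)].
  move=> yc.
  have gc i : continuous (fun t => \sum_j a i j t * y j t).
    move=> t; apply: (cts_sum (f := fun j x => a i j x * y j x)) => j.
    by apply: cvgM; [exact: ac|exact: yc].
  have /choice[G GP] i := primitive (gc i).
  have cI t : -1 < clamp e t < 1.
    by have := clamp_le t (ltW e0); rewrite ler_norml => /andP[h1 h2]; apply/andP; split; lra.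
  exists (fun i t => y0 i + G i (clamp e t)); split.
  - move=> i t; apply: cvgD; first exact: cvg_cst.
    apply: (cvg_comp _ _ (@clamp_cts e t)).
    have [dG _] := (proj2 (GP i)) _ (cI t).
    by have/derivable1_diffP/differentiable_continuous := dG.
  - by move=> i; rewrite clamp_id ?normr0 ?ltW // (proj1 (GP i)) addr0.
  - by move=> i t; rewrite (clamp_id (t := clamp e t)) // clamp_le // ltW.
  - move=> i t te; have := (proj2 (GP i)) t.
    have tI : -1 < t < 1 by move: te; rewrite ltr_norml => /andP[h1 h2]; apply/andP; split; lra.
    move=> /(_ tI) dG.
    apply: (@near_eq_is_derive _ _ _ (fun x => y0 i + G i x)).
      by apply: filterS (near_clamp_id te) => x ->.
    have /is_deriveP H := dG; apply/is_deriveP.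
    by under eq_fun do rewrite opprD addrACA subrr add0r.
(* It halves the uniform distance. *)
have contr (y y' z z' : I -> R -> R) D :
    (forall i t, `|y i t - y' i t| <= D) ->
    (forall i, continuous (z i)) -> (forall i, continuous (z' i)) ->
    (forall i, z i 0 = z' i 0) ->
    (forall i t, z i t = z i (clamp e t)) -> (forall i t, z' i t = z' i (clamp e t)) ->
    (forall i t, `|t| < e -> is_derive t (1 : R) (z i) (\sum_j a i j t * y j t)) ->
    (forall i t, `|t| < e -> is_derive t (1 : R) (z' i) (\sum_j a i j t * y' j t)) ->
    forall i t, `|z i t - z' i t| <= D * 2^-1.
  move=> yD zc zc' z0 zcl zcl' dz dz' i t.
  have D0 : 0 <= D by apply: le_trans (yD i 0); exact: normr_ge0.
  rewrite zcl zcl'; set s := clamp e t.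
  have se : `|s| <= e by rewrite clamp_le // ltW.
  apply: (@le_trans _ _ ((b * D) * e)); last first.
    by rewrite mulrAC mulrC ler_wpM2l.
  have := @deriv_le_center (fun x => z i x - z' i x)
    (fun x => \sum_j a i j x * y j x - \sum_j a i j x * y' j x) e (b * D) s.
  rewrite z0 subrr subr0; apply => //.
  - by move=> x; apply: cvgB; [exact: zc|exact: zc'].
  - by move=> x xe; apply: is_deriveB; [exact: dz|exact: dz'].
  - move=> x xe; rewrite -sumrB; apply: le_trans (ler_norm_sum _ _ _) _.
    apply: (@le_trans _ _ (\sum_(j : I) beta * D)).
      apply: ler_sum => j _; rewrite -mulrBr normrM; apply: ler_pM => //; exact: normr_ge0.
    by rewrite sumr_const /b -mulrA mulr_natl.
pose Cts := {y : I -> R -> R | forall i, continuous (y i)}.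
have /choice[f fP] (Y : Cts) : exists Z : Cts, [/\ forall i, sval Z i 0 = y0 i,
      forall i t, sval Z i t = sval Z i (clamp e t) &
      forall i t, `|t| < e -> is_derive t (1 : R) (sval Z i) (\sum_j a i j t * sval Y j t)].
  by case: Y => y yc; have [z [zc z1 z2 z3]] := key y yc; exists (exist _ z zc).
have cc : forall i, continuous ((fun (i : I) (_ : R) => y0 i) i) by move=> i t; exact: cvg_cst.
pose Y k : Cts := iter k f (exist _ _ cc).
pose D0 := (\sum_j beta * `|y0 j|) * e.
have step k i t : `|sval (Y k.+1) i t - sval (Y k) i t| <= D0 * 2^-1 ^+ k.
  elim: k i t => [|k IH] i t.
    rewrite expr0 mulr1 /=; have [z1 z2 z3] := fP (exist _ _ cc).
    have H := @deriv_le_center _ _ e (\sum_j beta * `|y0 j|) (clamp e t)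
      (svalP (f (exist _ _ cc)) i) (z3 i) _ e0 _.
    rewrite -z2 z1 in H; apply: H; last by rewrite clamp_le // ltW.
    move=> x xe; apply: le_trans (ler_norm_sum _ _ _) _; apply: ler_sum => j _.
    by rewrite normrM ler_wpM2r.
  rewrite exprSr mulrA.
  have [z1 z2 z3] := fP (Y k.+1); have [z1' z2' z3'] := fP (Y k).
  apply: (contr _ _ _ _ _ IH) => //.
  - exact: (svalP (Y k.+2)).
  - exact: (svalP (Y k.+1)).
  - by move=> l; rewrite z1 z1'.
have /choice[y yP] (it : I * R) : exists l, forall k, `|l - sval (Y k) it.1 it.2| <= 2 * D0 * 2^-1 ^+ k.
  by apply: (@geometric_limit (fun k => sval (Y k) it.1 it.2)) => k; exact: step.
(* The convergence is uniform, so the limit is continuous. *)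
have yc i : continuous (fun t => y (i, t)).
  move=> t; apply/cvgrPdist_lt => eps eps0.
  have [k kP] := geometric_small (2 * D0) (divr_gt0 eps0 (ltr0Sn R 2)).
  have := svalP (Y k) i t => /cvgrPdist_lt /(_ _ (divr_gt0 eps0 (ltr0Sn R 2))).
  apply: filterS => x H; have h1 := yP (i, t) k; have h2 := yP (i, x) k.
  rewrite distrC in h2.
  have -> : y (i, t) - y (i, x) = (y (i, t) - sval (Y k) i t) +
     (sval (Y k) i t - sval (Y k) i x) + (sval (Y k) i x - y (i, x)) by ring.
  apply: le_lt_trans (ler_normD _ _) _; apply: le_lt_trans (lerD (ler_normD _ _) (lexx _)) _.
  rewrite /= in h1 h2; lra.
pose yy : Cts := exist _ (fun i t => y (i, t)) yc.
have [z1 z2 z3] := fP yy.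
have zy i t : sval (f yy) i t = y (i, t).
  apply/eqP; rewrite -subr_eq0 -normr_le0; apply: (@le_geometric0 _ (4 * D0)) => k.
  have [z1' z2' z3'] := fP (Y k).
  have h1 : `|sval (f yy) i t - sval (Y k.+1) i t| <= 2 * D0 * 2^-1 ^+ k * 2^-1.
    apply: (contr _ _ _ _ _ (fun i t => yP (i, t) k)) => //.
    - exact: (svalP (f yy)).
    - exact: (svalP (Y k.+1)).
    - by move=> l; rewrite z1 z1'.
  have h2 := yP (i, t) k; have h3 := step k i t; rewrite /= in h2.
  have -> : sval (f yy) i t - y (i, t) = (sval (f yy) i t - sval (Y k.+1) i t) +
    (sval (Y k.+1) i t - sval (Y k) i t) - (y (i, t) - sval (Y k) i t) by ring.
  have n1 := ler_normB (sval (f yy) i t - sval (Y k.+1) i t + (sval (Y k.+1) i t - sval (Y k) i t)) (y (i, t) - sval (Y k) i t).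
  have n2 := ler_normD (sval (f yy) i t - sval (Y k.+1) i t) (sval (Y k.+1) i t - sval (Y k) i t).
  lra.
exists (fun i t => y (i, t)); split => //.
- by move=> i; rewrite -zy z1.
- move=> i t te; have := z3 i t te.
  have -> : sval (f yy) i = (fun t => y (i, t)) by apply/funext => x; rewrite zy.
  by [].
Unshelve. all: by end_near. Qed.
End LinearODE.
End Picard.

(** * Matrix solutions of complex linear systems along a real interval *)
Section MatrixODE.
Variable R : realType.
Local Notation C := (C R).

Lemma clamp_bound (g : R -> R) (d : R) : 0 < d -> (forall t, `|t| < d -> {for t, continuous g}) ->
  exists b, continuous (fun t => g (clamp (d / 2) t)) /\ forall t, `|g (clamp (d / 2) t)| <= b.
Proof.
move=> d0 gc; have d2 : 0 <= d / 2 by lra.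
have cd t : `|clamp (d / 2) t| <= d / 2 by exact: clamp_le.
have [||c _ cP] := @EVT_max R (fun t => `|g (clamp (d / 2) t)|) (- (d / 2)) (d / 2).
- lra.
- apply: continuous_subspaceT => t; apply: cvg_norm.
  apply: (cvg_comp _ _ (@clamp_cts R (d / 2) t)); apply: gc.
  by apply: le_lt_trans (cd t) _; lra.
exists `|g (clamp (d / 2) c)|; split.
  move=> t; apply: (cvg_comp _ _ (@clamp_cts R (d / 2) t)); apply: gc.
  by apply: le_lt_trans (cd t) _; lra.
move=> t; have := cP (clamp (d / 2) t); rewrite (clamp_id (t := clamp (d / 2) t)) //; apply.
by rewrite in_itv /= -ler_norml.
Qed.

(** Real and imaginary parts turn a complex system of size n into a real one of size
    2 n, indexed by [bool * 'I_n], which is solved for each column. *)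
Lemma matrix_ode n (H : R -> 'M[C]_n) (d : R) : 0 < d ->
  (forall i j t, `|t| < d -> {for t, continuous (fun x => H x i j)}) ->
  exists2 Phi : R -> 'M[C]_n, Phi 0 = 1%:M & exists2 e, 0 < e &
    forall t, `|t| < e -> mrder Phi t (H t *m Phi t).
Proof.
move=> d0 Hc.
pose I : finType := (bool * 'I_n)%type.
pose g (x y : I) (t : R) : R :=
  if x.1 then if y.1 then complex.Re (H t x.2 y.2) else - complex.Im (H t x.2 y.2)
  else if y.1 then complex.Im (H t x.2 y.2) else complex.Re (H t x.2 y.2).
have gc x y t : `|t| < d -> {for t, continuous (g x y)}.
  move=> td; have h := Hc x.2 y.2 t td; rewrite /g.
  have hR : (fun s => complex.Re (H s x.2 y.2)) @ t --> complex.Re (H t x.2 y.2) by exact: (@Re_cvg R R (nbhs t) _ (fun s => H s x.2 y.2) (H t x.2 y.2) h).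
  have hI : (fun s => complex.Im (H s x.2 y.2)) @ t --> complex.Im (H t x.2 y.2) by exact: (@Im_cvg R R (nbhs t) _ (fun s => H s x.2 y.2) (H t x.2 y.2) h).
  case: x.1; case: y.1; [exact: hR|exact: (cvgN hI)|exact: hI|exact: hR].
have /choice[b bP] (xy : I * I) := clamp_bound d0 (gc xy.1 xy.2).
have B x y t : `|g x y (clamp (d / 2) t)| <= \sum_xy `|b xy|.
  apply: le_trans (proj2 (bP (x, y)) t) _; apply: le_trans (ler_norm _) _.
  by rewrite (bigD1 (x, y)) //= lerDl sumr_ge0.
have [e e0 sol] := linear_ode (fun x y => proj1 (bP (x, y))) B.
have /choice[y yP] (j : 'I_n) := sol (fun x => if x.1 then (x.2 == j)%:R else 0).
pose Phi t : 'M[C]_n := \matrix_(i, j) (Complex (y j (true, i) t) (y j (false, i) t) : C).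
exists Phi.
  apply/matrixP => i j; rewrite !mxE; have [_ y0 _] := yP j.
  by rewrite !y0 /=; case: (i == j).
exists (Num.min e (d / 2)); first by rewrite lt_min e0; lra.
move=> t; rewrite lt_min => /andP[te td] i j.
have [_ _ dy] := yP j.
have sumE (x : I) : \sum_z g x z (clamp (d / 2) t) * y j z t =
    \sum_l (g x (true, l) t * y j (true, l) t + g x (false, l) t * y j (false, l) t).
  rewrite clamp_id; last exact: ltW.
  transitivity (\sum_c \sum_l g x (c, l) t * y j (c, l) t).
    by rewrite pair_bigA; apply: eq_bigr => -[c l] _.
  by rewrite big_bool /= -big_split.
have ReE : complex.Re ((H t *m Phi t) i j) = \sum_z g (true, i) z (clamp (d / 2) t) * y j z t.
  rewrite sumE mxE (big_morph _ (@Re_add R) (erefl _)); apply: eq_bigr => l _.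
  by rewrite Re_mul mxE /g /= mulNr.
have ImE : complex.Im ((H t *m Phi t) i j) = \sum_z g (false, i) z (clamp (d / 2) t) * y j z t.
  rewrite sumE mxE (big_morph _ (@Im_add R) (erefl _)); apply: eq_bigr => l _.
  by rewrite Im_mul mxE /g /= addrC.
apply: (@rder_ReIm R (fun x => Phi x i j)).
  have -> : (fun x => complex.Re (Phi x i j)) = y j (true, i) by apply/funext => x; rewrite mxE.
  by rewrite ReE; exact: dy.
have -> : (fun x => complex.Im (Phi x i j)) = y j (false, i) by apply/funext => x; rewrite mxE.
by rewrite ImE; exact: dy.
Qed.
End MatrixODE.

(** * Meromorphic functions in a local coordinate *)
Section Local.
Variable R : realType.
Local Notation C := (C R).
Local Notation CP1 := (CP1 R).

(** Complex derivative, stated as a difference quotient so that the calculus of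
    [qder] applies. *)
Definition cder (f : C -> C) (a d : C) : Prop := qder (0 : C)^' id (fun h => f (a + h)) (f a) d.

Lemma dnbhsC_filter : ProperFilter (0 : C)^'. Proof. exact: Proper_dnbhs_numFieldType. Qed.
Local Notation i0 := (@cvg_id_dnbhsC R).
Local Notation n0 := (@near_dnbhsC_neq0 R).

Lemma cderP f a d : cder f a d <-> is_derive a (1 : C) f d.
Proof.
have E : (fun h : C => (id h)^-1 * (f (a + h) - f a)) =
         (fun h => h^-1 *: ((f \o shift a) (h *: 1) - f a)).
  by apply/funext => h /=; rewrite /GRing.scale /= mulr1 (addrC h).
rewrite /cder /qder E; split=> [H|[H1 <-]]; last exact: H1.
apply: DeriveDef; first by apply/cvg_ex; exists d.
by apply: cvg_lim => //; exact: norm_hausdorff.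
Qed.

Lemma cder_derive1 f a d : cder f a d -> derive1 f a = d.
Proof. by move=> /cderP[_ <-]; rewrite derive1E. Qed.

Lemma derivable_cder (f : C -> C) a : derivable f a 1 -> cder f a (derive1 f a).
Proof. by move=> H; apply/cderP; rewrite derive1E; apply: DeriveDef. Qed.

Lemma cder_id a : cder id a 1.
Proof.
rewrite /cder /qder; have H : (fun=> 1 : C) @ (0 : C)^' --> (1 : C) by exact: cvg_cst.
apply: (cvg_trans _ H); apply: near_eq_cvg; near=> h.
have h0 : h != 0 by near: h; exact: n0.
by rewrite addrAC subrr add0r mulVf.
Unshelve. all: by end_near. Qed.

Lemma cder_comp f g a d e : cder g a d -> cder f (g a) e -> cder (fun x => f (g x)) a (d * e).
Proof. move=> gd fe; exact: (qder_comp dnbhsC_filter i0 n0 fe gd). Qed.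

Lemma cder_cts f a d : cder f a d -> {for a, continuous f}.
Proof.
move=> /(qder_cvg dnbhsC_filter i0 n0) H.
apply/(@cvgrPdist_lt _ _ _ (nbhs a)) => e e0; move: H => /cvgrPdist_lt /(_ e e0).
rewrite near_withinE => H.
have : \forall h \near (0 : C), `|f a - f (a + h)| < e.
  apply: filterS H => h; have [->|h0] := eqVneq h 0; last exact.
  by move=> _; rewrite addr0 subrr normr0.
move/nbhs_ballP => [r /= r0 Hr]; apply/nbhs_ballP; exists r => //= x.
rewrite /ball /= => xr; have := Hr (x - a).
rewrite /ball /= sub0r opprB => /(_ xr).
by rewrite (addrC a) subrK.
Qed.

Lemma cder_near f g a d : (\forall x \near a, f x = g x) -> cder g a d -> cder f a d.
Proof.
move=> fg; rewrite /cder (nbhs_singleton fg); apply: (qder_eq dnbhsC_filter).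
move: fg => /nbhs_ballP[r /= r0 Hr]; rewrite near_withinE; apply/nbhs_ballP; exists r => //= h.
by rewrite /ball /= sub0r normrN => hr _; apply: Hr; rewrite /ball /= opprD addNKr normrN.
Qed.

Lemma cder_ext f g a d : f =1 g -> cder g a d -> cder f a d.
Proof. by move=> /funext ->. Qed.

Lemma cderM f g a d e : cder f a d -> cder g a e -> cder (fun x => f x * g x) a (d * g a + f a * e).
Proof. exact: (qderM dnbhsC_filter i0 n0). Qed.

Lemma cderV f a d : f a != 0 -> cder f a d -> cder (fun x => (f x)^-1) a (- d * (f a)^-1 ^+ 2).
Proof. exact: (qderV dnbhsC_filter i0 n0). Qed.

Lemma near_dnbhs0 (P : C -> Prop) :
  (\forall s \near (0 : C)^', P s) <-> exists2 r : R, 0 < r & forall s : C, s != 0 -> `|s| < rc r -> P s.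
Proof.
split.
  rewrite near_withinE => /nbhs_ballP[e /= /pos_rc[r r0 ->] H]; exists r => // s s0 sr.
  by apply: H => //; rewrite /ball /= sub0r normrN.
move=> [r r0 H]; rewrite near_withinE; apply/nbhs_ballP; exists (rc r) => /=.
  by rewrite -(rc0 R) rc_lt.
by move=> s; rewrite /ball /= sub0r normrN => sr s0; exact: H.
Qed.

(** The local coordinate s centered at [p], read backwards: the affine coordinate
    of the point of parameter s. *)
Definition loc (p : CP1) (s : C) : C := if p is Some a then a + s else s^-1.
Definition dloc (p : CP1) (s : C) : C := if p is Some a then 1 else - s ^- 2.

Lemma loc_der p (s : C) : s != 0 -> cder (loc p) s (dloc p s).
Proof.
move=> s0; case: p => [a|] /=.
  have := qderD dnbhsC_filter (qder_cst dnbhsC_filter id a) (cder_id s); by rewrite add0r.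
have := @cderV id s 1 s0 (cder_id s).
by rewrite mulN1r exprVn.
Qed.

Lemma dloc_neq0 p (s : C) : s != 0 -> dloc p s != 0.
Proof. by case: p => [a|] s0 /=; rewrite ?oner_neq0 // oppr_eq0 invr_eq0 expf_neq0. Qed.

(** Statements near a point of the projective line are thus statements near 0 in the
    complex plane, for affine points and infinity alike. *)
Lemma near_pnbhs p (P : C -> Prop) :
  (\forall x \near pnbhs p, P x) <-> \forall s \near (0 : C)^', P (loc p s).
Proof.
case: p => [a|] //=; rewrite near_dnbhs0 near_withinE; split.
  move=> /nbhs_ballP[e /= /pos_rc[r r0 ->] H]; exists r => // s s0 sr.
  apply: H; first by rewrite /ball /= opprD addNKr normrN.
  by rewrite -subr_eq0 addrAC subrr add0r.
move=> [r r0 H]; apply/nbhs_ballP; exists (rc r) => /=; first by rewrite -(rc0 R) rc_lt.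
move=> x; rewrite /ball /= => xr xa; have := H (x - a).
by rewrite subr_eq0 xa distrC xr addrC subrK; apply.
Qed.

Lemma pnbhs_proper (p : CP1) : ProperFilter (pnbhs p).
Proof.
case: p => [a|] /=; first exact: Proper_dnbhs_numFieldType.
by apply: fmap_proper_filter; exact: dnbhsC_filter.
Qed.

Section Mero.
Variable U : set CP1.

(** A meromorphic function times a power of the local coordinate extends
    holomorphically. *)
Lemma mero_loc f p : meromorphic_on U f -> U p -> exists k (h : C -> C),
  (\forall s \near (0 : C), derivable h s 1) /\ \forall s \near (0 : C)^', s ^+ k * f (loc p s) = h s.
Proof.
move=> mf Up; have := mf p Up; case: p Up => [a|] Up [k [h [dh fh]]].
  exists k, (fun s => h (a + s)); split.
    have /nbhs_ballP[r r0 Hr] := dh; apply/nbhs_ballP; exists r; first exact: r0.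
    move=> s; rewrite /ball /= sub0r normrN => sr.
    have /derivable_cder H : derivable h (a + s) 1.
      by apply: Hr; rewrite /ball /= opprD addNKr normrN.
    have A : cder (fun s => a + s) s 1.
      by have := qderD dnbhsC_filter (qder_cst dnbhsC_filter id a) (cder_id s); rewrite add0r.
    by have /cderP[] := cder_comp A H.
  have := fh; rewrite (near_pnbhs (Some a)); apply: filterS => s /=.
  by rewrite addrAC subrr add0r.
exists k, h; split => //; apply: filterS fh => s /=; by rewrite subr0.
Qed.

Lemma near_neq0 (s : C) : s != 0 -> \forall z \near s, z != 0.
Proof.
move=> s0; apply/nbhs_ballP; exists `|s|; first by rewrite /= normr_gt0.
by move=> z; rewrite /ball /=; apply: contraTneq => ->; rewrite subr0 ltxx.
Qed.

Lemma nbhs0_dnbhs (P : C -> Prop) : (\forall s \near (0 : C), P s) -> \forall s \near (0 : C)^', P s.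
Proof. by move=> H; rewrite near_withinE; apply: filterS H. Qed.

(** A punctured disc is a neighbourhood of each of its points. *)
Lemma dnbhs_spread (P : C -> Prop) : (\forall s \near (0 : C)^', P s) ->
  \forall s \near (0 : C)^', \forall z \near s, P z.
Proof.
move=> /near_dnbhs0[r r0 H]; apply/near_dnbhs0; exists r => // s s0 sr.
have n1 : \forall z \near s, z != 0.
  exact: near_neq0.
have n2 : \forall z \near s, `|z| < rc r.
  apply/nbhs_ballP; exists (rc r - `|s|) => /=; first by rewrite subr_gt0.
  move=> z; rewrite /ball /= => zs.
  have -> : z = s - (s - z) by rewrite opprB addrC subrK.
  apply: le_lt_trans (ler_normB _ _) _.
  by rewrite -ltrBrDl.
by apply: filterS2 n1 n2 => z; exact: H.
Qed.

Lemma mero_derivable f p : meromorphic_on U f -> U p ->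
  \forall s \near (0 : C)^', exists d, cder (fun s => f (loc p s)) s d.
Proof.
move=> mf Up; have [k [h [dh fh]]] := mero_loc mf Up.
apply: filterS3 (dnbhs_spread fh) (nbhs0_dnbhs dh) n0 => s fh' dh' s0.
have kd : exists d, cder (fun z => (z ^+ k)^-1) s d.
  have [d dP] : exists d, cder (fun z => z ^+ k) s d.
    elim: k {fh fh'} => [|k [d IH]].
      by exists 0; under eq_fun do rewrite expr0; exact: (qder_cst dnbhsC_filter).
    eexists; under eq_fun do rewrite exprS; exact: (cderM (cder_id s) IH).
  eexists; apply: (cderV _ dP); by rewrite expf_neq0.
have [d dP] := kd; exists (d * h s + (s ^+ k)^-1 * derive1 h s).
apply: cder_near (cderM dP (derivable_cder dh')).
have n1 : \forall z \near s, z != 0.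
  exact: near_neq0.
apply: filterS2 fh' n1 => z E z0; rewrite -E mulrA mulVf ?mul1r //.
by rewrite expf_neq0.
Qed.

Lemma loc_inv (p : CP1) (s : C) f d : s != 0 -> cder (fun s => f (loc p s)) s d -> exists e, cder f (loc p s) e.
Proof.
case: p => [a|] /= s0 H.
  exists (1 * d).
  have A : cder (fun x => x - a) (a + s) 1.
    have := qderD dnbhsC_filter (cder_id (a + s)) (qder_cst dnbhsC_filter id (- a)); by rewrite addr0.
  have E : a + s - a = s by rewrite addrAC subrr add0r.
  rewrite -E in H; have := cder_comp A H.
  by apply: cder_ext => x; rewrite (addrC a) subrK.
have H' : cder (fun s : C => f s^-1) (s^-1)^-1 d by rewrite invrK.
have si : s^-1 != 0 by rewrite invr_eq0.
eexists; apply: cder_ext (cder_comp (cderV (f := id) si (cder_id s^-1)) H').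
by move=> x; rewrite invrK.
Qed.

Lemma mero_derive1 f p : meromorphic_on U f -> U p ->
  \forall s \near (0 : C)^', cder f (loc p s) (derive1 f (loc p s)).
Proof.
move=> mf Up; apply: filterS2 (mero_derivable mf Up) n0 => s [d dP] s0.
have [e eP] := loc_inv s0 dP; by rewrite (cder_derive1 eP).
Qed.

Lemma mero_derive1_loc f p : meromorphic_on U f -> U p ->
  \forall s \near (0 : C)^', cder (fun s => f (loc p s)) s (dloc p s * derive1 f (loc p s)).
Proof.
move=> mf Up; apply: filterS2 (mero_derive1 mf Up) n0 => s dP s0.
exact: (cder_comp (@loc_der p s s0) dP).
Qed.
End Mero.

Lemma cder_curve (f : C -> C) (c : R -> C) t d e :
  rder c t d -> cder f (c t) e -> rder (fun x => f (c x)) t (d * e).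
Proof.
by move=> cd fe; exact: (qder_comp (dnbhsR_filter R) (@cvg_rc_dnbhs R) (@near_rc_neq0 R) fe cd).
Qed.

Lemma rder_rc t : rder (@rc R) t 1.
Proof.
rewrite /rder /qder; have H : (fun=> 1 : C) @ (0 : R)^' --> (1 : C) by exact: cvg_cst.
apply: (cvg_trans _ H); apply: near_eq_cvg; near=> h.
have h0 : rc h != 0 by near: h; exact: near_rc_neq0.
by rewrite rcD addrAC subrr add0r mulVf.
Unshelve. all: by end_near. Qed.

(** Mean value inequality on the closed segment, for both the real and the imaginary
    part. *)
Lemma rder_seg (c c' : R -> C) (M : R) :
  (forall x : R, 0 <= x <= 1 -> rder c x (c' x)) -> (forall x : R, 0 <= x <= 1 -> `|c' x| <= rc M) ->
  `|c 1 - c 0| <= rc (2 * M).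
Proof.
move=> dc bc.
have key (P : C -> R) : (forall x : R, 0 <= x <= 1 -> is_derive x (1 : R) (fun y => P (c y)) (P (c' x))) ->
    (forall z, rc `|P z| <= `|z|) -> `|P (c 1) - P (c 0)| <= M.
  move=> dP Pn; have [||y] := @MVT_segment _ (fun y => P (c y)) (fun y => P (c' y)) 0 1 ler01.
  - move=> x; rewrite in_itv /= => /andP[x0 x1]; apply: dP; by rewrite !ltW.
  - by apply: derivable_within_continuous => x; rewrite in_itv /= => /dP[].
  rewrite in_itv /= => yI ->; rewrite subr0 mulr1 -rc_le.
  exact: le_trans (Pn _) (bc y yI).
have hR := key (@complex.Re R) (fun x xI => rder_Re (dc x xI)) (@Re_norm R).
have hI := key (@complex.Im R) (fun x xI => rder_Im (dc x xI)) (@Im_norm R).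
rewrite (complex_split (c 1 - c 0)).
apply: (le_trans (ler_normD _ _)); rewrite normrM !rc_norm.
have -> : `|'i%C : C| = 1 by rewrite normc_def /= expr0n expr1n add0r sqrtr1.
rewrite mul1r -rcD rc_le Re_add Im_add Re_opp Im_opp.
by rewrite mulr_natl mulr2n lerD.
Qed.

(** Mean value inequality along the segment from z to u; if it passes through the
    puncture, go around by way of i z. *)
Lemma punctured_lip (G : C -> C) (r M : R) : 
  (forall s : C, s != 0 -> `|s| < rc r -> exists2 d, cder G s d & `|d| <= rc M) ->
  forall z u : C, z != 0 -> u != 0 -> `|z| < rc r -> `|u| < rc r ->
    `|G u - G z| <= rc (8 * M * r).
Proof.
move=> dG.
(* Estimate when the segment avoids the puncture. *)
have seg (z u : C) : (forall x : R, 0 <= x <= 1 -> z + rc x * (u - z) != 0) ->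
    `|z| < rc r -> `|u| < rc r -> `|G u - G z| <= rc (4 * M * r).
  move=> av zr ur.
  have inr (x : R) : 0 <= x <= 1 -> `|z + rc x * (u - z)| < rc r.
    move=> /andP[x0 x1].
    have -> : z + rc x * (u - z) = rc (1 - x) * z + rc x * u by rewrite rcD rcN rc1; ring.
    apply: le_lt_trans (ler_normD _ _) _; rewrite !normrM !rc_norm (ger0_norm (x := 1 - x)) ?subr_ge0 // (ger0_norm x0).
    have -> : rc r = rc (1 - x) * rc r + rc x * rc r by rewrite -mulrDl -rcD subrK rc1 mul1r.
    have [->|xn] := eqVneq x 0.
      by rewrite subr0 rc1 rc0 !mul1r !mul0r !addr0.
    apply: ler_ltD; first by apply: ler_wpM2l; [rewrite -(rc0 R) rc_le subr_ge0|exact: ltW].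
    by rewrite ltr_pM2l // -(rc0 R) rc_lt lt_neqAle eq_sym xn.
  have /choice[d dP] (x : R) : exists d, 0 <= x <= 1 ->
      cder G (z + rc x * (u - z)) d /\ `|d| <= rc M.
    have [xI|xI] := boolP (0 <= x <= 1); last by exists 0.
    have [d d1 d2] := dG _ (av x xI) (inr x xI); by exists d.
  have cl x : rder (fun x : R => z + rc x * (u - z)) x (u - z).
    have := qderD (dnbhsR_filter R) (qder_cst (dnbhsR_filter R) (@rc R) z)
      (qderM (dnbhsR_filter R) (@cvg_rc_dnbhs R) (@near_rc_neq0 R) (rder_rc x) (qder_cst (dnbhsR_filter R) (@rc R) (u - z))).
    by rewrite add0r mul1r mulr0 addr0.
  have := @rder_seg (fun x => G (z + rc x * (u - z))) (fun x => (u - z) * d x) (2 * r * M).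
  rewrite rc1 mul1r (addrC z (u - z)) subrK rc0 mul0r addr0.
  have -> : 2 * (2 * r * M) = 4 * M * r by ring.
  apply=> x xI; have [d1 d2] := dP x xI.
    exact: (cder_curve (cl x) d1).
  rewrite normrM rcM; apply: ler_pM => //.
  apply: le_trans (ler_normB _ _) _; rewrite rcM (_ : rc 2 = 1 + 1); last by rewrite -rc1 -rcD.
  by rewrite mulrDl mul1r; apply: lerD; exact: ltW.
move=> z u z0 u0 zr ur.
have r0 : 0 <= r by rewrite -rc_le rc0; apply: le_trans (ltW zr).
have M0 : 0 <= M.
  by have [d _ dM] := dG z z0 zr; rewrite -rc_le rc0; apply: le_trans dM.
have Mr : 0 <= M * r by exact: mulr_ge0.
have [av|] := pselect (forall x : R, 0 <= x <= 1 -> z + rc x * (u - z) != 0).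
  by apply: le_trans (seg z u av zr ur) _; rewrite rc_le; nra.
move=> /existsNP[x /not_implyP[/andP[x0 x1] /negP]]; rewrite negbK => /eqP E.
(* The segment meets 0, so u is a negative multiple of z. *)
have xn : x != 0 by apply: contra_neq z0 => xE; rewrite -E xE rc0 mul0r addr0.
have xp : 0 < x by rewrite lt_neqAle eq_sym xn.
pose l := (1 - x) / x.
have uE : u = - (rc l * z).
  have rx : rc x != 0 by rewrite rc_eq0.
  rewrite /l rcM rcV rcD rcN rc1; apply: (mulfI rx).
  transitivity (z + rc x * (u - z) - (1 - rc x) * z); first by ring.
  by rewrite E; field; rewrite rx.
have l0 : 0 < l.
  rewrite lt_neqAle eq_sym mulr_ge0 ?invr_ge0 ?subr_ge0 // andbT.
  by apply: contra_neq u0 => lE; rewrite uE lE rc0 mul0r oppr0.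
have ni : `|'i%C : C| = 1 by rewrite normc_def /= expr0n expr1n add0r sqrtr1.
have wr : `|'i%C * z| < rc r by rewrite normrM ni mul1r.
have h1 := seg z ('i%C * z) _ zr wr; have h2 := seg ('i%C * z) u _ wr ur.
have -> : G u - G z = (G u - G ('i%C * z)) + (G ('i%C * z) - G z) by rewrite addrA subrK.
apply: le_trans (ler_normD _ _) _.
have -> : rc (8 * M * r) = rc (4 * M * r) + rc (4 * M * r) by rewrite -rcD; congr rc; ring.
have nz (a b : R) : (a != 0) || (b != 0) -> (rc a + 'i%C * rc b) * z != 0.
  move=> ab; rewrite mulf_neq0 //; apply: contraTneq ab => H.
  have : (Complex a b : C) = 0 by rewrite (complex_split (Complex a b)).
  by case=> -> ->; rewrite eqxx.
apply: lerD; [apply: h2 => y yI|apply: h1 => y yI].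
- have -> : 'i%C * z + rc y * (u - 'i%C * z) = (rc (- (y * l)) + 'i%C * rc (1 - y)) * z.
    by rewrite uE rcN rcM rcD rcN rc1; ring.
  apply: nz; have [->|y1] := eqVneq y 0; first by rewrite subr0 oner_neq0 orbT.
  by rewrite oppr_eq0 mulf_neq0 // gt_eqF.
- have -> : z + rc y * ('i%C * z - z) = (rc (1 - y) + 'i%C * rc y) * z.
    by rewrite rcD rcN rc1; ring.
  apply: nz; have [->|y1] := eqVneq y 0; first by rewrite subr0 oner_neq0.
  by rewrite orbT.
Qed.
End Local.

(** * The identity theorem for a function field, and its germs along a ray *)
Section FunctionField.
Variable R : realType.
Local Notation C := (C R).
Local Notation CP1 := (CP1 R).
Variables (U : set CP1) (K : set (C -> C)) (FK : function_field U K).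

(** The function f / f is in the field and takes only the values 0 and 1.  Being
    idempotent it has derivative 0 near p, so it is constant on a punctured
    disc. *)
Lemma K_dichotomy f p : K f -> U p ->
  (\forall x \near pnbhs p, f x = 0) \/ (\forall x \near pnbhs p, f x != 0).
Proof.
move=> Kf Up.
pose e x := f x * (f x)^-1.
have Ke : K e by apply: (ff_mul FK) => //; exact: (ff_inv FK).
have e01 x : e x = (f x != 0)%:R.
  by rewrite /e; have [->|f0] := eqVneq (f x) 0; [rewrite mul0r|rewrite mulfV].
have [r r0 dE] := proj1 (near_dnbhs0 _) (mero_derivable (ff_meromorphic FK Ke) Up).
have E2 d s : cder (fun s => e (loc p s)) s d -> d = 0.
  move=> ds; have := cderM ds ds.
  have -> : (fun x => e (loc p x) * e (loc p x)) = (fun x => e (loc p x)).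
    by apply/funext => x; rewrite !e01; case: (f _ != 0); rewrite ?mul1r ?mul0r.
  move=> ds2; have := cder_derive1 ds; rewrite (cder_derive1 ds2) e01.
  case: (f _ != 0); rewrite ?mulr1 ?mul1r ?mulr0 ?mul0r ?addr0 //.
  by move=> H; apply: (addrI d); rewrite addr0.
have cst z u : z != 0 -> u != 0 -> `|z| < rc r -> `|u| < rc r -> e (loc p u) = e (loc p z).
  move=> z0 u0 zr ur.
  have := @punctured_lip R (fun s => e (loc p s)) r 0.
  rewrite mulr0 mul0r => H; apply/eqP; rewrite -subr_eq0 -normr_le0 -(rc0 R).
  apply: H => // s s0 sr; have [d dP] := dE s s0 sr.
  by exists d => //; rewrite (E2 _ _ dP) normr0 rc0.
pose z0 : C := rc (r / 2).
have z00 : z0 != 0 by rewrite rc_eq0 gt_eqF // divr_gt0.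
have z0r : `|z0| < rc r by rewrite rc_norm rc_lt gtr0_norm ?divr_gt0 //; lra.
have [fz|fz] := eqVneq (f (loc p z0)) 0; [left|right]; apply/near_pnbhs/near_dnbhs0; exists r => // s s0 sr.
  have := cst _ _ z00 s0 z0r sr; rewrite !e01 fz eqxx.
  case: (eqVneq (f (loc p s)) 0) => [-> //|_ /eqP].
  by rewrite [X in X == _]mulr1n [X in _ == X]mulr0n oner_eq0.
have := cst _ _ z00 s0 z0r sr; rewrite !e01 fz.
case: (eqVneq (f (loc p s)) 0) => [_ /eqP|//].
by rewrite [X in X == _]mulr0n [X in _ == X]mulr1n eq_sym oner_eq0.
Qed.

(** The square with half side [r] is compact and contains the disc of radius [r], so
    its complement is a neighbourhood of infinity on which |x| > r. *)
Lemma nbhs_infty (r : R) (Q : CP1 -> Prop) : 0 < r ->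
  (forall x, rc r < `|x| -> Q (Some x)) -> Q None -> \forall q \near (None : CP1), Q q.
Proof.
move=> r0 H HN.
pose D : set (R * R) := `[- r, r]%classic `*` `[- r, r]%classic.
pose g (ab : R * R) : C := rc ab.1 + 'i%C * rc ab.2.
have gc : continuous g.
  move=> ab; apply: cvgD; last (apply: cvgM; first exact: cvg_cst).
    by apply: (@continuous_comp _ _ _ fst (@rc R)); [exact: cvg_fst|exact: rc_cts].
  by apply: (@continuous_comp _ _ _ snd (@rc R)); [exact: cvg_snd|exact: rc_cts].
have cD : compact (g @` D).
  apply: continuous_compact; first exact: continuous_subspaceT.
  by apply: compact_setX; exact: segment_compact.
exists (g @` D).
  split => //; apply: compact_closed => //; exact: norm_hausdorff.
move=> q [[x nD <-]|->//]; apply: H; rewrite real_ltNge ?normr_real //; last first.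
  by apply/complex_realP; exists r.
apply/negP => xr; apply: nD; exists (complex.Re x, complex.Im x); last by rewrite /g /= -complex_split.
split => /=; rewrite in_itv /= -ler_norml -rc_le; apply: le_trans xr.
  exact: Re_norm.
exact: Im_norm.
Qed.

(** A punctured neighbourhood of [p] contains a neighbourhood of each of its points;
    at infinity these are the large affine points. *)
Lemma pnbhs_spread (p : CP1) (P : C -> Prop) : (\forall x \near pnbhs p, P x) ->
  \forall q \near p, \forall x \near pnbhs q, P x.
Proof.
(* A neighbourhood contains a punctured one. *)
have inner (b : C) : (\forall x \near b, P x) -> \forall x \near pnbhs (Some b), P x.
  by move=> H; rewrite near_withinE; apply: filterS H.
case: p => [a|] H.
  have H' : \forall b \near a, \forall x \near pnbhs (Some b), P x.
    have [r r0 Hr] := proj1 (near_dnbhs0 _) (proj1 (near_pnbhs (Some a) _) H).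
    have S0 : \forall s \near (0 : C)^', P (a + s) by apply/near_dnbhs0; exists r.
    have [r' r'0 Hr'] := proj1 (near_dnbhs0 _) (dnbhs_spread S0).
    apply/nbhs_ballP; exists (rc r') => /=; first by rewrite -(rc0 R) rc_lt.
    move=> b; rewrite /ball /= => br; have [->//|ba] := eqVneq b a.
    apply: inner; have := Hr' (b - a); rewrite subr_eq0 ba distrC br => /(_ isT isT).
    move=> /nbhs_ballP[q /= q0 Hq]; apply/nbhs_ballP; exists q => //= x.
    rewrite /ball /= => bx; have := Hq (x - a); rewrite /ball /= opprB addrA subrK => /(_ bx).
    by rewrite addrC subrK.
  exact: H'.
have [r r0 Hr] := proj1 (near_dnbhs0 _) (proj1 (near_pnbhs None _) H).
have ri : 0 < r^-1 by rewrite invr_gt0.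
apply: (nbhs_infty ri) => [b br|]; last exact: H.
apply: inner; apply/nbhs_ballP; exists (`|b| - rc r^-1) => /=; first by rewrite subr_gt0.
move=> x; rewrite /ball /= => bx.
have xr : rc r^-1 < `|x|.
  have := ler_normD (b - x) x; rewrite subrK => H1.
  rewrite -(ltrD2l `|b - x|); apply: lt_le_trans H1; by rewrite -ltrBrDr.
have x0 : x != 0.
  by apply: contraTneq xr => ->; rewrite normr0 -(rc0 R) rc_lt -leNgt invr_ge0 ltW.
have := Hr x^-1; rewrite invr_eq0 x0 /= invrK; apply => //.
rewrite normfV -[rc r]invrK -rcV ltf_pV2 // posrE ?normr_gt0 //.
by rewrite -(rc0 R) rc_lt invr_gt0.
Qed.

Hypothesis U_connected : connected U.

(** By the dichotomy, the points near which f vanishes and those near which it does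
    not are two open sets covering U. *)
Lemma K_identity f p : K f -> U p -> (\forall x \near pnbhs p, f x = 0) ->
  generically U (fun x => f x = 0).
Proof.
move=> Kf Up f0.
pose O : set CP1 := [set q | \forall x \near pnbhs q, f x = 0].
pose O' : set CP1 := [set q | \forall x \near pnbhs q, f x != 0].
have oO : open O by rewrite openE => q Oq; exact: pnbhs_spread Oq.
have oO' : open O' by rewrite openE => q Oq; exact: pnbhs_spread Oq.
have disj q : O q -> O' q -> False.
  move=> h1 h2; have pp := pnbhs_proper q.
  have : \forall x \near pnbhs q, False by apply: filterS2 h1 h2 => x ->; rewrite eqxx.
  by move/filter_ex => [].
have E : U `&` O = U.
  apply: U_connected.
  - by exists p.
  - by exists O.
  - exists (~` O'); first exact: open_closedC.
    apply/seteqP; split => q [Uq h]; split => //; first by move=> h'; exact: (disj q).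
    by have [//|h'] := K_dichotomy Kf Uq.
move=> q Uq; have [_ Oq] : (U `&` O) q by rewrite E.
exact: Oq.
Qed.

Variables (x0 : CP1) (Ux0 : U x0).
Local Notation F := (at_right (0 : R)).

(** The positive real ray in the local coordinate at [x0].  Restricting to it turns
    differential equations over the field into equations in one real variable. *)
Definition ray (t : R) : C := loc x0 (rc t).

Lemma near_ray (P : C -> Prop) : (\forall x \near pnbhs x0, P x) -> \forall t \near F, P (ray t).
Proof.
move=> /near_pnbhs/near_dnbhs0[r r0 H]; apply/near_at_rightP; exists r => // t /andP[t0 tr].
by apply: H; rewrite ?rc_eq0 ?gt_eqF // rc_norm rc_lt gtr0_norm.
Qed.

Lemma near_rc_ray (P : C -> Prop) : (\forall s \near (0 : C)^', P s) -> \forall t \near F, P (rc t).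
Proof.
move=> /near_dnbhs0[r r0 H]; apply/near_at_rightP; exists r => // t /andP[t0 tr].
by apply: H; rewrite ?rc_eq0 ?gt_eqF // rc_norm rc_lt gtr0_norm.
Qed.

Definition ray_germ (c : R -> C) := exists2 f, K f & \forall t \near F, c t = f (ray t).

Lemma ray_germ_field : germ_field F ray_germ.
Proof.
have FFR := FF R.
split.
- move=> c d cd [f Kf cf]; exists f => //; by apply: filterS2 cd cf => t <-.
- by move=> a; exists (fun=> a); [exact: (ff_cst FK)|exact: nearW].
- move=> c d [f Kf cf] [g Kg dg]; exists (fun x => f x + g x); first exact: (ff_add FK).
  by apply: filterS2 cf dg => t -> ->.
- move=> c d [f Kf cf] [g Kg dg]; exists (fun x => f x * g x); first exact: (ff_mul FK).
  by apply: filterS2 cf dg => t -> ->.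
- move=> c [f Kf cf]; exists (fun x => (f x)^-1); first exact: (ff_inv FK).
  by apply: filterS cf => t ->.
- move=> c [f Kf cf]; have [H|H] := K_dichotomy Kf Ux0; [left|right].
    by apply: filterS2 cf (near_ray H) => t ->.
  by apply: filterS2 cf (near_ray H) => t ->.
Qed.

Definition ray_speed (t : R) : C := dloc x0 (rc t).

Lemma ray_speed_neq0 : \forall t \near F, ray_speed t != 0.
Proof.
apply/near_at_rightP; exists 1 => // t /andP[t0 _]; apply: dloc_neq0.
by rewrite rc_eq0 gt_eqF.
Qed.

Lemma ray_speed_cts : \forall t \near F, {for t, continuous ray_speed}.
Proof.
apply/near_at_rightP; exists 1 => // t /andP[t0 _]; rewrite /ray_speed /dloc.
case: x0 => [a|]; first exact: cvg_cst.
apply: cvgN; apply: cvgV; first by rewrite expf_neq0 // rc_eq0 gt_eqF.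
apply: cvgM; exact: rc_cts.
Qed.

Lemma K_ray_der f : K f -> \forall t \near F, rder (fun t => f (ray t)) t (ray_speed t * derive1 f (ray t)).
Proof.
move=> Kf; have H := near_rc_ray (mero_derive1_loc (ff_meromorphic FK Kf) Ux0).
apply: filterS H => t dt.
have := cder_curve (rder_rc t) dt; by rewrite mul1r.
Qed.

Lemma ray_germ_der c : ray_germ c -> exists2 c', ray_germ c' & \forall t \near F, rder c t (ray_speed t * c' t).
Proof.
move=> [f Kf cf]; exists (fun t => derive1 f (ray t)).
  by exists (derive1 f); [exact: (ff_derive FK)|exact: nearW].
have [e e0 He] := proj1 (near_at_rightP _) cf.
have [e' e'0 He'] := proj1 (near_at_rightP _) (K_ray_der Kf).
apply/near_at_rightP; exists (Num.min e e'); first by rewrite lt_min e0.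
move=> t /andP[t0]; rewrite lt_min => /andP[te te'].
have d : rder (fun t => f (ray t)) t (ray_speed t * derive1 f (ray t)) by apply: He'; rewrite t0.
rewrite /rder He ?t0 //; apply: (qder_eq (dnbhsR_filter R)) d.
rewrite near_withinE.
have n1 : \forall h \near (0 : R), 0 < t + h < e.
  apply/nbhs_ballP; exists (Num.min t (e - t)) => /=; first by rewrite lt_min t0 subr_gt0.
  move=> h; rewrite /ball /= sub0r normrN lt_min !ltr_norml => /andP[/andP[h1 h2] /andP[h3 h4]].
  by apply/andP; split; lra.
by apply: filterS n1 => h hI _; exact: He.
Qed.

End FunctionField.

(** * Characteristic polynomials and block-diagonal commutants *)
Lemma char_horner (K : comNzRingType) n (A : 'M[K]_n) c : (char_poly A).[c] = \det (c%:M - A).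
Proof.
rewrite -/(horner_eval c (char_poly A)) /char_poly -det_map_mx; congr (\det _).
apply/matrixP => i j; rewrite !mxE rmorphB rmorphMn /= /horner_eval.
by rewrite hornerX hornerC.
Qed.

(** Evaluating at n + 1 points replaces the identity of two polynomials, whose
    coefficients would have to be discussed one by one, by identities of
    determinants. *)
Lemma char_poly_interp (K : numFieldType) n (A : 'M[K]_n) (p : {poly K}) :
  size p = n.+1 -> (forall i : 'I_n.+1, \det ((i%:R)%:M - A) = p.[i%:R]) -> char_poly A = p.
Proof.
move=> sp H; apply/eqP; rewrite -subr_eq0; apply/eqP.
apply: (@roots_geq_poly_eq0 _ _ [seq (i%:R : K) | i : 'I_n.+1]).
- apply/allP => _ /fintype.imageP[i _ ->]; by rewrite /root hornerD hornerN char_horner H subrr.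
- rewrite map_inj_uniq ?enum_uniq // => i j /eqP; rewrite eqr_nat => /eqP; exact: val_inj.
- rewrite size_image card_ord; apply: leq_trans (size_polyD _ _) _.
  by rewrite size_polyN size_char_poly sp maxnn.
Qed.

Section Spectrum.
Variables (K : fieldType) (k : nat) (l : 'I_k -> K) (r : 'I_k -> nat).
Hypothesis linj : injective l.

(** The characteristic polynomial prescribed by eigenvalues and multiplicities. *)
Definition spec_poly : {poly K} := \prod_i ('X - (l i)%:P) ^+ r i.

Lemma spec_monic : spec_poly \is monic.
Proof. by apply: monic_prod => i _; apply: monic_exp; exact: monicXsubC. Qed.

Lemma size_spec : size spec_poly = (\sum_i r i).+1.
Proof.
rewrite /spec_poly size_prod; last by move=> i _; rewrite expf_neq0 // polyXsubC_eq0.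
under eq_bigr do rewrite size_exp_XsubC -addn1.
by rewrite big_split /= sum1_card -addSn addnK.
Qed.

Lemma horner_spec c : spec_poly.[c] = \prod_i (c - l i) ^+ r i.
Proof. by rewrite horner_prod; apply: eq_bigr => i _; rewrite !hornerE. Qed.

Lemma root_spec c : root spec_poly c -> exists i, c = l i.
Proof.
rewrite /root horner_spec => /prodf_eq0[i _]; rewrite expf_eq0 subr_eq0 => /andP[_ /eqP ->].
by exists i.
Qed.

Lemma mup_spec i : mup (l i) spec_poly = r i.
Proof.
rewrite /spec_poly (bigD1 i) //= mupMl.
  by rewrite mup_XsubCX eqxx.
rewrite /root horner_prod; apply/prodf_neq0 => j ji.
by rewrite !hornerE expf_neq0 // subr_eq0 (inj_eq linj) eq_sym.
Qed.

(** The prime powers of [spec_poly] are coprime, and the degrees agree. *)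
Lemma spec_unique n (A : 'M[K]_n) : (\sum_i r i)%N = n ->
  (forall i, mup (l i) (char_poly A) = r i) -> char_poly A = spec_poly.
Proof.
move=> rn H; have dvd : spec_poly %| char_poly A.
  rewrite /spec_poly; have Hd i : ('X - (l i)%:P) ^+ r i %| char_poly A.
    by rewrite -mup_geq ?H // monic_neq0 // char_poly_monic.
  have : forall s : seq 'I_k, uniq s -> \prod_(i <- s) ('X - (l i)%:P) ^+ r i %| char_poly A.
    elim=> [|i s IH] /=; first by rewrite big_nil dvd1p.
    move=> /andP[iNs us]; rewrite big_cons Gauss_dvdp ?Hd ?IH //.
    apply: coprimep_expl; rewrite coprimep_sym coprimep_XsubC /root horner_prod.
    rewrite prodf_seq_neq0; apply/allP => j js /=.
    rewrite !hornerE expf_neq0 // subr_eq0 (inj_eq linj).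
    by apply: contraNneq iNs => ->.
  by apply; exact: index_enum_uniq.
apply/eqP; rewrite -eqp_monic ?char_poly_monic ?spec_monic // eqp_sym.
by rewrite -dvdp_size_eqp // size_spec size_char_poly rn.
Qed.
End Spectrum.

Lemma det_mxdiag (K : comPzRingType) k (d : 'I_k -> nat) (D : forall i, 'M[K]_(d i)) :
  \det (\mxdiag_i D i) = \prod_i \det (D i).
Proof.
elim: k d D => [|k IH] d D.
  have z m (M : 'M[K]_m) : m = 0%N -> \det M = 1 by case: m M => // M _; exact: det_mx00.
  by rewrite [RHS]big_ord0 z // big_ord0.
rewrite mxdiag_recl [RHS]big_ord_recl -IH.
case: _ / mxsize_recl; by rewrite castmx_id det_ublock.
Qed.

(** [Q] is square up to the equation between its dimensions. *)
Lemma det_intertwine (K : fieldType) m n (e : m = n) (Q : 'M[K]_(m, n)) (B : 'M_n) (E : 'M_m) :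
  row_free Q -> Q *m B = E *m Q -> \det B = \det E.
Proof.
case: n / e Q B => Q B; rewrite row_free_unit unitmxE unitfE => uQ /(congr1 determinant).
by rewrite !det_mulmx mulrC => /(mulIf uQ).
Qed.

Lemma char_intertwine (K : fieldType) m n (e : m = n) (Q : 'M[K]_(m, n)) (B : 'M_n) (E : 'M_m) :
  row_free Q -> Q *m B = E *m Q -> forall c, (char_poly B).[c] = (char_poly E).[c].
Proof.
move=> fQ H c; rewrite !char_horner; apply: (det_intertwine e fQ).
by rewrite mulmxBr mulmxBl H mul_scalar_mx mul_mx_scalar.
Qed.

(** Over an algebraically closed field the characteristic polynomial splits, and its
    roots are eigenvalues. *)
Lemma char_single (K : closedFieldType) n (E : 'M[K]_n) a :
  (forall z, eigenvalue E z -> z = a) -> char_poly E = ('X - a%:P) ^+ n.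
Proof.
move=> H; have [s Es] := closed_field_poly_normal (char_poly E).
have sa z : z \in s -> z = a.
  move=> zs; apply: H; rewrite eigenvalue_root_char Es rootZ ?lead_coef_eq0 ?monic_neq0 ?char_poly_monic //.
  by rewrite root_prod_XsubC.
move: Es; rewrite (monicP (char_poly_monic E)) scale1r => Es.
have ss : size s = n.
  by have := size_char_poly E; rewrite Es size_prod_XsubC => -[].
rewrite Es -ss big_seq (eq_bigr (fun=> 'X - a%:P)); last by move=> z /sa ->.
by rewrite -big_seq big_const_seq count_predT iter_mulr_1.
Qed.

Section Decomposition.
Variables (K : numClosedFieldType) (n : nat) (B : 'M[K]_n).
Variables (k : nat) (l : 'I_k -> K) (r : 'I_k -> nat) (rn : (\sum_i r i)%N = n).
Hypothesis linj : injective l.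
Hypothesis Bspec : char_poly B = spec_poly l r.
Hypothesis n0 : (0 < n)%N.

Let V i : 'M[K]_n := kermxpoly B (('X - (l i)%:P) ^+ r i).

Let coV : {in predT &, forall i j, j != i -> coprimep (('X - (l i)%:P) ^+ r i) (('X - (l j)%:P) ^+ r j)}.
Proof.
move=> i j _ _ ji; apply: coprimep_expl; apply: coprimep_expr.
by rewrite coprimep_XsubC root_XsubC (inj_eq linj).
Qed.

Let V_direct : mxdirect (\sum_i V i)%MS.
Proof. exact: (mxdirect_sum_kermx B coV). Qed.

Let V_full : (\sum_i V i :=: 1%:M)%MS.
Proof.
case: n n0 B @V V_direct coV Bspec => // n' _ B' V0 _ co' HB.
apply: eqmx_trans (eqmx_sym (kermxpoly_prod B' co')) (kermxpoly_min _).
rewrite -/(spec_poly l r) -HB; exact: mxminpoly_dvd_char.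
Qed.

Let basis_free (d : 'I_k -> nat) (X : forall i, 'M[K]_(d i, n)) : (\sum_i d i)%N = n ->
  (forall i, (X i :=: V i)%MS) -> row_free (\mxcol_i X i).
Proof.
move=> dn XV; rewrite -row_leq_rank eqmx_col dn.
rewrite (eqmx_sums (B := V)); last by move=> i _; exact: eqmx_trans (genmxE _) (XV i).
by rewrite V_full mxrank1.
Qed.

Let basis_stable d (X : 'M[K]_(d, n)) i s : (X :=: V i)%MS -> comm_mx B s ->
  exists D, X *m s = D *m X.
Proof.
move=> XV Bs; apply/submxP; rewrite (eqmxMr s XV) XV.
exact: comm_mx_stable_kermxpoly.
Qed.

Let rank_V i : \rank (V i) = r i.
Proof.
pose d i := \rank (V i); pose X i : 'M[K]_(d i, n) := row_base (V i).
have dn : (\sum_i d i)%N = n.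
  by rewrite -[RHS](mxrank1 K n) -V_full (mxdirectP V_direct).
have XV j : (X j :=: V j)%MS by exact: eq_row_base.
have fX := basis_free dn XV.
have [E XE] := fin_all_exists (fun j => basis_stable (XV j) (comm_mx_refl B)).
have QE : \mxcol_j X j *m B = \mxdiag_j E j *m \mxcol_j X j.
  by rewrite mxcol_mul mul_mxdiag_mxcol; apply: eq_mxcol.
have cE j : char_poly (E j) = ('X - (l j)%:P) ^+ d j.
  apply: char_single => z /eigenvalueP[v vE v0].
  apply/eqP; apply: contraT => zl.
  have u0 : v *m X j != 0 by rewrite mulmx_free_eq0 // row_base_free.
  case/negP: u0; rewrite -submx0 -(mxdirect_kermxpoly B (p := 'X - z%:P) (q := ('X - (l j)%:P) ^+ r j)).
    rewrite sub_capmx -eigenspace_poly; apply/andP; split.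
      by apply/eigenspaceP; rewrite -mulmxA XE mulmxA vE scalemxAl.
    by apply: submx_trans (submxMl _ _) _; rewrite (XV j).
  by apply: coprimep_expr; rewrite coprimep_XsubC root_XsubC eq_sym.
have : char_poly B = spec_poly l d.
  apply: char_poly_interp; first by rewrite size_spec dn.
  move=> c; rewrite -char_horner (char_intertwine dn fX QE) char_horner -mxdiagZ -mxdiagB det_mxdiag.
  by rewrite horner_spec; apply: eq_bigr => j _; rewrite -char_horner cE !hornerE.
by move/(congr1 (mup (l i))); rewrite Bspec !mup_spec.
Qed.

(** A matrix commuting with [B] preserves the generalized eigenspaces of [B], so it
    is block diagonal in a basis adapted to them.  The i-th one has dimension [r i]
    because [B] has there the only eigenvalue [l i] ([char_single]), so that the
    characteristic polynomial counts the dimensions. *)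
Lemma commutant_block : exists2 P : 'M[K]_n, P \in unitmx & forall s, s \in unitmx -> comm_mx B s ->
  exists D : forall i, 'M[K]_(r i), (forall i, D i \in unitmx) /\
    castmx (esym rn, esym rn) (P *m s *m invmx P) = \mxdiag_i D i.
Proof.
pose X i : 'M[K]_(r i, n) := castmx (rank_V i, erefl n) (row_base (V i)).
have XV i : (X i :=: V i)%MS by exact: eqmx_trans (eqmx_cast _ _) (eq_row_base _).
have fX := basis_free rn XV.
suff : exists2 P : 'M[K]_n, P \in unitmx & forall s, s \in unitmx ->
    (forall i, exists D, X i *m s = D *m X i) -> exists D : forall i, 'M[K]_(r i), (forall i, D i \in unitmx) /\
    castmx (esym rn, esym rn) (P *m s *m invmx P) = \mxdiag_i D i.
  move=> [P uP H]; exists P => // s us Bs; apply: H => // i; exact: basis_stable (XV i) Bs.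
move: X fX {XV}; case: n / rn => X fX.
have uX : \mxcol_i X i \in unitmx by rewrite -row_free_unit.
exists (\mxcol_i X i) => // s us /fin_all_exists[D XD]; exists D.
have E : \mxcol_i X i *m s = \mxdiag_i D i *m \mxcol_i X i.
  by rewrite mxcol_mul mul_mxdiag_mxcol; apply: eq_mxcol.
rewrite castmx_id; split; last by rewrite E mulmxK.
have : \det (\mxdiag_i D i) != 0.
  by rewrite -(mulmxK uX (\mxdiag_i D i)) -E -unitfE -unitmxE !unitmx_mul uX us unitmx_inv uX.
by rewrite det_mxdiag => /prodf_neq0 H i; rewrite unitmxE unitfE; exact: H.
Qed.
End Decomposition.

(** Take the conjugate of the matrix that is the scalar [l i] on the i-th block: scalars
    commute with each block. *)
Lemma block_commutant (K : fieldType) n k (l : 'I_k -> K) (r : 'I_k -> nat) (rn : (\sum_i r i)%N = n) (P : 'M[K]_n) :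
  P \in unitmx -> exists2 M0 : 'M[K]_n, (forall c, \det (c%:M - M0) = (spec_poly l r).[c]) &
  forall s (D : forall i, 'M[K]_(r i)), castmx (esym rn, esym rn) (P *m s *m invmx P) = \mxdiag_i D i ->
    s *m M0 = M0 *m s.
Proof.
case: n / rn P => P uP; pose L : 'M[K]_(\sum_i r i) := \mxdiag_i (l i)%:M.
exists (invmx P *m L *m P) => [c|s D].
  have -> : c%:M - invmx P *m L *m P = invmx P *m (c%:M - L) *m P.
    by rewrite mulmxBr mulmxBl mul_mx_scalar -scalemxAl mulVmx // scalemx1.
  rewrite !det_mulmx det_inv mulrAC mulVf ?mul1r; last by rewrite -unitfE -unitmxE.
  rewrite -mxdiagZ -mxdiagB det_mxdiag horner_spec; apply: eq_bigr => i _.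
  by rewrite -raddfB det_scalar.
rewrite castmx_id => E.
have EL : P *m s *m invmx P *m L = L *m (P *m s *m invmx P).
  have mul (D1 D2 : forall i, 'M[K]_(r i)) : \mxdiag_i D1 i *m \mxdiag_i D2 i = \mxdiag_i (D1 i *m D2 i).
    rewrite [X in _ *m X]/mxdiag mul_mxdiag_mxblock; apply: eq_mxblock => i j.
    by case: eqVneq => [ij|_]; [case: j / ij; rewrite !conform_mx_id|rewrite mulmx0].
  by rewrite E /L !mul; apply: eq_mxdiag => i; rewrite scalar_mxC.
have sE : s = invmx P *m (P *m s *m invmx P) *m P by rewrite !mulmxA mulVmx // mul1mx mulmxKV.
rewrite sE; move: (P *m s *m invmx P) EL => Y EL.
by rewrite !mulmxA !(mulmxK uP) -(mulmxA (invmx P) Y L) EL mulmxA.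
Qed.

(** * The fundamental matrix at a nonsingular point *)
Section Fundamental.
Variable R : realType.
Local Notation C := (C R).
Local Notation CP1 := (CP1 R).
Local Notation F := (at_right (0 : R)).

(** In the local coordinate the system is dy/ds = h(s) y with h continuous at 0, at
    infinity as well as at an affine point. *)
Lemma nonsing_loc n (A : C -> 'M[C]_n) (x0 : CP1) : nonsingular A x0 ->
  exists h : C -> 'M[C]_n, (forall i j, \forall s \near (0 : C), {for s, continuous (fun z => h z i j)}) /\
    \forall s \near (0 : C)^', dloc x0 s *: A (loc x0 s) = h s.
Proof.
move=> ns.
have : forall ij : 'I_n * 'I_n, exists g : C -> C, (\forall s \near (0 : C), {for s, continuous g}) /\
    \forall s \near (0 : C)^', dloc x0 s * A (loc x0 s) ij.1 ij.2 = g s.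
  move=> ij; have := ns ij.1 ij.2; case: x0 ns => [a|] ns [g [dg Ag]].
    exists (fun s => g (a + s)); split; last first.
      have := proj1 (near_pnbhs (Some a) _) Ag; apply: filterS => s /= <-.
      by rewrite mul1r.
    have /nbhs_ballP[r r0 Hr] := dg; apply/nbhs_ballP; exists r; first exact: r0.
    move=> s; rewrite /ball /= sub0r normrN => sr.
    have D : derivable g (a + s) 1 by apply: Hr; rewrite /ball /= opprD addNKr normrN.
    have L : cder (fun s : C => a + s) s (0 + 1) := qderD (dnbhsC_filter R) (qder_cst (dnbhsC_filter R) id a) (cder_id s).
    exact: (cder_cts (cder_comp L (derivable_cder D))).
  exists g; split; last by apply: filterS Ag => s /= <-.
  by apply: filterS dg => s D; exact: (cder_cts (derivable_cder D)).
move=> /choice[g gP]; exists (fun s => \matrix_(i, j) g (i, j) s); split.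
  move=> i j; have [H _] := gP (i, j); apply: filterS H => s.
  have -> : (fun z => (\matrix_(i0, j0) g (i0, j0) z) i j) = g (i, j) by apply/funext => z; rewrite mxE.
  by [].
have H : \forall s \near (0 : C)^', forall i j, dloc x0 s * A (loc x0 s) i j = g (i, j) s.
  by apply: filter_forall => i; apply: filter_forall => j; exact: (proj2 (gP (i, j))).
by apply: filterS H => s H; apply/matrixP => i j; rewrite [LHS]mxE [RHS]mxE H.
Qed.

Lemma near0_right (P : R -> Prop) : (\forall t \near (0 : R)^', P t) -> \forall t \near F, P t.
Proof.
rewrite !near_withinE; apply: filterS => t H t0; apply: H; by rewrite gt_eqF.
Qed.

(** The solution is constructed on a real interval around 0, which gives its value
    and its differentiability at the base point itself. *)
Lemma fundamental_matrix n (A : C -> 'M[C]_n) (x0 : CP1) : nonsingular A x0 ->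
  exists Phi : R -> 'M[C]_n, [/\ \forall t \near F, Phi t \in unitmx,
    \forall t \near F, mrder Phi t (ray_speed x0 t *: A (ray x0 t) *m Phi t) &
    exists M, mxqder F (@rc R) Phi 1%:M M].
Proof.
move=> /nonsing_loc[h [hc hA]].
have : \forall s \near (0 : C), forall i j, continuous_at s (fun z => h z i j).
  have FN : Filter (nbhs (0 : C)) by exact: nbhs_filter.
  by apply: (filter_forall FN) => i; apply: (filter_forall FN) => j; exact: (hc i j).
move=> /nbhs_ballP[e /= /pos_rc[d d0 ->] hd].
have [|Phi Phi0 [e1 e10 dPhi]] := @matrix_ode R n (fun t => h (rc t)) d d0.
  move=> i j t td.
  have tB : ball (0 : C) (rc d) (rc t) by rewrite /ball /= sub0r normrN rc_norm rc_lt.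
  have hB : {for rc t, continuous (fun z => h z i j)} := hd (rc t) tB i j.
  exact: (@continuous_comp _ _ _ (@rc R) (fun z => h z i j) t (@rc_cts R t) hB).
have D0 : mrder Phi 0 (h (rc 0) *m Phi 0) by apply: dPhi; rewrite normr0.
have D1 : mxqder (0 : R)^' (@rc R) Phi 1%:M (h (rc 0) *m Phi 0).
  move: D0; rewrite /mrder Phi0; under eq_fun do rewrite add0r; done.
exists Phi; split.
- exact: near0_right (mxqder_unit (dnbhsR_filter R) (@cvg_rc_dnbhs R) (@near_rc_neq0 R) (unitmx1 C n) D1).
- apply: filterS2 (near_rc_ray hA) (_ : \forall t \near F, 0 < t < e1) => [t hE /andP[t0 te]|].
    rewrite /ray_speed /ray hE; by apply: dPhi; rewrite gtr0_norm.
  by apply/near_at_rightP; exists e1.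
- exists (h (rc 0) *m Phi 0) => i j P /(D1 i j) H; exact: near0_right H.
Qed.
End Fundamental.

(** * Rational solutions and presolutions along the ray *)
(** Proportionality of two columns X and Z is the vanishing of X Z^T - Z X^T, on which
    S acts by congruence. *)
Lemma mulmx_wedge (K : comUnitRingType) n (S : 'M[K]_n) (X Z : 'cV[K]_n) : S \in unitmx ->
  (S *m X) *m (S *m Z)^T = (S *m Z) *m (S *m X)^T <-> X *m Z^T = Z *m X^T.
Proof.
move=> uS; rewrite !trmx_mul !mulmxA -!(mulmxA S); split=> [|->] //.
have uT : S^T \in unitmx by rewrite unitmx_tr.
by move=> H; apply: (can_inj (mulmxK uT)); apply: (can_inj (mulKmx uS)).
Qed.

Lemma wedge0_colinear (K : fieldType) n (X Z : 'cV[K]_n) : Z *m X^T = X *m Z^T -> Z != 0 -> exists c, X = c *: Z.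
Proof.
move=> E /cV0Pn[k Zk]; exists (X k 0 / Z k 0); apply/matrixP => i j; rewrite (ord1 j).
have := congr1 (fun M : 'M_n => M k i) E; rewrite !mxE !big_ord1 !mxE => e.
by rewrite -[LHS](mulKf Zk) e mulrA (mulrC (Z k 0)^-1).
Qed.

Lemma inverse_cancel (K : comUnitRingType) n m (V T B : 'M[K]_n) (y : 'M[K]_(n, m)) a :
  T *m V = 1%:M -> (- (V *m (B *m T) *m V)) *m y + V *m (B *m y - a *: y) = - a *: (V *m y).
Proof.
move=> TV; rewrite mulmxBr mulNmx -!mulmxA (mulmxA T) TV mul1mx addKr.
by rewrite -scalemxAr scaleNr.
Qed.

Local Opaque C.

Section Inverse.
Variables (R : realType) (n : nat).
Local Notation C := (C R).

(** The entries of the inverse are regular functions, hence differentiable; the value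
    of the derivative follows from u u^-1 = 1. *)
Lemma mxqder_inv (T : Type) (F : set_system T) (k : T -> C) (u : T -> 'M[C]_n) s0 M :
  ProperFilter F -> k @ F --> (0 : C) -> (\forall x \near F, k x != 0) ->
  s0 \in unitmx -> mxqder F k u s0 M ->
  mxqder F k (fun x => invmx (u x)) (invmx s0) (- (invmx s0 *m M *m invmx s0)).
Proof.
move=> FF k0 kn us uM; have uu := mxqder_unit FF k0 kn us uM.
have [D DP] : exists D, mxqder F k (fun x => invmx (u x)) (invmx s0) D.
  have H ij : exists d, qder F k (fun x => invmx (u x) ij.1 ij.2) (invmx s0 ij.1 ij.2) d.
    have [f rf fE] := @reg_inv R n ij.1 ij.2.
    have [G fG] := reg_grad us rf.
    have := fG _ _ _ _ _ FF k0 kn uM; rewrite -(fE _ us) => H.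
    exists (ip G M); apply: (qder_eq FF _ H); apply: filterS uu => x ux; exact: (fE _ ux).
  have [d dP] := choice H; exists (\matrix_(i, j) d (i, j)) => i j.
  rewrite [X in qder _ _ _ _ X]mxE; exact: (dP (i, j)).
suff -> : - (invmx s0 *m M *m invmx s0) = D by [].
have H1 := mxqderM FF k0 kn uM DP.
have H2 : mxqder F k (fun x => u x *m invmx (u x)) (s0 *m invmx s0) 0.
  rewrite (mulmxV us); apply: (mxqder_eq FF _ (mxqder_cst FF k (1%:M : 'M[C]_n))).
  apply: filterS uu => x ux; exact: (mulmxV ux).
have E := mxqder_unique FF H1 H2.
have E2 : invmx s0 *m (M *m invmx s0 + s0 *m D) = 0 by rewrite E mulmx0.
rewrite mulmxDr (mulKmx us) mulmxA in E2.
by move/eqP: E2; rewrite addr_eq0 => /eqP ->; rewrite opprK.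
Qed.
End Inverse.

Section MatrixLimits.
Variables (k : numFieldType) (T : Type) (F : set_system T) (FF : Filter F).

Lemma sum_cvg (I : Type) (r : seq I) (f : I -> T -> k) (l : I -> k) :
  (forall i, f i @ F --> l i) -> (fun t => \sum_(i <- r) f i t) @ F --> \sum_(i <- r) l i.
Proof.
move=> H; elim: r => [|i r IH].
  by rewrite big_nil; under eq_fun do rewrite big_nil; exact: cvg_cst.
by rewrite big_cons; under eq_fun do rewrite big_cons; apply: cvgD; [exact: H|exact: IH].
Qed.

Lemma mulmx_cvg p q r (X : T -> 'M[k]_(p, q)) (Y : T -> 'M[k]_(q, r)) (X0 : 'M[k]_(p, q)) (Y0 : 'M[k]_(q, r)) :
  X @ F --> X0 -> Y @ F --> Y0 -> (fun t => X t *m Y t) @ F --> X0 *m Y0.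
Proof.
move=> /(cvg_mxP FF) HX /(cvg_mxP FF) HY; apply/cvg_mxP => i j.
have -> : (fun t => (X t *m Y t) i j) = (fun t => \sum_l X t i l * Y t l j).
  by apply/funext => t; rewrite mxE.
rewrite mxE; apply: sum_cvg => l; apply: cvgM; [exact: HX|exact: HY].
Qed.
End MatrixLimits.

Section VectorDerivative.
Variables (R : realType).
Local Notation C := (C R).

(** The topology of matrices is that of entrywise convergence. *)
Lemma mx_derive1 p q (v : C -> 'M[C]_(p, q)) x (D : 'M[C]_(p, q)) :
  (forall i j, cder (fun x => v x i j) x (D i j)) -> derive1 v x = D.
Proof.
move=> H; apply: cvg_lim; first exact: norm_hausdorff.
apply/cvg_mxP => i j; apply: cvg_trans (H i j).
apply: near_eq_cvg; near=> h; by rewrite !mxE (addrC h).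
Unshelve. all: by end_near. Qed.
End VectorDerivative.

Section Inclusion.
Variable R : realType.
Local Notation C := (C R).
Local Notation CP1 := (CP1 R).
Local Notation F := (at_right (0 : R)).
Local Hint Resolve FF : core.
Variables (U : set CP1) (K : set (C -> C)) (FK : function_field U K).
Variables (x0 : CP1) (Ux0 : U x0).
Local Notation ray := (ray x0).
Local Notation ray_speed := (ray_speed x0).
Local Notation Kr := (ray_germ K x0).

Lemma value_ray m (v : C -> 'cV[C]_m) v0 : value_at x0 v v0 -> (fun t => v (ray t)) @ F --> v0.
Proof. by move=> H P /H HP; exact: near_ray HP. Qed.

Lemma germ_mx_ray p q (v : C -> 'M[C]_(p, q)) : mx_over K v -> germ_mx Kr (fun t => v (ray t)).
Proof. by move=> Kv i j; exists (fun x => v x i j); [exact: Kv|exact: nearW]. Qed.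

Lemma mx_derive1_near p q (v : C -> 'M[C]_(p, q)) y : mx_over K v -> U y ->
  \forall x \near pnbhs y, forall i j, cder (fun x => v x i j) x (derive1 v x i j).
Proof.
move=> Kv Uy; apply/near_pnbhs.
have FN := dnbhsC_filter R.
have H : \forall s \near (0 : C)^', forall i j,
    cder (fun x => v x i j) (loc y s) (derive1 (fun x => v x i j) (loc y s)).
  apply: (filter_forall (dnbhsC_filter R)) => i; apply: (filter_forall (dnbhsC_filter R)) => j.
  exact: (mero_derive1 (ff_meromorphic FK (Kv i j)) Uy).
apply: filterS H => s H.
have E := @mx_derive1 R p q v (loc y s) (\matrix_(i, j) derive1 (fun x => v x i j) (loc y s)).
rewrite E => i j; rewrite mxE; exact: H.
Qed.

Lemma mx_ray_der p q (v : C -> 'M[C]_(p, q)) : mx_over K v ->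
  \forall t \near F, mrder (fun t => v (ray t)) t (ray_speed t *: derive1 v (ray t)).
Proof.
move=> Kv; have H1 := near_ray (mx_derive1_near Kv Ux0).
have H2 : \forall t \near F, forall i j,
    rder (fun t => v (ray t) i j) t (ray_speed t * derive1 (fun x => v x i j) (ray t)).
  apply: (filter_forall (FF R)) => i; apply: (filter_forall (FF R)) => j.
  exact: (K_ray_der FK Ux0 (Kv i j)).
apply: filterS2 H1 H2 => t H1 H2 i j.
have := H2 i j; rewrite (cder_derive1 (H1 i j)) /rder => H.
by rewrite [X in qder _ _ _ _ X]mxE.
Qed.

Variables (n : nat) (A : C -> 'M[C]_n) (Phi : R -> 'M[C]_n).
Hypothesis Phiu : \forall t \near F, Phi t \in unitmx.
Hypothesis dPhi : \forall t \near F, mrder Phi t (ray_speed t *: A (ray t) *m Phi t).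
Variable M : 'M[C]_n.
Hypothesis Phi1 : mxqder F (@rc R) Phi 1%:M M.

Variables (m : nat) (Psi : 'M[C]_n -> 'M[C]_m) (PR : algebraic_rep Psi).

Lemma cvg_rc_right : (@rc R) @ F --> (0 : C).
Proof. by move=> P /(@cvg_rc_dnbhs R) H; exact: near0_right H. Qed.
Lemma near_rc_right_neq0 : \forall t \near F, rc t != 0.
Proof. exact: near0_right (@near_rc_neq0 R). Qed.

Lemma Psi_inv_cvg : (fun t => invmx (Psi (Phi t))) @ F --> (1%:M : 'M[C]_m).
Proof.
have P1 : mxqder F (@rc R) Phi 1%:M (M *m 1%:M) by rewrite mulmx1.
have H := rep_qder_at PR (FF R) cvg_rc_right near_rc_right_neq0 (unitmx1 C n) P1.
rewrite (rep_one PR) in H.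
have H2 := mxqder_inv (FF R) cvg_rc_right near_rc_right_neq0 (unitmx1 C m) H.
have H3 := mxqder_cvg (FF R) cvg_rc_right near_rc_right_neq0 H2.
by rewrite invmx1 in H3.
Qed.

Section Presolution.
Variables (v : C -> 'cV[C]_m) (b : C -> C).
Hypothesis Kv : mx_over K v.
Hypothesis dv : generically U (fun x => derive1 v x - rep_diff Psi (A x) *m v x = - b x *: v x).

(** The solution read in the frame given by the fundamental matrix (variation of
    constants). *)
Definition pull t := invmx (Psi (Phi t)) *m v (ray t).

(** In the moving frame the system disappears, and only the scalar factor of the
    presolution remains. *)
Lemma pull_der : \forall t \near F, mrder pull t (- (ray_speed t * b (ray t)) *: pull t).
Proof.
have D1 := rep_der Phiu dPhi PR.
have E : \forall t \near F, derive1 v (ray t) - rep_diff Psi (A (ray t)) *m v (ray t) = - b (ray t) *: v (ray t).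
  exact: (near_ray (dv Ux0)).
have U1 : \forall t \near F, Psi (Phi t) \in unitmx by apply: filterS Phiu => t; exact: (rep_unitmx PR).
apply: filterS2 (filterI D1 U1) (filterI E (mx_ray_der Kv)) => t [d1 u1] [e d2].
have I1 : mrder (fun t => invmx (Psi (Phi t))) t _ := mxqder_inv (dnbhsR_filter R) (@cvg_rc_dnbhs R) (@near_rc_neq0 R) u1 d1.
have := mrderM I1 d2.
have -> : derive1 v (ray t) = rep_diff Psi (A (ray t)) *m v (ray t) - b (ray t) *: v (ray t).
  by rewrite -scaleNr -e addrC subrK.
rewrite scalerBr scalemxAl scalerA (inverse_cancel _ _ _ (mulmxV u1)); exact.
Qed.

Lemma pull_cvg v0 : value_at x0 v v0 -> pull @ F --> v0.
Proof.
move=> /value_ray H; have P1 := Psi_inv_cvg.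
by have := mulmx_cvg (FF R) P1 H; rewrite mul1mx.
Qed.

Lemma pull_back : \forall t \near F, v (ray t) = Psi (Phi t) *m pull t.
Proof.
apply: filterS Phiu => t /(rep_unitmx PR) ut; by rewrite /pull (mulKVmx ut).
Qed.

End Presolution.

(** An affine relation over the field between the entries of Psi(Phi) w0 is a member
    of the ideal of the fundamental matrix, so it is preserved by the stabilizer. *)
Lemma ideal_galois_relation (a : 'I_m -> R -> C) (c0 : R -> C) s (w0 : 'cV[C]_m) : (forall j, Kr (a j)) -> Kr c0 -> ideal_galois Kr Phi s ->
  (\forall t \near F, c0 t + \sum_j a j t * (Psi (Phi t) *m w0) j 0 = 0) ->
  \forall t \near F, c0 t + \sum_j a j t * (Psi (Phi t *m s) *m w0) j 0 = 0.
Proof.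
move=> Ka Kc [us gs] H.
have KF := ray_germ_field FK Ux0.
apply: (gs (fun t Y => c0 t + \sum_j a j t * (Psi Y *m w0) j 0)); split => //.
have Kp j : Kreg Kr (fun (_ : R) (Y : 'M[C]_n) => (Psi Y *m w0) j 0).
  have E : Kreg Kr (fun (_ : R) (Y : 'M[C]_n) => \sum_k Psi Y j k * w0 k 0).
    apply: (Kreg_sum KF) => k.
    exact: (Kreg_mul KF (Kreg_reg KF (rep_regular PR j k)) (@Kreg_coef R n Kr KF (fun=> w0 k 0) (gf_cst KF (w0 k 0)))).
  apply: (Kreg_ext _ E) => t Y _; by rewrite mxE.
have Ks : Kreg Kr (fun (t : R) (Y : 'M[C]_n) => \sum_j a j t * (Psi Y *m w0) j 0).
  by apply: (Kreg_sum KF) => j; exact: (Kreg_mul KF (@Kreg_coef R n Kr KF (a j) (Ka j)) (Kp j)).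
exact: (Kreg_add KF (@Kreg_coef R n Kr KF c0 Kc) Ks).
Qed.
End Inclusion.

Local Transparent C.

(** * The stabilizer of the relations is contained in the Galois group *)
Lemma sum_delta (K : pzRingType) m (c : K) (k : 'I_m) (X : 'I_m -> K) :
  \sum_j (if j == k then c else 0) * X j = c * X k.
Proof.
by rewrite (bigD1 k) //= eqxx big1 ?addr0 // => j /negbTE ->; rewrite mul0r.
Qed.

Lemma mul_cross (K : comPzRingType) (a c d y z : K) : c * (a * y) - d * (a * z) = a * (c * y - d * z).
Proof. by rewrite mulrBr !(mulrCA a). Qed.

Lemma mul_swap (K : comPzRingType) (a b c d : K) : a * b = c * d -> b * a = d * c.
Proof. by rewrite (mulrC b) (mulrC d). Qed.

Lemma outer_mxE (K : pzSemiRingType) n p (X : 'cV[K]_n) (Y : 'cV[K]_p) i j :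
  (X *m Y^T) i j = X i 0 * Y j 0.
Proof. by rewrite mxE big_ord1 mxE. Qed.

Lemma cross0 (K : comPzRingType) (a b c d : K) : a * b = c * d -> a * b - d * c = 0.
Proof. by move=> ->; rewrite mulrC subrr. Qed.

Section Generic.
Variables (R : realType) (U : set (CP1 R)).
Implicit Types P Q T : C R -> Prop.

Lemma generically_sub P Q : (forall x, P x -> Q x) -> generically U P -> generically U Q.
Proof.
move=> PQ H p Up; have FP := pnbhs_proper p.
exact: (@filterS _ _ FP _ _ PQ (H p Up)).
Qed.

Lemma generically_and P Q : generically U P -> generically U Q -> generically U (fun x => P x /\ Q x).
Proof. move=> H1 H2 p Up; have FP := pnbhs_proper p; exact: (filterI (H1 p Up) (H2 p Up)). Qed.

Lemma generically_all (I : finType) (P : I -> C R -> Prop) : (forall i, generically U (P i)) ->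
  generically U (fun x => forall i, P i x).
Proof. move=> H p Up; have FP := pnbhs_proper p; apply: (filter_forall FP) => i; exact: (H i p Up). Qed.
End Generic.

Local Opaque C.

Section Inclusion.
Variable R : realType.
Local Notation C := (C R).
Local Notation CP1 := (CP1 R).
Local Notation F := (at_right (0 : R)).
Local Hint Resolve FF : core.
Variables (U : set CP1) (K : set (C -> C)) (FK : function_field U K).
Variables (x0 : CP1) (Ux0 : U x0).
Local Notation ray := (ray x0).
Local Notation ray_speed := (ray_speed x0).
Local Notation Kr := (ray_germ K x0).
Variables (n : nat) (A : C -> 'M[C]_n) (Phi : R -> 'M[C]_n).
Hypothesis Phiu : \forall t \near F, Phi t \in unitmx.
Hypothesis dPhi : \forall t \near F, mrder Phi t (ray_speed t *: A (ray t) *m Phi t).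
Variable M : 'M[C]_n.
Hypothesis Phi1 : mxqder F (@rc R) Phi 1%:M M.
Variables (m : nat) (Psi : 'M[C]_n -> 'M[C]_m) (PR : algebraic_rep Psi).

Lemma rep_Phi_unit : \forall t \near F, Psi (Phi t) \in unitmx.
Proof. by apply: filterS Phiu => t; exact: (rep_unitmx PR). Qed.

Lemma ideal_galois_split s (X : 'cV[C]_m) : ideal_galois Kr Phi s -> \forall t \near F, Psi (Phi t *m s) *m X = Psi (Phi t) *m (Psi s *m X).
Proof.
move=> [us _]; apply: filterS Phiu => t ut; by rewrite (rep_mul PR ut us) mulmxA.
Qed.

(** With b = 0 the pull back of v is constant, equal to its limit v0, so that v =
    Psi(Phi) v0.  These relations are preserved by s, which gives Psi(Phi) Psi(s) v0
    = v as well. *)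
Lemma ideal_galois_rational s (v : C -> 'cV[C]_m) v0 : ideal_galois Kr Phi s ->
  rational_solution U K A Psi v -> value_at x0 v v0 -> Psi s *m v0 = v0.
Proof.
move=> gs [Kv dv] vv0.
have dv' : generically U (fun x => derive1 v x - rep_diff Psi (A x) *m v x = - 0 *: v x).
  apply: (generically_sub _ dv) => x ->; by rewrite subrr oppr0 scale0r.
have [e e0 De] := proj1 (near_at_rightP _) (pull_der FK Ux0 Phiu dPhi PR Kv (b := fun=> 0) dv').
pose t1 := e / 2; have t1e : 0 < t1 < e by rewrite /t1; apply/andP; split; lra.
have cst t : 0 < t < e -> pull x0 Phi Psi v t = pull x0 Phi Psi v t1.
  move=> te; apply/matrixP => i j.
  apply: (@rder0_cst R (fun t => pull x0 Phi Psi v t i j) 0 e) => // x xe.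
  have := De x xe i j; by rewrite mulr0 oppr0 scale0r /rder [X in qder _ _ _ _ X]mxE.
have E : v0 = pull x0 Phi Psi v t1.
  apply: (@cvg_unique _ _ (pull x0 Phi Psi v @ F)).
  - exact: norm_hausdorff.
  - exact: (pull_cvg Phi1 PR vv0).
  - apply: cvg_near_cst; apply/near_at_rightP; exists e => //.
have rel (i : 'I_m) : \forall t \near F, v (ray t) i 0 + \sum_j (if j == i then -1 else 0) * (Psi (Phi t *m s) *m v0) j 0 = 0.
  have Ka j : Kr (fun _ => if j == i then -1 else 0) by exact: (gf_cst (ray_germ_field FK Ux0)).
  apply: (ideal_galois_relation FK Ux0 PR Ka (germ_mx_ray x0 Kv i 0) gs).
  apply: filterS2 (pull_back x0 Phiu PR v) (_ : \forall t \near F, 0 < t < e) => [t vt te|].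
    by rewrite sum_delta mulN1r {1}vt (cst t te) -E subrr.
  by apply/near_at_rightP; exists e.
have rel' := filter_forall (FF R) rel.
have [t [[e1 e2] [ut [vt te]]]] := filter_ex (filterI (filterI rel' (ideal_galois_split v0 gs))
  (filterI rep_Phi_unit (filterI (pull_back x0 Phiu PR v) (proj2 (near_at_rightP (fun t => 0 < t < e)) (ex_intro2 _ _ e e0 (fun t h => h)))))).
apply: (can_inj (mulKmx ut)).
have vt' : v (ray t) = Psi (Phi t) *m v0 by rewrite {1}vt (cst t te) -E.
rewrite -e2 -vt'; apply/matrixP => i j; rewrite (ord1 j).
by have /eqP := e1 i; rewrite sum_delta mulN1r subr_eq0 => /eqP ->.
Qed.

(** All components of the pull back satisfy the same scalar equation, so the ratio of
    two of them is constant; letting one of the two arguments tend to 0 gives the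
    direction. *)
Lemma pull_direction (v : C -> 'cV[C]_m) (b : C -> C) v0 : mx_over K v -> K b ->
  generically U (fun x => derive1 v x - rep_diff Psi (A x) *m v x = - b x *: v x) ->
  value_at x0 v v0 ->
  \forall t \near F, pull x0 Phi Psi v t *m v0^T = v0 *m (pull x0 Phi Psi v t)^T.
Proof.
move=> Kv Kb dv vv0; set u := pull x0 Phi Psi v.
have bc : \forall t \near F, continuous_at t (fun t => b (ray t)).
  have Kbr : Kr (fun t => b (ray t)) by exists b => //; exact: nearW.
  exact: (germ_cts (ray_germ_der FK Ux0) Kbr).
have [e e0 H] := proj1 (near_at_rightP _) (filterI (pull_der FK Ux0 Phiu dPhi PR Kv dv) (filterI bc (ray_speed_cts x0))).
apply/near_at_rightP; exists e => // t te.
have par t' : 0 < t' < e -> forall i j, u t i 0 * u t' j 0 = u t j 0 * u t' i 0.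
  move=> te' i j; pose z (_ : 'I_1) (t : R) : C := u t' j 0 * u t i 0 - u t' i 0 * u t j 0.
  pose mm (_ _ : 'I_1) (t : R) : C := - (ray_speed t * b (ray t)).
  have dz (o : 'I_1) x : 0 < x < e -> rder (z o) x (\sum_o' mm o o' x * z o' x).
    move=> xe; have [D _] := H x xe.
    have d l : rder (fun t => u t l 0) x (- (ray_speed x * b (ray x)) * u x l 0).
      by have := D l 0; rewrite [X in qder _ _ _ _ X]mxE.
    rewrite big_ord1 /z -mul_cross /rder.
    exact: (qderB (dnbhsR_filter R) (qderZ (dnbhsR_filter R) (@cvg_rc_dnbhs R) (@near_rc_neq0 R) (c := u t' j 0) (d i))
       (qderZ (dnbhsR_filter R) (@cvg_rc_dnbhs R) (@near_rc_neq0 R) (c := u t' i 0) (d j))).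
  have cm (o o' : 'I_1) x : 0 < x < e -> continuous_at x (mm o o').
    move=> xe; have [_ [cb cw]] := H x xe.
    exact: (cvgN (cvgM cw cb)).
  have z0 (o : 'I_1) : z o t' = 0 by rewrite /z mulrC subrr.
  have /eqP := system_unique dz cm te te' z0 ord0; rewrite /z subr_eq0 => /eqP E.
  exact: (mul_swap E).
have uc := pull_cvg Phi1 PR vv0.
have uc' i : (fun t => u t i 0) @ F --> v0 i 0 := proj1 (cvg_mxP (FF R) _ _) uc i 0.
apply/matrixP => i j; rewrite !outer_mxE.
have L : (fun t' => u t i 0 * u t' j 0) @ F --> u t i 0 * v0 j 0 by apply: cvgM; [exact: cvg_cst|exact: uc'].
have L' : (fun t' => u t j 0 * u t' i 0) @ F --> u t j 0 * v0 i 0 by apply: cvgM; [exact: cvg_cst|exact: uc'].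
have L2 : (fun t' => u t i 0 * u t' j 0) @ F --> u t j 0 * v0 i 0.
  apply: cvg_trans L'; apply: near_eq_cvg; apply/near_at_rightP; exists e => // t' te'; by rewrite (par t' te' i j).
rewrite [RHS]mulrC; apply: (@cvg_unique _ _ ((fun t' => u t i 0 * u t' j 0) @ F)).
- exact: norm_hausdorff.
- exact: L.
- exact: L2.
Qed.

(** The vectors v and Psi(Phi) v0 are parallel.  The products that express it are
    relations over the field; s preserves them, so v is parallel to Psi(Phi) Psi(s)
    v0 too, and the limit at the base point gives the claim. *)
Lemma ideal_galois_presolution s (v : C -> 'cV[C]_m) v0 : ideal_galois Kr Phi s ->
  exponential_presolution U K A Psi v -> value_at x0 v v0 -> exists c, Psi s *m v0 = c *: v0.
Proof.
move=> gs [Kv [b Kb dv]] vv0.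
have [->|v00] := eqVneq v0 0; first by exists 0; rewrite mulmx0 scaler0.
have dir := pull_direction Kv Kb dv vv0.
pose X t := Psi (Phi t *m s) *m v0.
pose a (p q : 'I_m) j t : C := if j == q then v (ray t) p 0 else 0.
have rel (pq : 'I_m * 'I_m) : \forall t \near F, 0 + \sum_j (a pq.1 pq.2 j t - a pq.2 pq.1 j t) * (Psi (Phi t *m s) *m v0) j 0 = 0.
  have KF := ray_germ_field FK Ux0.
  have Ka p q j : Kr (a p q j).
    rewrite /a; case: (j == q); [exact: (germ_mx_ray x0 Kv p 0)|exact: (gf_cst KF)].
  have Kaa j : Kr (fun t => a pq.1 pq.2 j t - a pq.2 pq.1 j t) := gf_sub (FF R) KF (Ka _ _ j) (Ka _ _ j).
  apply: (ideal_galois_relation FK Ux0 PR Kaa (gf_cst KF 0) gs).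
  apply: filterS2 (pull_back x0 Phiu PR v) (filterI dir rep_Phi_unit) => t vt [dt ut].
  rewrite add0r; under eq_bigr do rewrite mulrBl.
  rewrite sumrB /a !sum_delta vt.
  have := congr1 (fun N : 'M_m => N pq.1 pq.2) (proj2 (mulmx_wedge (pull x0 Phi Psi v t) v0 ut) dt).
  rewrite /= !outer_mxE; exact: cross0.
have rel' := filter_forall (FF R) rel.
have par : \forall t \near F, forall i j, pull x0 Phi Psi v t i 0 * (Psi s *m v0) j 0 = (Psi s *m v0) i 0 * pull x0 Phi Psi v t j 0.
  apply: filterS2 (filterI rel' (ideal_galois_split v0 gs)) (filterI rep_Phi_unit (pull_back x0 Phiu PR v)) => t [e1 e2] [ut vt] i j.
  rewrite -!outer_mxE; apply: (congr1 (fun N : 'M_m => N i j)).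
  apply: (proj1 (mulmx_wedge _ _ ut)); apply/matrixP => p q; rewrite -e2 -vt !outer_mxE.
  have := e1 (p, q); rewrite add0r; under eq_bigr do rewrite mulrBl.
  rewrite sumrB /a !sum_delta => /eqP; rewrite subr_eq0 => /eqP ->; exact: mulrC.
apply: wedge0_colinear v00.
have uc' i : (fun t => pull x0 Phi Psi v t i 0) @ F --> v0 i 0 := proj1 (cvg_mxP (FF R) _ _) (pull_cvg Phi1 PR vv0) i 0.
apply/matrixP => i j; rewrite !outer_mxE.
have L : (fun t => pull x0 Phi Psi v t i 0 * (Psi s *m v0) j 0) @ F --> v0 i 0 * (Psi s *m v0) j 0 by apply: cvgM; [exact: uc'|exact: cvg_cst].
have L' : (fun t => (Psi s *m v0) i 0 * pull x0 Phi Psi v t j 0) @ F --> (Psi s *m v0) i 0 * v0 j 0 by apply: cvgM; [exact: cvg_cst|exact: uc'].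
apply: (@cvg_unique _ _ ((fun t => pull x0 Phi Psi v t i 0 * (Psi s *m v0) j 0) @ F)).
- exact: norm_hausdorff.
- exact: L.
- apply: cvg_trans L'; apply: near_eq_cvg; apply: filterS par => t ->; by [].
Qed.
End Inclusion.

Lemma ideal_galois_sub_Gal (R : realType) (U : set (CP1 R)) (K : set (C R -> C R)) (FK : function_field U K)
    (x0 : CP1 R) (Ux0 : U x0) n (A : C R -> 'M[C R]_n) (Phi : R -> 'M[C R]_n) M :
  (\forall t \near (0 : R)^'+, Phi t \in unitmx) ->
  (\forall t \near (0 : R)^'+, mrder Phi t (ray_speed x0 t *: A (ray x0 t) *m Phi t)) ->
  mxqder (0 : R)^'+ (@rc R) Phi 1%:M M ->
  forall s, ideal_galois (ray_germ K x0) Phi s -> Gal U K A x0 s.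
Proof.
move=> Phiu dPhi Phi1 s gs; split; first exact: (proj1 gs).
move=> m Psi PR; split => v v0 vS vv0.
  exact: (ideal_galois_rational FK Ux0 Phiu dPhi Phi1 PR gs vS vv0).
exact: (ideal_galois_presolution FK Ux0 Phiu dPhi Phi1 PR gs vS vv0).
Qed.

Local Transparent C.

(** * From block-diagonal Galois matrices to a decomposer symmetry *)
Lemma mulmx_cV0 (K : nzRingType) m n (M : 'M[K]_(m, n)) : (forall y : 'cV_n, M *m y = 0) -> M = 0.
Proof.
by move=> H; apply/matrixP => i j; have /matrixP/(_ i 0) := H (delta_mx j 0); rewrite -colE !mxE.
Qed.

Section LieBracket.
Variables (R : realType) (n : nat).
Local Notation C := (C R).

Lemma vfield_derive (f : vfield R n) q w (d : 'cV[C]_n) : (forall h : C, (f (h *: w + q)).1 = (f q).1) ->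
  mxqder (0 : C)^' id (fun h => (f (h *: w + q)).2) (f q).2 d -> 'D_w f q = (0, d).
Proof.
move=> f1 f2; apply: cvg_lim; first exact: norm_hausdorff.
have c1 : (fun=> 0 : C) @ (0 : C)^' --> (0 : C) by exact: cvg_cst.
have c2 : (fun h => h^-1 *: ((f (h *: w + q)).2 - (f q).2)) @ (0 : C)^' --> d.
  apply/cvg_mxP => i j; apply: cvg_trans (f2 i j); apply: near_eq_cvg; near=> h.
  by rewrite !mxE.
apply: cvg_trans (cvg_pair c1 c2); apply: near_eq_cvg; near=> h.
rewrite /= [f (h *: w + q)]surjective_pairing [f q]surjective_pairing f1.
rewrite [RHS]surjective_pairing; congr pair; by rewrite /= subrr scaler0.
Unshelve. all: by end_near. Qed.

(** The field of the system has constant component 1 along x and the linear field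
    component 0, so only the former sees the dependence of [B] on x, and [A] is
    differentiated along the fibre alone. *)
Lemma lie_bracketE (A B : C -> 'M[C]_n) x (D : 'M[C]_n) (y : 'cV[C]_n) :
  (forall i j, cder (fun x => B x i j) x (D i j)) ->
  lie_bracket (system_vfield A) (linear_vfield B) (x, y) = (0, (D + B x *m A x - A x *m B x) *m y).
Proof.
move=> dB.
have line (z : 'cV[C]_n) : mxqder (0 : C)^' id (fun h => h *: z + y) y z.
  move=> i j; rewrite /qder; have H : (fun=> z i j) @ (0 : C)^' --> z i j by exact: cvg_cst.
  apply: (cvg_trans _ H); apply: near_eq_cvg; near=> h.
  have h0 : h != 0 by near: h; exact: near_dnbhsC_neq0.
  by rewrite !mxE addrK mulKf.
have dB' : mxqder (0 : C)^' id (fun h => B (h *: (1 : C) + x)) (B x) D.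
  move=> i j; apply: (qder_eq (dnbhsC_filter R) _ (dB i j)); near=> h.
  by rewrite /GRing.scale /= mulr1 addrC.
rewrite /lie_bracket.
rewrite (vfield_derive (f := linear_vfield B) (d := D *m y + B x *m (A x *m y))) //; last first.
  exact: (mxqderM (dnbhsC_filter R) (@cvg_id_dnbhsC R) (@near_dnbhsC_neq0 R) dB' (line (A x *m y))).
rewrite (vfield_derive (f := system_vfield A) (d := A x *m (B x *m y))) //; last first.
  have := mxqderM (dnbhsC_filter R) (@cvg_id_dnbhsC R) (@near_dnbhsC_neq0 R) (mxqder_cst (dnbhsC_filter R) id (A x)) (line (B x *m y)).
  rewrite mul0mx add0r => H i j; apply: (qder_eq (dnbhsC_filter R) _ (H i j)); near=> h.
  by rewrite /= scaler0 add0r.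
rewrite mulmxBl mulmxDl -!mulmxA; congr pair; by rewrite /= subrr.
Unshelve. all: by end_near. Qed.
End LieBracket.

Section Descend.
Variable R : realType.
Local Notation C := (C R).
Local Notation CP1 := (CP1 R).
Local Notation F := (at_right (0 : R)).
Local Hint Resolve FF : core.
Variables (U : set CP1) (K : set (C -> C)) (FK : function_field U K).

Lemma generic_point (x0 : CP1) (P : C -> Prop) : U x0 -> generically U P -> exists x, P x.
Proof. by move=> Ux0 /(_ x0 Ux0) H; have FP := pnbhs_proper x0; exact: filter_ex H. Qed.

Variables (n : nat).

Lemma sym1_ode (A B : C -> 'M[C]_n) : sym1 U K A B <->
  mx_over K B /\ generically U (fun x => derive1 B x = A x *m B x - B x *m A x).
Proof.
split=> -[KB H]; split=> // p Up; have FP := pnbhs_proper p.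
  apply: filterS2 (H p Up) (mx_derive1_near FK KB Up) => x /= br dB.
  have : derive1 B x + B x *m A x - A x *m B x = 0.
    by apply: mulmx_cV0 => y; have := br y; rewrite (lie_bracketE A y dB) => -[].
  by move=> /eqP; rewrite subr_eq0 => /eqP <-; rewrite addrK.
apply: filterS2 (H p Up) (mx_derive1_near FK KB Up) => x /= ode dB y.
by rewrite (lie_bracketE A y dB) ode subrK subrr mul0mx.
Qed.

Lemma K_sum (I : Type) (s : seq I) (f : I -> C -> C) : (forall i, K (f i)) -> K (fun x => \sum_(i <- s) f i x).
Proof.
move=> Kf; elim: s => [|i s IH].
  by under eq_fun do rewrite big_nil; exact: (ff_cst FK).
by under eq_fun do rewrite big_cons; exact: (ff_add FK).
Qed.

Lemma K_prod (I : Type) (s : seq I) (f : I -> C -> C) : (forall i, K (f i)) -> K (fun x => \prod_(i <- s) f i x).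
Proof.
move=> Kf; elim: s => [|i s IH].
  by under eq_fun do rewrite big_nil; exact: (ff_cst FK).
by under eq_fun do rewrite big_cons; exact: (ff_mul FK).
Qed.

Lemma K_det (B : C -> 'M[C]_n) : mx_over K B -> K (fun x => \det (B x)).
Proof.
move=> KB; apply: K_sum => s; apply: (ff_mul FK (ff_cst FK _)).
by apply: K_prod => i; exact: KB.
Qed.

Lemma mx_over_mul (A B : C -> 'M[C]_n) : mx_over K A -> mx_over K B -> mx_over K (fun x => A x *m B x).
Proof.
move=> KA KB i j; have -> : (fun x => (A x *m B x) i j) = (fun x => \sum_l A x i l * B x l j).
  by apply/funext => x; rewrite mxE.
by apply: K_sum => l; exact: (ff_mul FK (KA i l) (KB l j)).
Qed.

Lemma mx_over_sub (A B : C -> 'M[C]_n) : mx_over K A -> mx_over K B -> mx_over K (fun x => A x - B x).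
Proof.
move=> KA KB i j; have -> : (fun x => (A x - B x) i j) = (fun x => A x i j + - B x i j).
  by apply/funext => x; rewrite sub_mxE.
exact: (ff_add FK (KA i j) (ff_opp FK (KB i j))).
Qed.

Hypothesis U_connected : connected U.
Variables (x0 : CP1) (Ux0 : U x0).
Local Notation ray := (ray x0).
Local Notation ray_speed := (ray_speed x0).

(** The second case of the dichotomy at [x0] is excluded by the ray. *)
Lemma K_ray_zero f : K f -> (\forall t \near F, f (ray t) = 0) -> generically U (fun x => f x = 0).
Proof.
move=> Kf f0; have [H|H] := K_dichotomy FK Kf Ux0.
  exact: (K_identity FK U_connected Kf Ux0 H).
have [t [e ne]] := @filter_ex _ F (FF R) _ (filterI f0 (near_ray H)); by rewrite e eqxx in ne.
Qed.

Lemma spectrum_of_char (B : C -> 'M[C]_n) k (l : 'I_k -> C) (r : 'I_k -> nat) :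
  injective l -> (forall i, (0 < r i)%N) ->
  generically U (fun x => char_poly (B x) = spec_poly l r) -> has_spectrum U B r.
Proof.
move=> linj r0 H; exists l; split=> //.
- move=> c; split=> [He|[i ->]].
    have [x [Hx]] := generic_point Ux0 (generically_and H He).
    by rewrite eigenvalue_root_char Hx => /root_spec.
  apply: (generically_sub _ H) => x Hx; rewrite eigenvalue_root_char Hx.
  by rewrite -dvdp_XsubCl XsubC_dvd ?monic_neq0 ?spec_monic // mup_spec.
- by move=> i; apply: (generically_sub _ H) => x ->; exact: mup_spec.
Qed.

Lemma mrder_inv (S : R -> 'M[C]_n) t D : S t \in unitmx -> mrder S t D ->
  mrder (fun x => invmx (S x)) t (- (invmx (S t) *m D *m invmx (S t))).
Proof. exact: (mxqder_inv (dnbhsR_filter R) (@cvg_rc_dnbhs R) (@near_rc_neq0 R)). Qed.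

Lemma mrderB p q (S V : R -> 'M[C]_(p, q)) t D E : mrder S t D -> mrder V t E ->
  mrder (fun x => S x - V x) t (D - E).
Proof.
move=> SD VE i j; rewrite !sub_mxE; apply: (qder_eq (dnbhsR_filter R) _ (qderB (dnbhsR_filter R) (SD i j) (VE i j))).
apply: nearW => h; by rewrite sub_mxE.
Qed.

Lemma lax_mxE (w : C) (A Phi M0 : 'M[C]_n) : Phi \in unitmx ->
  (w *: A *m Phi *m M0) *m invmx Phi + (Phi *m M0) *m (- (invmx Phi *m (w *: A *m Phi) *m invmx Phi)) =
  w *: (A *m (Phi *m M0 *m invmx Phi) - (Phi *m M0 *m invmx Phi) *m A).
Proof.
move=> uPhi; rewrite mulmxN scalerBr -!scalemxAl -!scalemxAr -!scalemxAl -!scalemxAr !mulmxA.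
by rewrite (mulmxK uPhi).
Qed.

(** On the ray the equation holds for Phi M0 Phi^-1; both sides have entries in the
    field, so it spreads to U. *)
Lemma lax_generic (A B : C -> 'M[C]_n) (Phi : R -> 'M[C]_n) (M0 : 'M[C]_n) : mx_over K A -> mx_over K B ->
  (\forall t \near F, Phi t \in unitmx) ->
  (\forall t \near F, mrder Phi t (ray_speed t *: A (ray t) *m Phi t)) ->
  (\forall t \near F, B (ray t) = Phi t *m M0 *m invmx (Phi t)) ->
  generically U (fun x => derive1 B x = A x *m B x - B x *m A x).
Proof.
move=> KA KB uPhi dPhi BE.
have [e e0 He] := proj1 (near_at_rightP _) BE.
have ray_ode : \forall t \near F, derive1 B (ray t) = A (ray t) *m B (ray t) - B (ray t) *m A (ray t).
  apply: filterS2 (filterI uPhi dPhi) (filterI (filterI (mx_ray_der FK Ux0 KB) (ray_speed_neq0 x0))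
    (proj2 (near_at_rightP (fun t => 0 < t < e)) (ex_intro2 _ _ e e0 (fun t h => h)))) => t [ut dt] [[db w0] te].
  have D1 := mrderM (mrderM dt (mrder_cst M0 t)) (mrder_inv ut dt).
  rewrite mulmx_add0 (lax_mxE _ _ _ ut) -(He t te) in D1.
  have D2 : mrder (fun x => B (ray x) - Phi x *m M0 *m invmx (Phi x)) t
     (ray_speed t *: derive1 B (ray t) - ray_speed t *: (A (ray t) *m B (ray t) - B (ray t) *m A (ray t))).
    exact: mrderB db D1.
  have S0 x : 0 < x < e -> B (ray x) - Phi x *m M0 *m invmx (Phi x) = 0 by move=> xe; rewrite (He x xe) subrr.
  have /eqP := mrder_near0 S0 te D2.
  by rewrite -scalerBr scaler_eq0 (negbTE w0) subr_eq0 => /eqP.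
have KG : forall ij : 'I_n * 'I_n, K (fun x => derive1 (fun x => B x ij.1 ij.2) x + - (A x *m B x - B x *m A x) ij.1 ij.2).
  move=> ij; apply: (ff_add FK (ff_derive FK (KB ij.1 ij.2))); apply: (ff_opp FK).
  exact: (mx_over_sub (mx_over_mul KA KB) (mx_over_mul KB KA)).
have dB p (Up : U p) := mx_derive1_near FK KB Up.
have Z : generically U (fun x => forall ij : 'I_n * 'I_n,
    derive1 (fun x => B x ij.1 ij.2) x + - (A x *m B x - B x *m A x) ij.1 ij.2 = 0).
  apply: generically_all => ij; apply: (K_ray_zero (KG ij)).
  apply: filterS2 ray_ode (near_ray (dB x0 Ux0)) => t E d.
  by rewrite (cder_derive1 (d ij.1 ij.2)) E subrr.
apply: (generically_sub _ (generically_and Z dB)) => x [z d]; apply/matrixP => i j.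
by have /eqP := z (i, j); rewrite (cder_derive1 (d i j)) subr_eq0 => /eqP.
Qed.

Lemma char_generic (B : C -> 'M[C]_n) (p : {poly C}) : mx_over K B -> size p = n.+1 ->
  (\forall t \near F, forall c, \det (c%:M - B (ray t)) = p.[c]) ->
  generically U (fun x => char_poly (B x) = p).
Proof.
move=> KB sp H.
have Z : generically U (fun x => forall i : 'I_n.+1, \det ((i%:R)%:M - B x) + - p.[i%:R] = 0).
  apply: generically_all => i; apply: K_ray_zero.
    apply: (ff_add FK _ (ff_cst FK _)); apply: K_det; apply: mx_over_sub => // a b; exact: (ff_cst FK).
  by apply: filterS H => t H; rewrite H subrr.
apply: (generically_sub _ Z) => x z; apply: char_poly_interp => // i.
by have /eqP := z i; rewrite subr_eq0 => /eqP.
Qed.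

(** The eigenvalues are arbitrary distinct numbers, here 0, 1, ..., k - 1. *)
Theorem block_diagonal_decomposer (A : C -> 'M[C]_n) k (r : 'I_k -> nat) (rn : (\sum_i r i)%N = n) :
  mx_over K A -> nonsingular A x0 -> (forall i, (0 < r i)%N) ->
  conjugated_to_block_diag rn (Gal U K A x0) ->
  exists B : C -> 'M[C]_n, sym1 U K A B /\ has_spectrum U B r.
Proof.
move=> KA ns r0 [P uP HP].
have [Phi [uPhi dPhi [M1 Phi1]]] := fundamental_matrix ns.
pose l (i : 'I_k) : C := i%:R.
have linj : injective l by move=> i j /eqP; rewrite eqr_nat => /eqP; exact: val_inj.
have [M0 cM0 comM0] := block_commutant l rn uP.
have kM : germ_mx (ray_germ K x0) (fun t => Phi t *m M0 *m invmx (Phi t)).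
  apply: (descent (ray_germ_field FK Ux0) (ray_speed_neq0 x0) (ray_speed_cts x0) (ray_germ_der FK Ux0) (germ_mx_ray x0 KA) uPhi dPhi).
  move=> s /(ideal_galois_sub_Gal FK Ux0 uPhi dPhi Phi1)/HP[D [_ DE]]; exact: comM0 DE.
have /choice[f fP] (ij : 'I_n * 'I_n) : exists f, K f /\
    \forall t \near F, (Phi t *m M0 *m invmx (Phi t)) ij.1 ij.2 = f (ray t).
  by have [f Kf E] := kM ij.1 ij.2; exists f.
pose B x : 'M[C]_n := \matrix_(i, j) f (i, j) x.
have KB : mx_over K B.
  move=> i j; have -> : (fun x => B x i j) = f (i, j) by apply/funext => x; rewrite mxE.
  exact: (proj1 (fP (i, j))).
have BE : \forall t \near F, B (ray t) = Phi t *m M0 *m invmx (Phi t).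
  have := filter_forall (FF R) (fun ij => proj2 (fP ij)); apply: filterS => t E.
  by apply/matrixP => i j; rewrite (E (i, j)) mxE.
exists B; split.
  by apply/sym1_ode; split=> //; exact: (lax_generic KA KB uPhi dPhi BE).
apply: (spectrum_of_char linj r0); apply: (char_generic KB); first by rewrite size_spec rn.
apply: filterS2 BE uPhi => t BtE ut c; rewrite BtE -cM0.
have -> : c%:M - Phi t *m M0 *m invmx (Phi t) = Phi t *m (c%:M - M0) *m invmx (Phi t).
  by rewrite mulmxBr mulmxBl mul_mx_scalar -scalemxAl mulmxV // scalemx1.
by rewrite !det_mulmx det_inv mulrAC mulfV ?mul1r // -unitfE -unitmxE.
Qed.
End Descend.

(** * Boundedness of the solutions of a commutator equation *)
(** The commutator equation as a linear system with unknowns indexed by the entries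
    of b. *)
Lemma comm_entry (K : comPzRingType) n (h b : 'M[K]_n) i j :
  (h *m b - b *m h) i j =
  \sum_(kl : 'I_n * 'I_n) (h i kl.1 *+ (kl.2 == j) - h kl.2 j *+ (kl.1 == i)) * b kl.1 kl.2.
Proof.
rewrite sub_mxE !mxE -(pair_bigA _ (fun k l => (h i k *+ (l == j) - h l j *+ (k == i)) * b k l)) /=.
under [RHS]eq_bigr do under eq_bigr do rewrite mulrBl.
under [RHS]eq_bigr do rewrite sumrB.
rewrite sumrB; congr (_ - _).
  apply: eq_bigr => k _; rewrite (bigD1 j) //= eqxx mulr1n big1 ?addr0 // => l /negbTE ->.
  by rewrite mulr0n mul0r.
rewrite [RHS](bigD1 i) //= [X in _ = _ + X]big1 ?addr0.
  by apply: eq_bigr => l _; rewrite eqxx mulr1n mulrC.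
move=> k /negbTE ki; rewrite big1 // => l _; by rewrite ki mulr0n mul0r.
Qed.

Section Bounded.
Variables (R : realType) (n : nat).
Local Notation C := (C R).

Lemma rc_ge0 (x : R) : (0 <= rc x) = (0 <= x).
Proof. by rewrite -(rc0 R) rc_le. Qed.

Lemma rcX (x : R) m : rc (x ^+ m) = rc x ^+ m.
Proof. by rewrite /rc rmorphXn. Qed.

Lemma sqn_bound (z : C) M : `|z| <= rc M -> sqn z <= M ^+ 2.
Proof.
move=> H; have M0 : 0 <= rc M by apply: le_trans H.
by rewrite -rc_le sqn_norm rcX ler_pXn2r // nnegrE.
Qed.

Lemma norm_bound (z : C) N : sqn z <= N -> `|z| <= rc (1 + N).
Proof.
move=> H; have N0 : 0 <= N by apply: le_trans H; exact: sqn_ge0.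
rewrite -(ler_pXn2r (n := 2)) // ?nnegrE ?rc_ge0 ?addr_ge0 //.
rewrite -sqn_norm -rcX rc_le; apply: le_trans H _; nra.
Qed.

(** The assumption with the power of s says that b has at most a pole.  It bounds b
    on a circle; Gronwall's inequality along the rays carries that bound to the
    whole punctured disc, since the length of the rays is bounded. *)
Lemma lax_bounded (b h : C -> 'M[C]_n) (r beta : R) : 0 < r ->
  (forall s : C, s != 0 -> `|s| < rc r -> forall i j,
     cder (fun s => b s i j) s ((h s *m b s - b s *m h s) i j)) ->
  (forall s : C, s != 0 -> `|s| < rc r -> forall i j, `|h s i j| <= rc beta) ->
  (exists (k : nat) (M : R), forall s : C, s != 0 -> `|s| < rc r -> forall i j, `|s ^+ k * b s i j| <= rc M) ->
  exists N, forall s : C, s != 0 -> `|s| < rc r -> forall i j, `|b s i j| <= rc N.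
Proof.
move=> r0 db hb [k [M bM]].
pose I : finType := ('I_n * 'I_n)%type.
pose t1 := r / 2; have t1I : 0 < t1 < r by rewrite /t1; apply/andP; split; lra.
(* The bound on the circle of radius t1. *)
pose S1 := \sum_(ij : I) (M / t1 ^+ k) ^+ 2.
pose B := S1 * expR ((1 + (2 * beta) ^+ 2) *+ #|I| * r).
exists (1 + B) => s s0 sr i j; apply: norm_bound.
have [t t0 ts] : exists2 t, 0 < t & `|s| = rc t by apply: pos_rc; rewrite normr_gt0.
have tr : t < r by rewrite -rc_lt -ts.
(* The point s is on the ray of direction u, at distance t from the origin. *)
pose u := s / `|s|; have u1 : `|u| = 1 by rewrite /u normrM normfV normr_id mulfV // normr_eq0.
have u0 : u != 0 by rewrite -normr_eq0 u1 oner_neq0.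
have su : s = rc t * u by rewrite -ts /u mulrC mulfVK // normr_eq0.
have pt (x : R) : 0 < x < r -> rc x * u != 0 /\ `|rc x * u| < rc r.
  move=> /andP[x0 xr]; split; first by rewrite mulf_eq0 negb_or rc_eq0 gt_eqF.
  by rewrite normrM u1 mulr1 rc_norm gtr0_norm // rc_lt.
pose z (ij : I) (x : R) : C := b (rc x * u) ij.1 ij.2.
pose m (ij kl : I) (x : R) : C := u * (h (rc x * u) ij.1 kl.1 *+ (kl.2 == ij.2) - h (rc x * u) kl.2 ij.2 *+ (kl.1 == ij.1)).
have dz : forall (ij : I) (x : R), 0 < x < r -> rder (z ij) x (\sum_(kl : I) m ij kl x * z kl x).
  move=> ij x xI; have [p0 pr] := pt _ xI.
  have dl : rder (fun y => rc y * u) x (1 * u + rc x * 0).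
    exact: (qderM (dnbhsR_filter R) (@cvg_rc_dnbhs R) (@near_rc_neq0 R) (rder_rc x) (qder_cst (dnbhsR_filter R) (@rc R) u)).
  rewrite mul1r mulr0 addr0 in dl.
  have := cder_curve dl (db _ p0 pr ij.1 ij.2); rewrite comm_entry mulr_sumr /m.
  by under eq_bigr do rewrite mulrA.
have mb : forall (ij kl : I) (x : R), 0 < x < r -> sqn (m ij kl x) <= (2 * beta) ^+ 2.
  move=> ij kl x xI; have [p0 pr] := pt x xI; apply: sqn_bound; rewrite normrM u1 mul1r.
  apply: le_trans (ler_normB _ _) _.
  have b0 : 0 <= rc beta by apply: le_trans (hb _ p0 pr ij.1 ij.1).
  have nb (w : C) (e : bool) : `|w| <= rc beta -> `|w *+ e| <= rc beta by case: e; rewrite ?mulr0n ?normr0.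
  have -> : rc (2 * beta) = rc beta + rc beta by rewrite -rcD; congr rc; ring.
  by apply: lerD; apply: nb; exact: (hb _ p0 pr).
have tI : 0 < t < r by rewrite t0.
have G := system_gronwall dz mb tI t1I.
have S1b : \sum_(kl : I) sqn (z kl t1) <= S1.
  apply: ler_sum => kl _; apply: sqn_bound; have [p0 pr] := pt t1 t1I.
  have := bM _ p0 pr kl.1 kl.2; rewrite normrM normrX normrM u1 mulr1 rc_norm.
  have t10 : 0 < t1 by case/andP: t1I.
  have t1k : 0 < rc (t1 ^+ k) by rewrite -(rc0 R) rc_lt exprn_gt0.
  have E := rcX t1 k.
  rewrite (gtr0_norm t10) -E => H; rewrite rcM rcV ler_pdivlMr // mulrC; exact: H.
have zs : sqn (b s i j) <= \sum_(kl : I) sqn (z kl t).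
  rewrite (bigD1 (i, j)) //= /z /= -su lerDl sumr_ge0 // => kl _; exact: sqn_ge0.
apply: (le_trans zs); apply: (le_trans G); rewrite /B; apply: ler_pM.
- by apply: sumr_ge0 => kl _; exact: sqn_ge0.
- exact: expR_ge0.
- exact: S1b.
- rewrite ler_expR; apply: ler_wpM2l; first by rewrite mulrn_wge0 // addr_ge0 // sqr_ge0.
  by case/andP: t1I => t10 t1r; rewrite ler_norml; apply/andP; split; lra.
Qed.
End Bounded.

(** * From a decomposer symmetry to block-diagonal Galois matrices *)
Lemma mxvec_entry (K : Type) p q (Y : 'M[K]_(p, q)) a b : (mxvec Y)^T (mxvec_index a b) 0 = Y a b.
Proof. by rewrite mxE mxvecE. Qed.

Section Limit.
Variable R : realType.
Local Notation C := (C R).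

(** The Cauchy criterion, for which completeness of the real numbers suffices. *)
Lemma real_puncture_limit (g : C -> R) (r M : R) : 0 < r ->
  (forall r', 0 < r' <= r -> forall z u : C, z != 0 -> u != 0 -> `|z| < rc r' -> `|u| < rc r' ->
     `|g u - g z| <= M * r') ->
  exists l : R, g @ (0 : C)^' --> l.
Proof.
move=> r0 H.
have FF0 : ProperFilter (g @ (0 : C)^') by apply: fmap_proper_filter; exact: dnbhsC_filter.
suff : cvg (g @ (0 : C)^') by move=> c; exists (lim (g @ (0 : C)^')).
apply: cauchy_cvg; apply: cauchy_exP => e e0.
pose r' := Num.min r (e / (2 * (1 + `|M|))).
have d0 : 0 < 2 * (1 + `|M|) by rewrite mulr_gt0 // ltr_wpDr.
have r'0 : 0 < r' by rewrite lt_min r0 divr_gt0.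
have r'r : 0 < r' <= r by rewrite r'0 ge_min lexx.
pose z0 : C := rc (r' / 2).
have z00 : z0 != 0 by rewrite rc_eq0 gt_eqF // divr_gt0.
have z0r : `|z0| < rc r' by rewrite rc_norm rc_lt gtr0_norm ?divr_gt0 //; lra.
exists (g z0); apply/near_dnbhs0; exists r' => // u u0 ur.
rewrite /ball /= distrC; apply: le_lt_trans (H r' r'r _ _ z00 u0 z0r ur) _.
apply: (@le_lt_trans _ _ ((1 + `|M|) * r')).
  by rewrite ler_pM2r //; apply: le_trans (ler_norm _) _; rewrite lerDr.
apply: (@le_lt_trans _ _ ((1 + `|M|) * (e / (2 * (1 + `|M|))))).
  by rewrite ler_pM2l ?ge_min ?lexx ?orbT // ltr_wpDr.
have m0 : 1 + `|M| != 0 by rewrite gt_eqF // ltr_wpDr.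
have -> : (1 + `|M|) * (e / (2 * (1 + `|M|))) = e / 2 by field.
lra.
Qed.

Lemma puncture_limit (G : C -> C) (r M : R) : 0 < r ->
  (forall s : C, s != 0 -> `|s| < rc r -> exists2 d, cder G s d & `|d| <= rc M) ->
  exists l : C, G @ (0 : C)^' --> l.
Proof.
move=> r0 H.
have L r' : 0 < r' <= r -> forall z u : C, z != 0 -> u != 0 -> `|z| < rc r' -> `|u| < rc r' ->
    `|G u - G z| <= rc (8 * M * r').
  move=> /andP[r'0 r'r]; apply: punctured_lip => s s0 sr; apply: H => //.
  by apply: lt_le_trans sr _; rewrite rc_le.
have [a aP] : exists a : R, (fun s => complex.Re (G s)) @ (0 : C)^' --> a.
  apply: (real_puncture_limit (M := 8 * M) r0) => r' r'I z u z0 u0 zr ur.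
  rewrite -rc_le -Re_opp -Re_add; apply: le_trans (Re_norm _) _; exact: L.
have [b bP] : exists b : R, (fun s => complex.Im (G s)) @ (0 : C)^' --> b.
  apply: (real_puncture_limit (M := 8 * M) r0) => r' r'I z u z0 u0 zr ur.
  rewrite -rc_le -Im_opp -Im_add; apply: le_trans (Im_norm _) _; exact: L.
have FN := dnbhsC_filter R.
by exists (Complex a b : C); apply: ReIm_cvg.
Qed.
End Limit.

Section Conjugation.
Variables (R : realType) (n : nat).
Local Notation C := (C R).

Lemma conjugation_rep : algebraic_rep (fun s : 'M[C]_n => sandwich s (invmx s)).
Proof.
apply: (sandwich_rep (L := id) (Q := @invmx _ n)) => //.
- exact: invmx1.
- move=> s t us ut; by rewrite -{1}(invmxK s) invmx_Vmul // unitmx_inv.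
- by move=> i j; exists (fun s => s i j); [exact: Reg_coord|].
- by move=> i j; have [f rf fE] := @reg_inv R n i j; exists f.
Qed.

Lemma mxqder_vec p q (T : Type) (F : set_system T) (k : T -> C) (u : T -> 'M[C]_(p, q)) s0 M :
  mxqder F k u s0 M -> mxqder F k (fun x => (mxvec (u x))^T) (mxvec s0)^T (mxvec M)^T.
Proof.
move=> H i j; case/mxvec_indexP: i => a b; rewrite (ord1 j) !mxvec_entry.
have -> : (fun x => (mxvec (u x))^T (mxvec_index a b) 0) = (fun x => u x a b).
  by apply/funext => x; rewrite mxvec_entry.
exact: H.
Qed.

(** The derivative at 0 of h |-> (1 + h M) X (1 + h M)^-1. *)
Lemma conjugation_diff (M X : 'M[C]_n) :
  rep_diff (fun s : 'M[C]_n => sandwich s (invmx s)) M *m (mxvec X)^T = (mxvec (M *m X - X *m M))^T.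
Proof.
have D1 := rep_qder conjugation_rep (dnbhsC_filter R) (@cvg_id_dnbhsC R) (@near_dnbhsC_neq0 R) (@line_qder R n M).
have H1 := mxqderM (dnbhsC_filter R) (@cvg_id_dnbhsC R) (@near_dnbhsC_neq0 R) D1 (mxqder_cst (dnbhsC_filter R) id (mxvec X)^T).
rewrite mulmx_add0 (mul1mx (mxvec X)^T) in H1.
have L := @line_qder R n M.
have LX := mxqderM (dnbhsC_filter R) (@cvg_id_dnbhsC R) (@near_dnbhsC_neq0 R) L (mxqder_cst (dnbhsC_filter R) id X).
have LI := mxqder_inv (dnbhsC_filter R) (@cvg_id_dnbhsC R) (@near_dnbhsC_neq0 R) (unitmx1 C n) L.
have H2 := mxqderM (dnbhsC_filter R) (@cvg_id_dnbhsC R) (@near_dnbhsC_neq0 R) LX LI.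
rewrite mulmx_add0 invmx1 !mulmx1 !mul1mx mulmxN in H2.
apply: (mxqder_unique (dnbhsC_filter R) H1); apply: (mxqder_eq (dnbhsC_filter R) _ (mxqder_vec H2)).
apply: nearW => h; exact: sandwichE.
Qed.
End Conjugation.

Section Symmetry.
Variable R : realType.
Local Notation C := (C R).
Local Notation CP1 := (CP1 R).
Variables (U : set CP1) (K : set (C -> C)) (FK : function_field U K).
Variables (x0 : CP1) (Ux0 : U x0).
Variables (n : nat) (A B : C -> 'M[C]_n).
Hypotheses (nsA : nonsingular A x0) (KB : mx_over K B).
Hypothesis ode : generically U (fun x => derive1 B x = A x *m B x - B x *m A x).
Local Notation b := (fun s => B (loc x0 s)).

(** A symmetry is meromorphic and solves a commutator equation with bounded
    coefficients, so it is bounded ([lax_bounded]); then its derivative is bounded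
    and it satisfies the Cauchy criterion at the base point. *)
Lemma symmetry_limit : exists B0 : 'M[C]_n, forall i j, (fun s => B (loc x0 s) i j) @ (0 : C)^' --> B0 i j.
Proof.
have FN := dnbhsC_filter R.
have [h [hc hA]] := nonsing_loc nsA.
have db : \forall s \near (0 : C)^', forall i j,
    cder (fun s => B (loc x0 s) i j) s ((h s *m b s - b s *m h s) i j).
  have d1 : \forall s \near (0 : C)^', forall i j, cder (fun s => B (loc x0 s) i j) s
      (dloc x0 s * derive1 (fun x => B x i j) (loc x0 s)).
    apply: (filter_forall FN) => i; apply: (filter_forall FN) => j.
    exact: (mero_derive1_loc (ff_meromorphic FK (KB i j)) Ux0).
  have d2 := proj1 (near_pnbhs x0 _) (mx_derive1_near FK KB Ux0).
  (* The factor relating derivatives in s and in x is absorbed by h. *)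
  have d3 := proj1 (near_pnbhs x0 _) (ode Ux0).
  apply: filterS2 (filterI d1 hA) (filterI d2 d3) => s [e1 e2] [e3 e4] i j.
  rewrite -e2 -scalemxAl -scalemxAr -scalerBr -e4 [X in cder _ _ X]mxE.
  have := e1 i j; by rewrite (cder_derive1 (e3 i j)).
have hb : exists beta : R, \forall s \near (0 : C), forall i j, `|h s i j| <= rc beta.
  have /choice[g gP] (ij : 'I_n * 'I_n) : exists g : R, \forall s \near (0 : C), `|h s ij.1 ij.2| <= rc g.
    have c0 : continuous_at (0 : C) (fun z => h z ij.1 ij.2) := nbhs_singleton (hc ij.1 ij.2).
    have /pos_rc[g g0 gE] : 0 < `|h 0 ij.1 ij.2| + 1 by rewrite ltr_wpDl.
    exists g; rewrite -gE.
    have := c0 => /cvgrPdist_lt /(_ 1 ltr01); apply: filterS => s H.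
    rewrite -lerBlDl; apply: le_trans (ltW H); rewrite distrC; exact: lerB_dist.
  exists (\sum_ij `|g ij|).
  have FN0 : Filter (nbhs (0 : C)) by exact: nbhs_filter.
  have := filter_forall FN0 gP; apply: filterS => s H i j.
  apply: le_trans (H (i, j)) _; rewrite rc_le; apply: le_trans (ler_norm _) _.
  by rewrite (bigD1 (i, j)) //= lerDl sumr_ge0.
have bb : exists (k : nat) (M : R), \forall s \near (0 : C)^', forall i j, `|s ^+ k * B (loc x0 s) i j| <= rc M.
  have /choice[g gP] (ij : 'I_n * 'I_n) : exists g : nat * R, \forall s \near (0 : C)^',
      `|s ^+ g.1 * B (loc x0 s) ij.1 ij.2| <= rc g.2.
    have [k [H [dH HE]]] := mero_loc (ff_meromorphic FK (KB ij.1 ij.2)) Ux0.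
    have c0 : continuous_at (0 : C) H := cder_cts (derivable_cder (nbhs_singleton dH)).
    have /pos_rc[g g0 gE] : 0 < `|H 0| + 1 by rewrite ltr_wpDl.
    exists (k, g); rewrite /= -gE.
    have := c0 => /cvgrPdist_lt /(_ 1 ltr01) /nbhs0_dnbhs H1.
    apply: filterS2 HE H1 => s -> H1.
    rewrite -lerBlDl; apply: le_trans (ltW H1); rewrite distrC; exact: lerB_dist.
  exists (\sum_ij (g ij).1)%N, (\sum_ij `|(g ij).2|).
  have s1 : \forall s \near (0 : C)^', `|s| <= 1.
    apply/near_dnbhs0; exists 1 => // s _ /ltW; by rewrite (_ : rc 1 = 1).
  have gP' := filter_forall FN gP.
  apply: filterS2 s1 gP' => s s1' H i j.
  apply: le_trans (_ : `|s ^+ (g (i, j)).1 * B (loc x0 s) i j| <= _).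
    rewrite !normrM ler_wpM2r // !normrX ler_wiXn2l //.
    by rewrite (bigD1 (i, j)) //= leq_addr.
  apply: le_trans (H (i, j)) _; rewrite rc_le; apply: le_trans (ler_norm _) _.
  by rewrite [leRHS](bigD1 (i, j)) //= lerDl sumr_ge0.
have [beta hb'] := hb; have [k [M bM]] := bb.
have [r r0 Hr] := proj1 (near_dnbhs0 _) (filterI db (filterI (nbhs0_dnbhs hb') bM)).
have [N bN] : exists N, forall s : C, s != 0 -> `|s| < rc r -> forall i j, `|b s i j| <= rc N.
  apply: (lax_bounded r0 (h := h) (beta := beta)) => [s s0 sr|s s0 sr|].
  - exact: (proj1 (Hr s s0 sr)).
  - exact: (proj1 (proj2 (Hr s s0 sr))).
  - exists k, M => s s0 sr; exact: (proj2 (proj2 (Hr s s0 sr))).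
have /choice[l lP] (ij : 'I_n * 'I_n) : exists l : C, (fun s => B (loc x0 s) ij.1 ij.2) @ (0 : C)^' --> l.
  apply: (puncture_limit (M := \sum_(kl : 'I_n * 'I_n) 2 * beta * N) r0) => s s0 sr.
  have [d [hs _]] := Hr s s0 sr; exists ((h s *m b s - b s *m h s) ij.1 ij.2); first exact: d.
  rewrite comm_entry; apply: le_trans (ler_norm_sum _ _ _) _.
  rewrite (big_morph (@rc R) (@rcD R) (rc0 R)); apply: ler_sum => kl _.
  rewrite normrM rcM; apply: ler_pM => //; last exact: bN.
  apply: le_trans (ler_normB _ _) _.
  have b0 : 0 <= rc beta by apply: le_trans (hs kl.1 kl.1).
  have nb (w : C) (e : bool) : `|w| <= rc beta -> `|w *+ e| <= rc beta by case: e; rewrite ?mulr0n ?normr0.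
  have -> : rc (2 * beta) = rc beta + rc beta by rewrite -rcD; congr rc; ring.
  by apply: lerD; apply: nb; exact: hs.
by exists (\matrix_(i, j) l (i, j)) => i j; rewrite mxE; exact: (lP (i, j)).
Qed.

Variable B0 : 'M[C]_n.
Hypothesis BB0 : forall i j, (fun s => B (loc x0 s) i j) @ (0 : C)^' --> B0 i j.

(** The entries of B form a rational solution of the system attached to the
    conjugation representation: its value at the base point is fixed by the
    Galois group. *)
Lemma Gal_commutes s : Gal U K A x0 s -> comm_mx B0 s.
Proof.
move=> [us Gs]; have [Gr _] := Gs _ _ (@conjugation_rep R n).
pose v x : 'cV[C]_(n * n) := (mxvec (B x))^T.
have vS : rational_solution U K A (fun s : 'M[C]_n => sandwich s (invmx s)) v.
  split.
    move=> i j; case/mxvec_indexP: i => a c; rewrite (ord1 j).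
    have -> : (fun x => v x (mxvec_index a c) 0) = (fun x => B x a c).
      by apply/funext => x; rewrite /v mxvec_entry.
    exact: KB.
  have dB p (Up : U p) := mx_derive1_near FK KB Up.
  apply: (generically_sub _ (generically_and ode dB)) => x [e d]; rewrite conjugation_diff -e.
  apply: mx_derive1 => i j; case/mxvec_indexP: i => a c; rewrite (ord1 j).
  have -> : (fun x => v x (mxvec_index a c) 0) = (fun x => B x a c).
    by apply/funext => y; rewrite /v mxvec_entry.
  by rewrite mxvec_entry; exact: d.
have vv0 : value_at x0 v (mxvec B0)^T.
  have FP := pnbhs_proper x0.
  apply/cvg_mxP => i j; case/mxvec_indexP: i => a c; rewrite (ord1 j) mxvec_entry.
  have -> : (fun x => v x (mxvec_index a c) 0) = (fun x => B x a c).
    by apply/funext => y; rewrite /v mxvec_entry.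
  by have Hac := @BB0 a c; move=> P /Hac HP; apply/near_pnbhs; exact: HP.
have := Gr v _ vS vv0; rewrite sandwichE => /trmx_inj/(can_inj mxvecK) E.
by rewrite /comm_mx -{1}E mulmxKV.
Qed.

Lemma det_cvg (c : C) : (fun s => \det (c%:M - B (loc x0 s))) @ (0 : C)^' --> \det (c%:M - B0).
Proof.
have FN := dnbhsC_filter R; apply: (sum_cvg FN) => p; apply: cvgM; first exact: cvg_cst.
have ec i j : (fun s => (c%:M - B (loc x0 s)) i j) @ (0 : C)^' --> (c%:M - B0) i j.
  have -> : (fun s => (c%:M - B (loc x0 s)) i j) = (fun s => (c%:M : 'M[C]_n) i j - B (loc x0 s) i j).
    by apply/funext => s; rewrite sub_mxE.
  by rewrite sub_mxE; apply: cvgB; [exact: cvg_cst|exact: BB0].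
have pc (f : 'I_n -> 'I_n) (q : seq 'I_n) : (fun s => \prod_(i <- q) (c%:M - B (loc x0 s)) i (f i)) @ (0 : C)^' -->
    \prod_(i <- q) (c%:M - B0) i (f i).
  elim: q => [|i q IH]; first by rewrite big_nil; under eq_fun do rewrite big_nil; exact: cvg_cst.
  rewrite big_cons; under eq_fun do rewrite big_cons.
  exact: (cvgM (ec i (f i)) IH).
exact: pc.
Qed.

Lemma limit_char (p : {poly C}) : size p = n.+1 -> generically U (fun x => char_poly (B x) = p) ->
  char_poly B0 = p.
Proof.
move=> sp H; apply: char_poly_interp => // i.
have FN := dnbhsC_filter R.
have L : (fun s => \det (i%:R%:M - B (loc x0 s))) @ (0 : C)^' --> p.[i%:R].
  apply: cvg_near_cst; have := proj1 (near_pnbhs x0 _) (H x0 Ux0).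
  by apply: filterS => s <-; rewrite char_horner.
apply: (@cvg_unique _ _ ((fun s => \det (i%:R%:M - B (loc x0 s))) @ (0 : C)^')).
- exact: norm_hausdorff.
- exact: det_cvg.
- exact: L.
Qed.
End Symmetry.

Theorem decomposer_block_diagonal (R : realType) (U : set (CP1 R)) (K : set (C R -> C R))
  (FK : function_field U K) (x0 : CP1 R) (Ux0 : U x0) n (n0 : (0 < n)%N) (A B : C R -> 'M[C R]_n)
  k (r : 'I_k -> nat) (rn : (\sum_i r i)%N = n) :
  nonsingular A x0 -> sym1 U K A B -> has_spectrum U B r ->
  conjugated_to_block_diag rn (Gal U K A x0).
Proof.
move=> nsA /(sym1_ode FK)[KB ode] [l [linj _ lr]].
have [B0 BB0] := symmetry_limit FK Ux0 nsA KB ode.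
have cB0 : char_poly B0 = spec_poly l r.
  apply: (limit_char Ux0 BB0); first by rewrite size_spec rn.
  apply: (generically_sub _ (generically_all lr)) => x; exact: spec_unique.
have [P uP HP] := commutant_block rn linj cB0 n0.
exists P => // s Gs.
exact: (HP s (proj1 Gs) (Gal_commutes FK KB ode BB0 Gs)).
Qed.

Theorem theorem6p10 (R : realType) (U : set (CP1 R))
    (U_nonempty : U !=set0) (U_connected : connected U) (U_open : open U)
    (K : set (C R -> C R)) (K_function_field : function_field U K)
    (n : nat) (n_gt0 : (0 < n)%N)
    (A : C R -> 'M[C R]_n) (A_over_K : mx_over K A)
    (x0 : CP1 R) (U_x0 : U x0) (x0_nonsingular : nonsingular A x0)
    (k : nat) (k_ge2 : (2 <= k)%N) (r : 'I_k -> nat)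
    (r_gt0 : forall i, (0 < r i)%N) (r_sum : (\sum_i r i)%N = n) :
  (exists B : C R -> 'M[C R]_n,
     decomposer_symmetry U K A B /\ has_spectrum U B r)
  <->
  conjugated_to_block_diag r_sum (Gal U K A x0).
Proof.
split=> [[B [[symB _] spB]]|HG].
  exact: (decomposer_block_diagonal K_function_field U_x0 n_gt0 r_sum x0_nonsingular symB spB).
have [B [symB spB]] := block_diagonal_decomposer K_function_field U_connected U_x0
  A_over_K x0_nonsingular r_gt0 HG.
exists B; split=> //; split=> //; have [l [linj el _]] := spB.
case: k k_ge2 l linj el {r_gt0 r_sum HG spB r} => [|[|k]] // _ l linj el.
exists (l ord0), (l ord_max); split; try by apply/el; eexists.
by rewrite (inj_eq linj).
Qed.
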